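(* Let $L$ be a nonzero nilpotent Lie superalgebra with $\dim L=(m\mid n)$. Then $s(L)=2$ if and only if $L$ is isomorphic to one of the following: \begin{itemize} \item $H(p,q)\oplus A(m-2p-1\mid n-q)$ for some $p,q\ge 0$ with $p+q\ge 2$; \item $H(0,1)\oplus A(m-1\mid n-1)$; \item $H_1\oplus A(m-1\mid n-2)$; \item $L_{4,0}^1$; \item $L_{5,0}^2\oplus A(1\mid 0)$; \item $L_{5,0}^2\oplus A(0\mid 1)$. \end{itemize}
   Context: All Lie superalgebras are finite dimensional over $\mathbb{C}$. $\dim L=(m\mid n)$ means $\dim L_{\bar 0}=m$, $\dim L_{\bar 1}=n$. Isomorphisms are bijective even (degree-preserving) homomorphisms. $L$ is nilpotent if its descending central sequence $L^0=L$, $L^{k+1}=[L^k,L]$ reaches $0$. Schur multiplier: for a free presentation $0\to R\to F\to L\to 0$ with $F$ a free Lie superalgebra, $\mathcal M(L)=\frac{[F,F]\cap R}{[F,R]}$ (independent of the presentation up to isomorphism); $\dim\mathcal M(L)$ is its total dimension (even plus odd). For $\dim L=(m\mid n)$ define $s(L)=\frac12(m+n-2)(m+n-1)+n+1-\dim\mathcal M(L)$. Brackets below are listed up to graded skew-symmetry, unlisted ones being zero. $A(k\mid l)$ ($k,l\ge 0$) is the abelian Lie superalgebra of dimension $(k\mid l)$; an entry involving $A(k\mid l)$ occurs only when $k,l\ge 0$. $H(p,q)$ ($p,q\ge0$, $p+q\ge1$), of dimension $(2p+1\mid q)$: even basis $x_1,\dots,x_{2p},z$, odd basis $y_1,\dots,y_q$,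 brackets $[x_i,x_{p+i}]=z$ for $1\le i\le p$ and $[y_j,y_j]=z$ for $1\le j\le q$. $H_k$ ($k\ge1$), of dimension $(k\mid k+1)$: even basis $x_1,\dots,x_k$, odd basis $y_1,\dots,y_k,z$, brackets $[x_i,y_i]=z$ for $1\le i\le k$. $L_{4,0}^1$: even basis $x_0,y_0,z_0,v_0$ (no odd part), $[x_0,y_0]=z_0$, $[y_0,z_0]=v_0$. $L_{5,0}^2$: even basis $x_0,y_0,z_0,v_0,w_0$ (no odd part), $[x_0,y_0]=v_0$, $[x_0,z_0]=w_0$. *)

(* Defs.v *)
From mathcomp Require Import all_boot all_order all_algebra.
From mathcomp Require Import classical_sets reals complex.

Set Implicit Arguments.
Unset Strict Implicit.
Unset Printing Implicit Defensive.

Import Order.TTheory GRing.Theory Num.Theory.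

Local Open Scope classical_set_scope.
Local Open Scope ring_scope.

(* A Lie superalgebra structure on the vector space [V], not necessarily of
   finite dimension.  Parities are booleans: [false] is even, [true] is odd,
   and they add with [addb].  The ground field has characteristic 0, so no
   extra axioms on [[x,x]] or [[x,[x,x]]] are needed. *)
Record lieSuper (K : numFieldType) (V : lmodType K) := LieSuper {
  homog : bool -> set V;
  br : V -> V -> V;
  homog_lin : forall b (a : K) x y,
    homog b x -> homog b y -> homog b (a *: x + y);
  homog_dec : forall v, exists x y, [/\ homog false x, homog true y & v = x + y];
  homog_cap : forall v, homog false v -> homog true v -> v = 0;
  br_linl : forall (a : K) x y z, br (a *: x + y) z = a *: br x z + br y z;
  br_linr : forall (a : K) x y z, br z (a *: x + y) = a *: br z x + br z y;
  br_homog : forall b c x y, homog b x -> homog c y -> homog (b (+) c) (br x y);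
  br_skew : forall b c x y, homog b x -> homog c y ->
    br x y = - ((-1) ^+ (b && c) *: br y x);
  br_jacobi : forall b c d x y z, homog b x -> homog c y -> homog d z ->
    br x (br y z) = br (br x y) z + (-1) ^+ (b && c) *: br y (br x z) }.

Section Basic.
Variable K : numFieldType.
Implicit Types V W : lmodType K.

Definition lspan V (A : set V) : set V :=
  [set v | exists (k : nat) (c : 'I_k -> K) (w : 'I_k -> V),
     (forall i, A (w i)) /\ v = \sum_i c i *: w i].

Definition brset V (L : lieSuper V) (A B : set V) : set V :=
  lspan [set v | exists x y, [/\ A x, B y & v = br L x y]].

Fixpoint lcs V (L : lieSuper V) (k : nat) : set V :=
  if k is k'.+1 then brset L (lcs L k') setT else setT.

Definition nilpotent V (L : lieSuper V) : Prop :=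
  exists k, lcs L k = [set 0].

Definition lie_hom V W (L : lieSuper V) (M : lieSuper W)
    (f : {linear V -> W}) : Prop :=
  (forall b x, homog L b x -> homog M b (f x)) /\
  (forall x y, f (br L x y) = br M (f x) (f y)).

Definition lie_iso V W (L : lieSuper V) (M : lieSuper W) : Prop :=
  exists f : {linear V -> W}, lie_hom L M f /\ bijective f.

(* [F] is free on the family [i] of homogeneous elements of parities [par]. *)
Definition is_free W (F : lieSuper W) (X : Type) (par : X -> bool)
    (i : X -> W) : Prop :=
  (forall x, homog F (par x) (i x)) /\
  (forall (V : lmodType K) (L : lieSuper V) (g : X -> V),
     (forall x, homog L (par x) (g x)) ->
     exists f : {linear W -> V},
       [/\ lie_hom F L f, forall x, f (i x) = g x &
           forall f' : {linear W -> V},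
             lie_hom F L f' -> (forall x, f' (i x) = g x) -> f' =1 f]).

Record free_presentation V (L : lieSuper V) := FreePresentation {
  fp_space : lmodType K;
  fp_alg : lieSuper fp_space;
  fp_gen : Type;
  fp_par : fp_gen -> bool;
  fp_incl : fp_gen -> fp_space;
  fp_free : is_free fp_alg fp_par fp_incl;
  fp_proj : {linear fp_space -> V};
  fp_hom : lie_hom fp_alg L fp_proj;
  fp_surj : forall v, exists w, fp_proj w = v }.

Definition fp_ker V (L : lieSuper V) (P : free_presentation L) :
    set (fp_space P) := [set w | fp_proj P w = 0].
Arguments fp_ker {V L} P.

(* [dim (A / B) = d], for subspaces [B `<=` A]: there is a family of [d]
   elements of [A] whose classes form a basis of [A / B]. *)
Definition quo_dim V (A B : set V) (d : nat) : Prop :=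
  exists e : 'I_d -> V,
    [/\ forall i, A (e i),
        forall c : 'I_d -> K, B (\sum_i c i *: e i) -> forall i, c i = 0 &
        forall v, A v -> exists c : 'I_d -> K, B (v - \sum_i c i *: e i)].

Definition schur_dim V (L : lieSuper V) (P : free_presentation L) (d : nat) :
    Prop :=
  quo_dim (brset (fp_alg P) setT setT `&` fp_ker P)
          (brset (fp_alg P) setT (fp_ker P)) d.

Definition sdim (V : vectType K) (L : lieSuper V) (m n : nat) : Prop :=
  exists U0 U1 : {vspace V},
    [/\ homog L false = [set v | v \in U0], homog L true = [set v | v \in U1],
        \dim U0 = m & \dim U1 = n].

(* The multiplier is computed from the presentation [P]. *)
Definition s_invariant (V : vectType K) (L : lieSuper V)
    (P : free_presentation L) (s : rat) : Prop :=
  exists m n d : nat, [/\ sdim L m n, schur_dim P d &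
    s = (m%:R + n%:R - 2) * (m%:R + n%:R - 1) / 2 + n%:R + 1 - d%:R].

End Basic.

Section DirectSum.
Variables (K : numFieldType) (V W : lmodType K).
Variables (L : lieSuper V) (M : lieSuper W).

Definition dsum_homog b : set (V * W)%type :=
  [set u | homog L b u.1 /\ homog M b u.2].
Definition dsum_br (u v : V * W) : V * W := (br L u.1 v.1, br M u.2 v.2).

Lemma dsum_lin b (a : K) x y :
  dsum_homog b x -> dsum_homog b y -> dsum_homog b (a *: x + y).
Proof. by move=> [? ?] [? ?]; split; apply: homog_lin. Qed.

Lemma dsum_dec v :
  exists x y, [/\ dsum_homog false x, dsum_homog true y & v = x + y].
Proof.
case: v => v w; have [x [y [hx hy ->]]] := homog_dec L v.
have [x' [y' [hx' hy' ->]]] := homog_dec M w.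
by exists (x, x'), (y, y').
Qed.

Lemma dsum_cap v : dsum_homog false v -> dsum_homog true v -> v = 0.
Proof.
case: v => v w [/= v0 w0] [/= v1 w1].
by rewrite (homog_cap v0 v1) (homog_cap w0 w1).
Qed.

Lemma dsum_linl (a : K) x y z :
  dsum_br (a *: x + y) z = a *: dsum_br x z + dsum_br y z.
Proof. by rewrite /dsum_br /= !br_linl. Qed.

Lemma dsum_linr (a : K) x y z :
  dsum_br z (a *: x + y) = a *: dsum_br z x + dsum_br z y.
Proof. by rewrite /dsum_br /= !br_linr. Qed.

Lemma dsum_br_homog b c x y :
  dsum_homog b x -> dsum_homog c y -> dsum_homog (b (+) c) (dsum_br x y).
Proof. by move=> [? ?] [? ?]; split; apply: br_homog. Qed.

Lemma dsum_skew b c x y : dsum_homog b x -> dsum_homog c y ->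
  dsum_br x y = - ((-1) ^+ (b && c) *: dsum_br y x).
Proof.
move=> [hx hx'] [hy hy'].
by rewrite /dsum_br (br_skew hx hy) (br_skew hx' hy').
Qed.

Lemma dsum_jacobi b c d x y z :
  dsum_homog b x -> dsum_homog c y -> dsum_homog d z ->
  dsum_br x (dsum_br y z) =
  dsum_br (dsum_br x y) z + (-1) ^+ (b && c) *: dsum_br y (dsum_br x z).
Proof.
move=> [hx hx'] [hy hy'] [hz hz'].
by rewrite /dsum_br /= (br_jacobi hx hy hz) (br_jacobi hx' hy' hz').
Qed.

Definition dsum : lieSuper (V * W)%type :=
  LieSuper dsum_lin dsum_dec dsum_cap dsum_linl dsum_linr dsum_br_homog
    dsum_skew dsum_jacobi.

End DirectSum.

(* The Lie superalgebra with even basis indexed by [E], odd basis indexed by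
   [O], and brackets of basis elements given by the table [t]. *)
Section Table.
Variables (K : numFieldType) (E O : finType).
Local Notation I := (E + O)%type.

Definition tspace : lmodType K := {ffun I -> K^o}.

Definition tpar (i : I) : bool := if i is inr _ then true else false.

Definition tvec (i : I) : tspace := [ffun j => (j == i)%:R].

Variable t : I -> I -> tspace.

Definition thomog (b : bool) : set tspace :=
  [set u | forall i, tpar i != b -> u i = 0].

Definition tbr (u v : tspace) : tspace := \sum_i \sum_j (u i * v j) *: t i j.

Hypothesis t_homog : forall i j, thomog (tpar i (+) tpar j) (t i j).
Hypothesis t_skew :
  forall i j, t i j = - ((-1) ^+ (tpar i && tpar j) *: t j i).
Hypothesis t_jacobi : forall i j k,
  tbr (tvec i) (t j k) =
  tbr (t i j) (tvec k) + (-1) ^+ (tpar i && tpar j) *: tbr (tvec j) (t i k).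

Lemma tbr_linl (a : K) x y z : tbr (a *: x + y) z = a *: tbr x z + tbr y z.
Proof.
rewrite /tbr scaler_sumr -big_split; apply: eq_bigr => i _ /=.
rewrite scaler_sumr -big_split; apply: eq_bigr => j _ /=.
by rewrite !ffunE scalerA -scalerDl mulrDl mulrA.
Qed.

Lemma tbr_linr (a : K) x y z : tbr z (a *: x + y) = a *: tbr z x + tbr z y.
Proof.
rewrite /tbr scaler_sumr -big_split; apply: eq_bigr => i _ /=.
rewrite scaler_sumr -big_split; apply: eq_bigr => j _ /=.
by rewrite !ffunE scalerA -scalerDl mulrDr [z i * _]mulrCA.
Qed.

Lemma tbr0l z : tbr 0 z = 0.
Proof. by apply: big1 => i _; apply: big1 => j _; rewrite ffunE mul0r scale0r. Qed.

Lemma tbr0r z : tbr z 0 = 0.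
Proof. by apply: big1 => i _; apply: big1 => j _; rewrite ffunE mulr0 scale0r. Qed.

Lemma tbr_suml (J : finType) (c : J -> K) (w : J -> tspace) z :
  tbr (\sum_j c j *: w j) z = \sum_j c j *: tbr (w j) z.
Proof.
elim/big_rec2: _ => [|j y x _ IH]; first exact: tbr0l.
by rewrite tbr_linl IH.
Qed.

Lemma tbr_sumr (J : finType) (c : J -> K) (w : J -> tspace) z :
  tbr z (\sum_j c j *: w j) = \sum_j c j *: tbr z (w j).
Proof.
elim/big_rec2: _ => [|j y x _ IH]; first exact: tbr0r.
by rewrite tbr_linr IH.
Qed.

Lemma tvec_sum (u : tspace) : u = \sum_i u i *: tvec i.
Proof.
apply/ffunP => k; rewrite sum_ffunE (bigD1 k) //= !ffunE eqxx big1.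
  by rewrite addr0 /GRing.scale /= mulr1.
by move=> i ik; rewrite !ffunE eq_sym (negPf ik) scaler0.
Qed.

Lemma tbr_vec i j : tbr (tvec i) (tvec j) = t i j.
Proof.
rewrite /tbr (bigD1 i) //= (bigD1 j) //= !ffunE !eqxx mulr1 scale1r.
rewrite !big1 ?addr0 // => [k ki|k kj].
  by apply: big1 => l _; rewrite ffunE (negPf ki) mul0r scale0r.
by rewrite [tvec j k]ffunE (negPf kj) mulr0 scale0r.
Qed.

Lemma tbr_sum2 u v : tbr u v = \sum_i u i *: \sum_j v j *: t i j.
Proof.
by apply: eq_bigr => i _; rewrite scaler_sumr; apply: eq_bigr => j _;
  rewrite scalerA.
Qed.

Lemma thomog_lin b (a : K) x y :
  thomog b x -> thomog b y -> thomog b (a *: x + y).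
Proof. by move=> hx hy i hi; rewrite !ffunE hx // hy // scaler0 addr0. Qed.

Lemma thomog_par b u i : thomog b u -> u i != 0 -> tpar i = b.
Proof. by move=> hu /eqP ui; apply/eqP; apply: contra_notT ui => /hu. Qed.

Lemma thomog_dec v :
  exists x y, [/\ thomog false x, thomog true y & v = x + y].
Proof.
exists [ffun i => if tpar i then 0 else v i],
       [ffun i => if tpar i then v i else 0]; split.
- by move=> i; rewrite ffunE; case: (tpar i).
- by move=> i; rewrite ffunE; case: (tpar i).
by apply/ffunP => i; rewrite !ffunE; case: (tpar i); rewrite ?add0r ?addr0.
Qed.

Lemma thomog_cap v : thomog false v -> thomog true v -> v = 0.
Proof.
move=> h0 h1; apply/ffunP => i; rewrite ffunE.
by case par_i: (tpar i); [apply: h0 | apply: h1]; rewrite par_i.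
Qed.

Lemma tbr_homog b c x y : thomog b x -> thomog c y -> thomog (b (+) c) (tbr x y).
Proof.
move=> hx hy k hk; rewrite sum_ffunE big1 // => i _.
rewrite sum_ffunE big1 // => j _; rewrite !ffunE.
have [xi|xi] := eqVneq (x i) 0; first by rewrite xi mul0r scale0r.
have [yj|yj] := eqVneq (y j) 0; first by rewrite yj mulr0 scale0r.
by rewrite t_homog ?scaler0 // (thomog_par hx xi) (thomog_par hy yj).
Qed.

Lemma tbr_skew b c x y : thomog b x -> thomog c y ->
  tbr x y = - ((-1) ^+ (b && c) *: tbr y x).
Proof.
move=> hx hy; rewrite /tbr [in RHS]exchange_big scaler_sumr -sumrN /=.
apply: eq_bigr => i _; rewrite scaler_sumr -sumrN; apply: eq_bigr => j _.
have [xi|xi] := eqVneq (x i) 0; first by rewrite xi mul0r mulr0 !scale0r scaler0 oppr0.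
have [yj|yj] := eqVneq (y j) 0; first by rewrite yj mul0r mulr0 !scale0r scaler0 oppr0.
rewrite t_skew (thomog_par hx xi) (thomog_par hy yj) scalerN !scalerA.
by rewrite mulrC [x i * y j]mulrC.
Qed.

Lemma tbr_jacobi b c d x y z : thomog b x -> thomog c y -> thomog d z ->
  tbr x (tbr y z) = tbr (tbr x y) z + (-1) ^+ (b && c) *: tbr y (tbr x z).
Proof.
move=> hx hy _.
have L1 (u v w : tspace) : tbr u (tbr v w) =
    \sum_i \sum_j \sum_k (u i * v j * w k) *: tbr (tvec i) (t j k).
  rewrite {1}(tvec_sum u) tbr_suml; apply: eq_bigr => i _.
  rewrite [tbr v w]tbr_sum2 tbr_sumr scaler_sumr; apply: eq_bigr => j _.
  rewrite tbr_sumr !scaler_sumr; apply: eq_bigr => k _.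
  by rewrite !scalerA.
have L2 (u v w : tspace) : tbr (tbr u v) w =
    \sum_i \sum_j \sum_k (u i * v j * w k) *: tbr (t i j) (tvec k).
  rewrite [tbr u v]tbr_sum2 tbr_suml; apply: eq_bigr => i _.
  rewrite tbr_suml !scaler_sumr; apply: eq_bigr => j _.
  rewrite {1}(tvec_sum w) tbr_sumr !scaler_sumr; apply: eq_bigr => k _.
  by rewrite !scalerA.
rewrite !L1 L2 [X in _ + _ *: X]exchange_big scaler_sumr -big_split /=.
apply: eq_bigr => i _; rewrite scaler_sumr -big_split; apply: eq_bigr => j _ /=.
rewrite scaler_sumr -big_split; apply: eq_bigr => k _ /=.
have [xi|xi] := eqVneq (x i) 0.
  by rewrite xi mulr0 !mul0r !scale0r scaler0 addr0.
have [yj|yj] := eqVneq (y j) 0.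
  by rewrite yj mulr0 !mul0r !scale0r scaler0 addr0.
rewrite t_jacobi (thomog_par hx xi) (thomog_par hy yj) scalerDr !scalerA.
by rewrite [y j * x i]mulrC [_ * (-1) ^+ _]mulrC.
Qed.

Definition talg : lieSuper tspace :=
  LieSuper thomog_lin thomog_dec thomog_cap tbr_linl tbr_linr tbr_homog
    tbr_skew tbr_jacobi.

(* Jacobi is automatic when all products of basis elements are central. *)
Lemma t_jacobi_central :
  (forall i j k, t i j k = 0 \/ forall l, t k l = 0 /\ t l k = 0) ->
  forall i j k, tbr (tvec i) (t j k) =
    tbr (t i j) (tvec k) + (-1) ^+ (tpar i && tpar j) *: tbr (tvec j) (t i k).
Proof.
move=> tc.
have r0 i j k : tbr (tvec i) (t j k) = 0.
  apply: big1 => a _; apply: big1 => b _.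
  have [->|/(_ a) [_ ->]] := tc j k b; first by rewrite mulr0 scale0r.
  by rewrite scaler0.
have l0 i j k : tbr (t i j) (tvec k) = 0.
  apply: big1 => a _; apply: big1 => b _.
  have [->|/(_ b) [-> _]] := tc i j a; first by rewrite mul0r scale0r.
  by rewrite scaler0.
by move=> i j k; rewrite !r0 l0 scaler0 addr0.
Qed.

End Table.

Section Models.
Variable K : numFieldType.

Section Abelian.
Variables k l : nat.
Local Notation I := ('I_k + 'I_l)%type.

Definition abel_table (i j : I) : tspace K 'I_k 'I_l := 0.

Lemma abel_homog i j : thomog (tpar i (+) tpar j) (abel_table i j).
Proof. by move=> a _; rewrite ffunE. Qed.

Lemma abel_skew i j :
  abel_table i j = - ((-1) ^+ (tpar i && tpar j) *: abel_table j i).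
Proof. by rewrite /abel_table scaler0 oppr0. Qed.

Lemma abel_central i j a :
  abel_table i j a = 0 \/ forall b, abel_table a b = 0 /\ abel_table b a = 0.
Proof. by right. Qed.

Definition abel : lieSuper (tspace K 'I_k 'I_l) :=
  talg abel_homog abel_skew (t_jacobi_central abel_central).
End Abelian.

(* Basis of H(p,q): [x_i] is [inl (inl (inl i))], [x_(p+i)] is
   [inl (inl (inr i))], [z] is [inl (inr tt)] and [y_j] is [inr j]. *)
Section Heisenberg.
Variables p q : nat.
Local Notation E := ('I_p + 'I_p + unit)%type.
Local Notation I := (E + 'I_q)%type.

Definition H_table (i j : I) : tspace K E 'I_q :=
  let z := tvec K (inl (inr tt) : I) in
  match i, j with
  | inl (inl (inl a)), inl (inl (inr b)) => if a == b then z else 0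
  | inl (inl (inr a)), inl (inl (inl b)) => if a == b then - z else 0
  | inr a, inr b => if a == b then z else 0
  | _, _ => 0
  end.

Lemma H_homog i j : thomog (tpar i (+) tpar j) (H_table i j).
Proof.
move: i j => [[[i|i]|[]]|i] [[[j|j]|[]]|j] k //= hk; rewrite /H_table;
  try case: ifP => _; rewrite ?ffunE //;
  by case: k hk => [[[?|?]|[]]|?]; rewrite //= oppr0.
Qed.

Lemma H_skew i j :
  H_table i j = - ((-1) ^+ (tpar i && tpar j) *: H_table j i).
Proof.
move: i j => [[[i|i]|[]]|i] [[[j|j]|[]]|j] //=;
  rewrite /H_table ?[j == i]eq_sym; try case: ifP => _;
  by rewrite ?expr1 ?expr0 ?scaleN1r ?scale1r ?opprK ?scaler0 ?oppr0.
Qed.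

Lemma H_central i j k :
  H_table i j k = 0 \/ forall l, H_table k l = 0 /\ H_table l k = 0.
Proof.
have [->|kz] := eqVneq k (inl (inr tt)).
  by right => [[[[l|l]|[]]|l]].
left; move: i j => [[[i|i]|[]]|i] [[[j|j]|[]]|j] //=; rewrite /H_table;
  try case: ifP => _; by rewrite ?ffunE // (negPf kz) ?oppr0.
Qed.

Definition H : lieSuper (tspace K E 'I_q) :=
  talg H_homog H_skew (t_jacobi_central H_central).
End Heisenberg.

(* Basis: [x_i] is [inl i], [y_i] is [inr (inl i)] and [z] is [inr (inr tt)]. *)
Section OddHeisenberg.
Variable k : nat.
Local Notation O := ('I_k + unit)%type.
Local Notation I := ('I_k + O)%type.

Definition Hodd_table (i j : I) : tspace K 'I_k O :=
  let z := tvec K (inr (inr tt) : I) in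
  match i, j with
  | inl a, inr (inl b) => if a == b then z else 0
  | inr (inl a), inl b => if a == b then - z else 0
  | _, _ => 0
  end.

Lemma Hodd_homog i j : thomog (tpar i (+) tpar j) (Hodd_table i j).
Proof.
move: i j => [i|[i|[]]] [j|[j|[]]] l //= hl; rewrite /Hodd_table;
  try case: ifP => _; rewrite ?ffunE //;
  by case: l hl => [?|[?|[]]]; rewrite //= oppr0.
Qed.

Lemma Hodd_skew i j :
  Hodd_table i j = - ((-1) ^+ (tpar i && tpar j) *: Hodd_table j i).
Proof.
move: i j => [i|[i|[]]] [j|[j|[]]] //=;
  rewrite /Hodd_table ?[j == i]eq_sym; try case: ifP => _;
  by rewrite ?expr1 ?expr0 ?scaleN1r ?scale1r ?opprK ?scaler0 ?oppr0.
Qed.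

Lemma Hodd_central i j l :
  Hodd_table i j l = 0 \/ forall a, Hodd_table l a = 0 /\ Hodd_table a l = 0.
Proof.
have [->|lz] := eqVneq l (inr (inr tt)).
  by right => [[a|[a|[]]]].
left; move: i j => [i|[i|[]]] [j|[j|[]]] //=; rewrite /Hodd_table;
  try case: ifP => _; by rewrite ?ffunE // (negPf lz) ?oppr0.
Qed.

Definition Hodd : lieSuper (tspace K 'I_k O) :=
  talg Hodd_homog Hodd_skew (t_jacobi_central Hodd_central).
End OddHeisenberg.

(* [x0, y0, z0, v0] are numbered [0, 1, 2, 3]. *)
Section L4.
Local Notation I := ('I_4 + 'I_0)%type.

Definition L4_table (i j : I) : tspace K 'I_4 'I_0 :=
  let z := tvec K (inl (@inord 3 2) : I) in
  let v := tvec K (inl (@inord 3 3) : I) in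
  match i, j with
  | inl a, inl b =>
      match val a, val b with
      | 0%N, 1%N => z | 1%N, 0%N => - z
      | 1%N, 2%N => v | 2%N, 1%N => - v
      | _, _ => 0
      end
  | _, _ => 0
  end.

Lemma L4_homog i j : thomog (tpar i (+) tpar j) (L4_table i j).
Proof. by case: i j => [i|[]//] [j|[]//] [k|[]//]. Qed.

Lemma L4_skew i j :
  L4_table i j = - ((-1) ^+ (tpar i && tpar j) *: L4_table j i).
Proof.
case: i j => [i|[]//] [j|[]//]; rewrite expr0 scale1r.
by case: i j => [[|[|[|[|//]]]] ?] [[|[|[|[|//]]]] ?]; rewrite ?oppr0 ?opprK.
Qed.

Lemma L4_jacobi i j k : tbr L4_table (tvec K i) (L4_table j k) =
  tbr L4_table (L4_table i j) (tvec K k) +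
  (-1) ^+ (tpar i && tpar j) *: tbr L4_table (tvec K j) (L4_table i k).
Proof.
have bNl u v : tbr L4_table (- u) v = - tbr L4_table u v.
  by rewrite -[- u]addr0 -scaleN1r tbr_linl tbr0l addr0 scaleN1r.
have bNr u v : tbr L4_table u (- v) = - tbr L4_table u v.
  by rewrite -[- v]addr0 -scaleN1r tbr_linr tbr0r addr0 scaleN1r.
case: i j k => [i|[]//] [j|[]//] [k|[]//]; rewrite expr0 scale1r.
by case: i j k => [[|[|[|[|//]]]] ?] [[|[|[|[|//]]]] ?] [[|[|[|[|//]]]] ?];
  rewrite {2 4 6}/L4_table /= ?bNl ?bNr ?tbr0l ?tbr0r ?tbr_vec
    /L4_table /= ?inordK //= ?oppr0 ?opprK ?addr0 ?add0r ?subrr ?addNr.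
Qed.

Definition L4 : lieSuper (tspace K 'I_4 'I_0) :=
  talg L4_homog L4_skew L4_jacobi.
End L4.

(* [x0, y0, z0, v0, w0] are numbered [0, 1, 2, 3, 4]. *)
Section L5.
Local Notation I := ('I_5 + 'I_0)%type.

Definition L5_table (i j : I) : tspace K 'I_5 'I_0 :=
  let v := tvec K (inl (@inord 4 3) : I) in
  let w := tvec K (inl (@inord 4 4) : I) in
  match i, j with
  | inl a, inl b =>
      match val a, val b with
      | 0%N, 1%N => v | 1%N, 0%N => - v
      | 0%N, 2%N => w | 2%N, 0%N => - w
      | _, _ => 0
      end
  | _, _ => 0
  end.

Lemma L5_homog i j : thomog (tpar i (+) tpar j) (L5_table i j).
Proof. by case: i j => [i|[]//] [j|[]//] [k|[]//]. Qed.

Lemma L5_skew i j :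
  L5_table i j = - ((-1) ^+ (tpar i && tpar j) *: L5_table j i).
Proof.
case: i j => [i|[]//] [j|[]//]; rewrite expr0 scale1r.
by case: i j => [[|[|[|[|[|//]]]]] ?] [[|[|[|[|[|//]]]]] ?];
  rewrite ?oppr0 ?opprK.
Qed.

Lemma L5_central i j k :
  L5_table i j k = 0 \/ forall l, L5_table k l = 0 /\ L5_table l k = 0.
Proof.
case: k => [k|[]//]; have [k3|k3] := ltnP k 3; last first.
  right=> -[l|[]//]; rewrite /L5_table.
  by case: k k3 l => [[|[|[|[|[|//]]]]] ?] //= _ [[|[|[|[|[|//]]]]] ?].
left; case: i j => [i|[]//] [j|[]//].
have k0 (a : 'I_5) : (2 < a)%N -> (inl k == inl a :> I) = false.
  by move=> a2; apply/eqP => -[ka]; move: k3; rewrite ka ltnNge a2.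
by case: i j => [[|[|[|[|[|//]]]]] ?] [[|[|[|[|[|//]]]]] ?];
  rewrite /L5_table /= ?ffunE ?k0 ?inordK ?oppr0.
Qed.

Definition L5 : lieSuper (tspace K 'I_5 'I_0) :=
  talg L5_homog L5_skew (t_jacobi_central L5_central).
End L5.

End Models.

(* Main.v *)
(** The dual of the Hopf formula identifies the multiplier with the space of
    super 2-cocycles of L with trivial coefficients modulo the coboundaries
    [(x, y) |-> f [x, y]], so that dim M(L) = dim Z^2(L) - dim L'.  Put
    d = dim L', v = dim L / L', and let Z(U) be the space of cocycles vanishing
    on U x L.  As Z(L') is the space of all super-skew forms on L / L', the
    condition s(L) = 2 becomes

      dim Z(0) - dim Z(L') = (d - 1) v + d (d - 1) / 2 + dim (L' odd).

    Climbing through ideals from 0 to L', each step of dimension one adds at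
    most v to the left-hand side, because a cocycle vanishing on [U, L] x L
    vanishes on U x L'.  For the last step, from a hyperplane D1 of L', let
    L' / D1 = <z> and [x, y] = B(x, y) z mod D1.  The functional
    theta = omega(z, _) satisfies theta /\ B = 0, so the last step adds at most 2,
    at most 1 when z is odd, and when z is even it adds 0 unless B is a product
    of two even functionals.  This forces d <= 2.  For d = 1 the forms B are
    classified by normal forms.  For d = 2 and class 3 the count leaves only
    L^1_{4,0}.  For d = 2 and class 2 every form of the pencil is decomposable,
    so they share a factor, L = L^2_{5,0} + A, and the count gives dim A = 1. *)
From HB Require Import structures.
Require Import Defs.
From mathcomp Require Import all_boot all_order all_algebra.
From mathcomp Require Import boolp classical_sets reals complex.
From mathcomp Require Import zify ring lra.

Set Implicit Arguments.
Unset Strict Implicit.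
Unset Printing Implicit Defensive.

Import GRing.Theory Num.Theory.

Local Open Scope ring_scope.

(** * Linear algebra *)

Section LinearAlgebra.
Variable K : fieldType.

(** The obstacle is that the free algebra is known only through its universal property and may be
    infinite dimensional, so nothing in it can be counted directly. Lifting a basis of L makes
    [F, F] / [F, R] a quotient of the space of N x N matrices, N = dim L, and the annihilator of the
    relations is the space of cocycles. Freeness gives one inclusion: a cocycle defines a central
    extension of L, and the map from the free algebra into that extension shows that the cocycle
    kills the relations. The dimension of the multiplier counts even and odd classes together, which
    is why cocycles carry no parity. In the count, the steps below L' supply at most (d - 1) v, so
    the last step alone has to supply at least C(d, 2) + dim (L' odd). This single demand drives
    every case: for d = 2 it is at least 1, hence a nonzero theta exists and B is decomposable, and
    an odd class of L' modulo [L', L] would raise it beyond what an odd z can supply. *)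

Lemma lfun_of_linear (E E' : vectType K) (f : E -> E') :
  (forall a x y, f (a *: x + y) = a *: f x + f y) ->
  exists F : 'Hom(E, E'), forall x, F x = f x.
Proof.
move=> fl.
pose fL : {linear E -> E'} := HB.pack f (GRing.isLinear.Build K E E' _ f fl).
by exists (linfun fL) => x; rewrite lfunE.
Qed.

(** A subspace of largest dimension inside [S] exhausts [S], since one more vector of [S] would
    enlarge it. This turns any linearly closed predicate, decidable or not, into a [{vspace}] whose
    dimension can be counted. *)
Lemma vspace_of_pred (E : vectType K) (S : E -> Prop) :
  S 0 -> (forall a x y, S x -> S y -> S (a *: x + y)) ->
  exists U : {vspace E}, forall x, x \in U <-> S x.
Proof.
move=> S0 SL.
pose P k := `[< exists U : {vspace E}, \dim U = k /\ forall x, x \in U -> S x >].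
have P0 : exists k, P k.
  exists 0%N; apply/asboolP; exists 0%VS; split; first exact: dimv0.
  by move=> x; rewrite memv0 => /eqP ->.
have Pb k : P k -> (k <= \dim {:E})%N.
  by move/asboolP => [U [<- _]]; rewrite dimvS ?subvf.
case: (ex_maxnP P0 Pb) => k /asboolP [U [dU US]] kmax.
exists U => x; split; first exact: US.
move=> Sx; apply: contrapT => /negP xU.
have : (k.+1 <= k)%N; last by rewrite ltnn.
apply: kmax; apply/asboolP; exists (U + <[x]>)%VS; split; last first.
  move=> y /memv_addP [u uU [w /vlineP [a ->] ->]].
  by rewrite addrC; apply: SL => //; apply: US.
rewrite dimv_disjoint_sum ?dim_vline ?dU.
  by case: (x =P 0) xU => [->|_ _]; rewrite ?mem0v //= addn1.
apply/eqP; rewrite -subv0; apply/subvP => y /memv_capP [yU /vlineP [a ya]].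
rewrite memv0 ya scaler_eq0; apply/orP; left; apply: contraNT xU => a0.
by rewrite -[x](scalerK a0) -ya memvZ.
Qed.

Section Coordinates.
Variables (E : vectType K) (I : finType) (f : I -> E -> K).
Hypothesis f_lin : forall i a x y, f i (a *: x + y) = a * f i x + f i y.

Let coordmap : exists F : 'Hom(E, {ffun I -> K^o}), forall x i, F x i = f i x.
Proof.
have [|F FE] := @lfun_of_linear E {ffun I -> K^o} (fun x => [ffun i => f i x]).
  by move=> a x y; apply/ffunP => i; rewrite !ffunE f_lin.
by exists F => x i; rewrite FE ffunE.
Qed.

Let dim_ffun : \dim {: {ffun I -> K^o}} = #|I|.
Proof. by rewrite dimvf /dim /= muln1. Qed.

(** Rank-nullity for the map with coordinates [f i]. Upper bounds on spaces of cocycles come from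
    naming a few values that determine a cocycle modulo a smaller space. *)
Lemma dim_le_coords (W U : {vspace E}) :
  (forall x, x \in W -> (forall i, f i x = 0) -> x \in U) ->
  (\dim W <= \dim U + #|I|)%N.
Proof.
move=> h; have [F FE] := coordmap.
rewrite -(limg_ker_dim F W) leq_add //; last first.
  by rewrite -dim_ffun dimvS // subvf.
apply: dimvS; apply/subvP => x /memv_capP [xW]; rewrite memv_ker => /eqP Fx.
by apply: h => // i; rewrite -FE Fx ffunE.
Qed.

(** Rank-nullity again, with the coordinate map onto: the matching lower bounds come from exhibiting
    a cocycle for each choice of values. *)
Lemma dim_ge_coords (W U : {vspace E}) :
  (forall x, x \in U -> x \in W /\ forall i, f i x = 0) ->
  (forall c : I -> K, exists2 x, x \in W & forall i, f i x = c i) ->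
  (\dim U + #|I| <= \dim W)%N.
Proof.
move=> hU hW; have [F FE] := coordmap.
rewrite -(limg_ker_dim F W) leq_add //.
  apply: dimvS; apply/subvP => x xU; have [xW fx] := hU x xU.
  rewrite memv_cap xW memv_ker; apply/eqP/ffunP => i.
  by rewrite FE fx ffunE.
rewrite -dim_ffun dimvS //; apply/subvP => c _.
have [x xW xc] := hW c; apply/memv_imgP; exists x => //.
by apply/ffunP => i; rewrite FE xc.
Qed.

End Coordinates.

Lemma functional_separation (E : vectType K) (U : {vspace E}) x : x \notin U ->
  exists f : 'Hom(E, K^o), f x = 1 /\ forall u, u \in U -> f u = 0.
Proof.
move=> xU; have x0 : x - projv U x != 0.
  by rewrite subr_eq0; apply: contraNneq xU => ->; rewrite memv_proj.
pose y := x - projv U x.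
pose X := vbasis (fullv : {vspace E}).
(* The component of [x] outside [U] has a nonzero coordinate; that coordinate, divided by its value
   at [x], is the functional. *)
have [i yi] : exists i, coord X i y != 0.
  apply: contrapT => h; case/eqP: x0; rewrite -/y (coord_vbasis (memvf y)).
  apply: big1 => i _; apply/eqP; rewrite scaler_eq0; apply/orP; left.
  by apply: contrapT => /negP yi; apply: h; exists i.
have [|f fE] := @lfun_of_linear E K^o
   (fun z => coord X i (z - projv U z) / coord X i y).
  move=> a z w.
  have -> : a *: z + w - projv U (a *: z + w) =
            a *: (z - projv U z) + (w - projv U w).
    by rewrite linearP /= scalerBr opprD addrACA.
  by rewrite linearP mulrDl -mulrA.
exists f; split; first by rewrite fE divff.
by move=> u uU; rewrite fE projv_id // subrr linear0 mul0r.
Qed.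

End LinearAlgebra.

(** * Brackets, forms and cocycles *)

Section Bracket.
Variables (K : numFieldType) (V : lmodType K) (L : lieSuper V).

Lemma brDl x y z : br L (x + y) z = br L x z + br L y z.
Proof. by rewrite -[x]scale1r br_linl !scale1r. Qed.

Lemma brDr x y z : br L z (x + y) = br L z x + br L z y.
Proof. by rewrite -[x]scale1r br_linr !scale1r. Qed.

Lemma br0l z : br L 0 z = 0.
Proof. by apply: (addrI (br L 0 z)); rewrite -brDl !addr0. Qed.

Lemma br0r z : br L z 0 = 0.
Proof. by apply: (addrI (br L z 0)); rewrite -brDr !addr0. Qed.

Lemma brZl a x z : br L (a *: x) z = a *: br L x z.
Proof. by rewrite -[a *: x]addr0 br_linl br0l addr0. Qed.

Lemma brZr a x z : br L z (a *: x) = a *: br L z x.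
Proof. by rewrite -[a *: x]addr0 br_linr br0r addr0. Qed.

Lemma brNl x z : br L (- x) z = - br L x z.
Proof. by rewrite -scaleN1r brZl scaleN1r. Qed.

Lemma brNr x z : br L z (- x) = - br L z x.
Proof. by rewrite -scaleN1r brZr scaleN1r. Qed.

Lemma brBl x y z : br L (x - y) z = br L x z - br L y z.
Proof. by rewrite brDl brNl. Qed.

Lemma brBr x y z : br L z (x - y) = br L z x - br L z y.
Proof. by rewrite brDr brNr. Qed.

Lemma br_suml (I : finType) (F : I -> V) z :
  br L (\sum_i F i) z = \sum_i br L (F i) z.
Proof. by elim/big_rec2: _ => [|i y x _ <-]; rewrite ?br0l // brDl. Qed.

Lemma br_sumr (I : finType) (F : I -> V) z :
  br L z (\sum_i F i) = \sum_i br L z (F i).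
Proof. by elim/big_rec2: _ => [|i y x _ <-]; rewrite ?br0r // brDr. Qed.

(** The axioms do not place 0 in [homog b] outright. Decompose 0 as x + y; then x = -y = (-2) y + y
    is odd as well as even, hence 0. *)
Lemma homog0 b : homog L b 0.
Proof.
have [x [y [hx hy]]] := homog_dec L 0 => /esym/eqP.
rewrite addr_eq0 => /eqP xy.
have x0 : x = 0.
  apply: (homog_cap hx); rewrite xy.
  by move: (homog_lin (-2) hy hy); rewrite scaleNr scaler_nat mulr2n opprD addrNK.
by case: b; [move: hy; rewrite -[y]opprK -xy x0 oppr0 | rewrite -x0].
Qed.

Lemma homogZ b a x : homog L b x -> homog L b (a *: x).
Proof. by move=> hx; rewrite -[a *: x]addr0; apply: homog_lin => //; exact: homog0. Qed.

Lemma homogD b x y : homog L b x -> homog L b y -> homog L b (x + y).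
Proof. by move=> hx hy; rewrite -[x]scale1r; apply: homog_lin. Qed.

Lemma homogN b x : homog L b x -> homog L b (- x).
Proof. by rewrite -scaleN1r; exact: homogZ. Qed.

Lemma homogB b x y : homog L b x -> homog L b y -> homog L b (x - y).
Proof. by move=> hx hy; apply/homogD/homogN. Qed.

Lemma homog_ind (P : V -> Prop) :
  (forall x y, P x -> P y -> P (x + y)) ->
  (forall b x, homog L b x -> P x) -> forall x, P x.
Proof.
by move=> PD Ph x; have [u [w [hu hw ->]]] := homog_dec L x;
  apply: PD; apply: Ph; eauto.
Qed.

Lemma br_skew_even x y : homog L false x ->
  (forall b, homog L b y -> br L x y = - br L y x) /\
  (forall b, homog L b y -> br L y x = - br L x y).
Proof.
move=> hx; split=> b hy.
  by rewrite (br_skew hx hy) /= expr0 scale1r.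
by rewrite (br_skew hy hx) andbF expr0 scale1r.
Qed.

Lemma br_evenC x y : homog L false x -> br L x y = - br L y x.
Proof.
move=> hx; elim/homog_ind: y => [y z hy hz|b y /(br_skew_even y hx).1 //].
by rewrite brDr brDl hy hz opprD.
Qed.

Lemma br_even_self x : homog L false x -> br L x x = 0.
Proof.
move=> hx; have /eqP := br_evenC x hx.
by rewrite -addr_eq0 -mulr2n -scaler_nat scaler_eq0 pnatr_eq0 /= => /eqP.
Qed.

End Bracket.

Definition bilin (K : numFieldType) (V : lmodType K) (g : V -> V -> K) : Prop :=
  (forall a x y z, g (a *: x + y) z = a * g x z + g y z) /\
  (forall a x y z, g z (a *: x + y) = a * g z x + g z y).

Section Bilinear.
Variables (K : numFieldType) (V : lmodType K) (g : V -> V -> K).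
Hypothesis gb : bilin g.

Lemma bilinDl x y z : g (x + y) z = g x z + g y z.
Proof. by rewrite -[x]scale1r gb.1 !scale1r mul1r. Qed.

Lemma bilinDr x y z : g z (x + y) = g z x + g z y.
Proof. by rewrite -[x]scale1r gb.2 !scale1r mul1r. Qed.

Lemma bilin0l z : g 0 z = 0.
Proof. by apply: (addrI (g 0 z)); rewrite -bilinDl !addr0. Qed.

Lemma bilin0r z : g z 0 = 0.
Proof. by apply: (addrI (g z 0)); rewrite -bilinDr !addr0. Qed.

Lemma bilinZl a x z : g (a *: x) z = a * g x z.
Proof. by rewrite -[a *: x]addr0 gb.1 bilin0l addr0. Qed.

Lemma bilinZr a x z : g z (a *: x) = a * g z x.
Proof. by rewrite -[a *: x]addr0 gb.2 bilin0r addr0. Qed.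

Lemma bilinNl x z : g (- x) z = - g x z.
Proof. by rewrite -scaleN1r bilinZl mulN1r. Qed.

Lemma bilinNr x z : g z (- x) = - g z x.
Proof. by rewrite -scaleN1r bilinZr mulN1r. Qed.

Lemma bilinBl x y z : g (x - y) z = g x z - g y z.
Proof. by rewrite bilinDl bilinNl. Qed.

Lemma bilinBr x y z : g z (x - y) = g z x - g z y.
Proof. by rewrite bilinDr bilinNr. Qed.

Lemma bilin_suml (I : finType) (F : I -> V) z :
  g (\sum_i F i) z = \sum_i g (F i) z.
Proof. by elim/big_rec2: _ => [|i y x _ <-]; rewrite ?bilin0l // bilinDl. Qed.

Lemma bilin_sumr (I : finType) (F : I -> V) z :
  g z (\sum_i F i) = \sum_i g z (F i).
Proof. by elim/big_rec2: _ => [|i y x _ <-]; rewrite ?bilin0r // bilinDr. Qed.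

End Bilinear.

(* 2-cocycles with values in a trivial module of dimension (1|1); no parity is
   imposed on the form. *)
Definition cocycle (K : numFieldType) (V : lmodType K) (L : lieSuper V)
    (g : V -> V -> K) : Prop :=
  (forall b c x y, homog L b x -> homog L c y ->
     g x y = - ((-1) ^+ (b && c) * g y x)) /\
  (forall b c d x y z, homog L b x -> homog L c y -> homog L d z ->
     g x (br L y z) = g (br L x y) z + (-1) ^+ (b && c) * g y (br L x z)).

(** * Bilinear forms as Gram matrices *)

Section Forms.
Variables (K : numFieldType) (V : vectType K).
Local Notation N := (\dim {:V}).
Local Notation X := (vbasis {:V}).

Definition pairing (A B : 'M[K]_N) : K := \sum_i \sum_j A i j * B i j.

Definition tensor (u w : V) : 'M[K]_N :=
  \matrix_(i, j) (coord X i u * coord X j w).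

(** Forms are stored as Gram matrices in a fixed basis, so that they make up a finite-dimensional
    space. The same matrices also encode elements of V tensor V, and [pairing] is the duality
    between the two readings. *)
Definition bform (W : 'M[K]_N) (u w : V) : K := pairing W (tensor u w).

Lemma pairing_linl a A B C : pairing (a *: A + B) C = a * pairing A C + pairing B C.
Proof.
rewrite /pairing mulr_sumr -big_split; apply: eq_bigr => i _ /=.
rewrite mulr_sumr -big_split; apply: eq_bigr => j _ /=.
by rewrite !mxE mulrDl mulrA.
Qed.

Lemma pairingC A B : pairing A B = pairing B A.
Proof. by apply: eq_bigr => i _; apply: eq_bigr => j _; rewrite mulrC. Qed.

Lemma pairing_linr a A B C : pairing C (a *: A + B) = a * pairing C A + pairing C B.
Proof. by rewrite pairingC pairing_linl !(pairingC _ C). Qed.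

Lemma tensor_linl a x y z : tensor (a *: x + y) z = a *: tensor x z + tensor y z.
Proof. by apply/matrixP => i j; rewrite !mxE linearP /= mulrDl mulrA. Qed.

Lemma tensor_linr a x y z : tensor z (a *: x + y) = a *: tensor z x + tensor z y.
Proof. by apply/matrixP => i j; rewrite !mxE linearP /= mulrDr mulrCA. Qed.

Lemma bform_bilin W : bilin (bform W).
Proof.
by split=> a x y z; rewrite /bform (tensor_linl, tensor_linr) pairing_linr.
Qed.

Lemma bform_lin a W W' x y : bform (a *: W + W') x y = a * bform W x y + bform W' x y.
Proof. exact: pairing_linl. Qed.

Lemma pairing0 A : pairing A 0 = 0.
Proof. by apply: big1 => i _; apply: big1 => j _; rewrite mxE mulr0. Qed.

Lemma bform0 x y : bform 0 x y = 0.
Proof. by rewrite /bform pairingC pairing0. Qed.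

Lemma bilin_expand g x y : bilin g ->
  g x y = \sum_i \sum_j coord X i x * coord X j y * g X`_i X`_j.
Proof.
move=> gb; rewrite {1}(coord_vbasis (memvf x)) (bilin_suml gb).
apply: eq_bigr => i _; rewrite {1}(coord_vbasis (memvf y)) (bilin_sumr gb).
by apply: eq_bigr => j _; rewrite (bilinZl gb) (bilinZr gb) mulrA.
Qed.

Lemma bform_surj g : bilin g -> exists W, forall x y, bform W x y = g x y.
Proof.
move=> gb; exists (\matrix_(i, j) g X`_i X`_j) => x y.
rewrite (bilin_expand _ _ gb); apply: eq_bigr => i _; apply: eq_bigr => j _.
by rewrite !mxE mulrC.
Qed.

Lemma bform_vbasis W (i j : 'I_N) : bform W X`_i X`_j = W i j.
Proof.
have Xf : free X by exact: basis_free (vbasisP _).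
rewrite /bform /pairing (bigD1 i) //= (bigD1 j) //= !mxE !coord_free // !eqxx.
rewrite !mulr1 !big1 ?addr0 // => [k /negPf ki|k /negPf kj].
  by apply: big1 => l _; rewrite !mxE !coord_free // eq_sym ki mul0r mulr0.
by rewrite !mxE !coord_free // [j == k]eq_sym kj !mulr0.
Qed.

Lemma bform_inj W : (forall x y, bform W x y = 0) -> W = 0.
Proof. by move=> W0; apply/matrixP => i j; rewrite mxE -bform_vbasis W0. Qed.

End Forms.

(** * Parity projections and spaces of cocycles *)

Section Graded.
Variables (K : numFieldType) (V : vectType K) (L : lieSuper V).
Variable Vp : bool -> {vspace V}.
Hypothesis VpP : forall b x, homog L b x <-> x \in Vp b.

Lemma cap_parts b : (Vp b :&: Vp (~~ b))%VS = 0%VS.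
Proof.
apply/eqP; rewrite -subv0; apply/subvP => x /memv_capP [].
rewrite -!VpP memv0 => h1 h2; apply/eqP.
by case: b h1 h2 => h1 h2; [apply: (homog_cap h2) | apply: (homog_cap h1)].
Qed.

Lemma add_parts b : (Vp b + Vp (~~ b))%VS = fullv.
Proof.
apply/vspaceP => x; rewrite memvf.
have [u [w [/VpP hu /VpP hw ->]]] := homog_dec L x.
by case: b; rewrite /= 1?[(Vp true + _)%VS]addvC memv_add.
Qed.

Lemma dim_parts b : (\dim (Vp b) + \dim (Vp (~~ b)) = \dim {:V})%N.
Proof. by rewrite -(add_parts b) dimv_disjoint_sum // cap_parts. Qed.

Definition part (b : bool) : 'End(V) := daddv_pi (Vp b) (Vp (~~ b)).

Lemma part_homog b x : homog L b (part b x).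
Proof. by apply/VpP; exact: memv_pi. Qed.

Lemma part_mem b x : part b x \in Vp b.
Proof. exact: memv_pi. Qed.

Lemma part_id b x : homog L b x -> part b x = x.
Proof. by move=> /VpP hx; apply: daddv_pi_id => //; exact: cap_parts. Qed.

Lemma part_add b x : part b x + part (~~ b) x = x.
Proof.
rewrite /part negbK; apply: daddv_pi_add; first exact: cap_parts.
by rewrite add_parts memvf.
Qed.

Lemma part_other b x : homog L (~~ b) x -> part b x = 0.
Proof.
move=> hx; move: (part_add b x); rewrite (part_id hx) => /eqP.
by rewrite -subr_eq0 addrK => /eqP.
Qed.

Definition graded (U : {vspace V}) : Prop :=
  forall b x, x \in U -> part b x \in U.

Lemma gradedf : graded fullv.
Proof. by move=> b x _; exact: memvf. Qed.

Definition Zpred (U : {vspace V}) (W : 'M[K]_(\dim {:V})) : Prop :=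
  cocycle L (bform W) /\ forall u x, u \in U -> bform W u x = 0.

Lemma Zspace_ex U : exists Z : {vspace 'M[K]_(\dim {:V})},
  forall W, W \in Z <-> Zpred U W.
Proof.
apply: vspace_of_pred; first split.
- by split=> [b c x y _ _|b c d x y z _ _ _]; rewrite !bform0 ?mulr0 ?oppr0 ?addr0.
- by move=> u x _; rewrite bform0.
move=> a W W' [[s j] z] [[s' j'] z']; split; first split.
- move=> b c x y hx hy; rewrite !bform_lin (s _ _ _ _ hx hy) (s' _ _ _ _ hx hy).
  by ring.
- move=> b c d x y w hx hy hw; rewrite !bform_lin (j _ _ _ _ _ _ hx hy hw).
  by rewrite (j' _ _ _ _ _ _ hx hy hw); ring.
by move=> u x uU; rewrite bform_lin z // z' // mulr0 addr0.
Qed.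

Definition Zspace (U : {vspace V}) : {vspace 'M[K]_(\dim {:V})} :=
  projT1 (cid (Zspace_ex U)).

Lemma ZspaceP U W : W \in Zspace U <-> Zpred U W.
Proof. by rewrite /Zspace; case: cid. Qed.

Lemma Zspace_form (U : {vspace V}) g : bilin g -> cocycle L g ->
  (forall u x, u \in U -> g u x = 0) ->
  exists2 W, W \in Zspace U & forall x y, bform W x y = g x y.
Proof.
move=> gb [gs gj] gU; have [W WE] := bform_surj gb; exists W => //.
apply/ZspaceP; split; first split.
- by move=> b c x y hx hy; rewrite !WE; apply: gs.
- by move=> b c d x y z hx hy hz; rewrite !WE; apply: gj hx hy hz.
by move=> u x uU; rewrite WE gU.
Qed.

Lemma Zspace_sub U U' : (U <= U')%VS -> (Zspace U' <= Zspace U)%VS.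
Proof.
move=> UU'; apply/subvP => W /ZspaceP [WZ WU]; apply/ZspaceP; split=> // u x uU.
by apply: WU; exact: (subvP UU' u uU).
Qed.

Section Cocycle.
Variable g : V -> V -> K.
Hypotheses (gb : bilin g) (gc : cocycle L g).

(** Super-skew-symmetry speaks of homogeneous arguments, so vanishing in the left slot passes to the
    right slot after [u] is split into its components, which stay in the graded [U]. *)
Lemma cocycle_radr (U : {vspace V}) u x : graded U ->
  (forall y z, y \in U -> g y z = 0) -> u \in U -> g x u = 0.
Proof.
move=> Ug gU uU; rewrite -(part_add false u) (bilinDr gb).
elim/(@homog_ind _ _ L): x => [x y|b x hx].
  by rewrite !(bilinDl gb) addrACA => -> ->; rewrite addr0.
by rewrite !(gc.1 _ _ _ _ hx (part_homog _ _)) !gU ?Ug // !mulr0 oppr0 addr0.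
Qed.

Lemma cocycle_evenC x y : homog L false x -> g x y = - g y x.
Proof.
move=> hx; elim/(@homog_ind _ _ L): y => [y z|b y hy].
  by rewrite (bilinDl gb) (bilinDr gb) opprD => -> ->.
by rewrite (gc.1 _ _ _ _ hx hy) /= expr0 mul1r.
Qed.

Lemma cocycle_br b c x y u : homog L b x -> homog L c y ->
  g (br L x y) u = g x (br L y u) - (-1) ^+ (b && c) * g y (br L x u).
Proof.
move=> hx hy; elim/(@homog_ind _ _ L): u => [u w|d u hu].
  by rewrite !brDr !(bilinDr gb) => -> ->; ring.
by rewrite (gc.2 _ _ _ _ _ _ hx hy hu) addrK.
Qed.

End Cocycle.

Lemma Zspace_radr (U : {vspace V}) W u x : graded U -> W \in Zspace U -> u \in U ->
  bform W x u = 0.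
Proof.
by move=> Ug /ZspaceP [Wc WU]; apply: (cocycle_radr (bform_bilin W)) => // y z; apply: WU.
Qed.

End Graded.

(** * The derived algebra *)

Section Span.
Variables (K : numFieldType) (V : lmodType K).
Implicit Types A B : set V.

Lemma lspan_incl A x : A x -> lspan A x.
Proof.
move=> Ax; exists 1%N, (fun=> 1), (fun=> x); split=> //.
by rewrite big_ord1 scale1r.
Qed.

Lemma lspan0 A : lspan A 0.
Proof.
by exists 0%N, (fun=> 0), (fun=> 0); split; [case | rewrite big_ord0].
Qed.

Lemma lspan_lin A a x y : lspan A x -> lspan A y -> lspan A (a *: x + y).
Proof.
move=> [k [c [w [Aw ->]]]] [l [c' [w' [Aw' ->]]]].
exists (k + l)%N, (fun i => match split i with inl i => a * c i | inr i => c' i end),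
  (fun i => match split i with inl i => w i | inr i => w' i end).
split; first by move=> i; case: (split i).
rewrite big_split_ord scaler_sumr /=; congr (_ + _); apply: eq_bigr => i _.
  by rewrite -[lshift _ _]/(unsplit (inl i)) unsplitK scalerA.
by rewrite -[rshift _ _]/(unsplit (inr i)) unsplitK.
Qed.

Lemma lspan_ind A (S : V -> Prop) : S 0 ->
  (forall a x y, S x -> S y -> S (a *: x + y)) -> (forall x, A x -> S x) ->
  forall x, lspan A x -> S x.
Proof.
move=> S0 SL AS x [k [c [w [Aw ->]]]].
by elim/big_rec: _ => // i y _ Sy; apply: SL => //; apply/AS/Aw.
Qed.

End Span.

Section Derived.
Variables (K : numFieldType) (V : vectType K) (L : lieSuper V).
Implicit Types U W : {vspace V}.

Definition brspan U : {vspace V} :=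
  (<<[seq br L u x | u <- vbasis U, x <- vbasis {:V}]>>)%VS.

Lemma br_brspan U u x : u \in U -> br L u x \in brspan U.
Proof.
move=> /coord_vbasis ->; rewrite br_suml; apply: memv_suml => i _.
rewrite brZl memvZ // (coord_vbasis (memvf x)) br_sumr; apply: memv_suml => j _.
rewrite brZr memvZ // memv_span //; apply/allpairsP.
by exists ((vbasis U)`_i, (vbasis {:V})`_j); rewrite /= !mem_nth ?size_tuple.
Qed.

Lemma brspan_sub U W : (forall u x, u \in U -> br L u x \in W) ->
  (brspan U <= W)%VS.
Proof.
move=> h; apply/span_subvP => _ /allpairsP [[u x] /= [uU _ ->]].
exact/h/vbasis_mem.
Qed.

Lemma brspanS U W : (U <= W)%VS -> (brspan U <= brspan W)%VS.
Proof. by move=> UW; apply: brspan_sub => u x /(subvP UW); exact: br_brspan. Qed.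

Lemma mem_brspan U x : brset L [set u | u \in U]%classic setT x <-> x \in brspan U.
Proof.
split.
  apply: (@lspan_ind _ _ _ (fun x => x \in brspan U)); first exact: mem0v.
    by move=> a y z hy hz; rewrite memvD ?memvZ.
  by move=> _ [u [y [/= uU _ ->]]]; exact: br_brspan.
have [W WP] := vspace_of_pred (@lspan0 _ _ _) (@lspan_lin _ _
  [set v | exists u x, [/\ [set u | u \in U]%classic u, setT x & v = br L u x]]%classic).
suff /subvP h : (brspan U <= W)%VS by move=> /h/WP.
apply: brspan_sub => u y uU; apply/WP; apply: lspan_incl.
by exists u, y.
Qed.

Definition derived : {vspace V} := brspan fullv.

Lemma br_derived x y : br L x y \in derived.
Proof. exact/br_brspan/memvf. Qed.

Variable Vp : bool -> {vspace V}.
Hypothesis VpP : forall b x, homog L b x <-> x \in Vp b.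

(** A bracket of homogeneous vectors is homogeneous, so a parity projection either keeps it or kills
    it. *)
Lemma brspan_graded U : graded Vp U -> graded Vp (brspan U).
Proof.
move=> Ug b x; rewrite -!(mem_brspan U); move: x.
have neq_negb (e e' : bool) : e != e' -> e = ~~ e' by case: e e' => -[].
pose S x := part Vp b x \in brspan U.
suff h x : x \in brspan U -> S x by move=> x /mem_brspan/h xU; apply/mem_brspan.
move=> /mem_brspan; apply: (@lspan_ind _ _ _ S); rewrite /S.
- by rewrite linear0 mem0v.
- by move=> a y z hy hz; rewrite linearP memvD ?memvZ.
move=> _ [u [y [/= uU _ ->]]].
have hom c d : part Vp b (br L (part Vp c u) (part Vp d y)) \in brspan U.
  have := br_homog (part_homog VpP c u) (part_homog VpP d y).
  have [<-|cdb] := eqVneq (c (+) d) b => hb.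
    by rewrite (part_id VpP hb) br_brspan ?Ug.
  by rewrite (part_other VpP) ?mem0v //; rewrite -(neq_negb _ _ cdb).
rewrite -(part_add VpP false u) -(part_add VpP false y) !brDl !brDr !linearD /=.
by rewrite !memvD.
Qed.

Lemma derived_graded : graded Vp derived.
Proof. exact/brspan_graded/gradedf. Qed.

End Derived.

(** * Central extensions and the Hopf formula *)

Section CentralExtension.
Variables (K : numFieldType) (V : vectType K) (L : lieSuper V).
Variable Vp : bool -> {vspace V}.
Hypothesis VpP : forall b x, homog L b x <-> x \in Vp b.
Variable g : V -> V -> K.
Hypotheses (gb : bilin g) (gc : cocycle L g).

Definition parity_inv (x : V) : V := part Vp false x - part Vp true x.

Lemma parity_inv_lin a x y :
  parity_inv (a *: x + y) = a *: parity_inv x + parity_inv y.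
Proof. by rewrite /parity_inv !linearP /= scalerDr addrACA. Qed.

Lemma parity_inv_homog b x : homog L b x -> parity_inv x = (-1) ^+ b *: x.
Proof.
rewrite /parity_inv; case: b => hx.
  by rewrite (part_id VpP hx) (part_other VpP (b := false) hx) sub0r scaleN1r.
by rewrite (part_id VpP hx) (part_other VpP (b := true) hx) subr0 scale1r.
Qed.

(* The center is graded by the eigenspaces of the swap of the two copies of K,
   so that g need not be homogeneous. *)
Definition ext_homog (b : bool) : set (V * (K^o * K^o)) :=
  [set w | homog L b w.1 /\ w.2.2 = (-1) ^+ b * w.2.1]%classic.

(** The second central entry is the form twisted by the parity involution. On arguments of parities
    b and c it is (-1)^(b + c) times the first entry, which is the swap eigenvalue required in
    parity b + c. *)
Definition ext_br (u w : V * (K^o * K^o)) : V * (K^o * K^o) :=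
  (br L u.1 w.1, (g u.1 w.1, g (parity_inv u.1) (parity_inv w.1))).

Lemma ext_brE b c u w : homog L b u.1 -> homog L c w.1 ->
  ext_br u w = (br L u.1 w.1, (g u.1 w.1, (-1) ^+ (b (+) c) * g u.1 w.1)).
Proof.
move=> hu hw; rewrite /ext_br (parity_inv_homog hu) (parity_inv_homog hw).
by rewrite (bilinZl gb) (bilinZr gb) mulrA signr_addb.
Qed.

Lemma ext_lin b (a : K) x y :
  ext_homog b x -> ext_homog b y -> ext_homog b (a *: x + y).
Proof.
move=> [hx ex] [hy ey]; split; first exact: homog_lin.
by rewrite /= ex ey /GRing.scale /= mulrDr mulrCA.
Qed.

Lemma ext_dec v : exists x y, [/\ ext_homog false x, ext_homog true y & v = x + y].
Proof.
case: v => v [a c]; have [x [y [hx hy ->]]] := homog_dec L v.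
exists (x, ((a + c) / 2, (a + c) / 2)), (y, ((a - c) / 2, - ((a - c) / 2))).
split; first by split=> //=; rewrite expr0 mul1r.
  by split=> //=; rewrite expr1 mulN1r.
by congr (_, (_, _)); rewrite /=; field.
Qed.

Lemma ext_cap v : ext_homog false v -> ext_homog true v -> v = 0.
Proof.
case: v => v [a c] [/= h1 e1] [/= h2 e2]; rewrite (homog_cap h1 h2).
have a0 : a = 0.
  by apply/eqP; rewrite -eqNr -mulN1r -[-1]expr1 -e2 e1 expr0 mul1r.
by rewrite e1 a0 mulr0.
Qed.

Lemma ext_linl (a : K) x y z : ext_br (a *: x + y) z = a *: ext_br x z + ext_br y z.
Proof. by rewrite /ext_br /= br_linl parity_inv_lin !gb.1. Qed.

Lemma ext_linr (a : K) x y z : ext_br z (a *: x + y) = a *: ext_br z x + ext_br z y.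
Proof. by rewrite /ext_br /= br_linr parity_inv_lin !gb.2. Qed.

Lemma ext_br_homog b c x y :
  ext_homog b x -> ext_homog c y -> ext_homog (b (+) c) (ext_br x y).
Proof.
by move=> [hx _] [hy _]; rewrite (ext_brE hx hy); split=> //=; apply: br_homog.
Qed.

Lemma ext_skew b c x y : ext_homog b x -> ext_homog c y ->
  ext_br x y = - ((-1) ^+ (b && c) *: ext_br y x).
Proof.
move=> [hx _] [hy _]; rewrite (ext_brE hx hy) (ext_brE hy hx).
rewrite (br_skew hx hy) (gc.1 _ _ _ _ hx hy) [c (+) b]addbC.
move: (_ ^+ (b && c)) (_ ^+ (b (+) c)) => s t.
by congr (_, (_, _)); rewrite mulrN; congr (- _); exact: mulrCA.
Qed.

Lemma ext_jacobi b c d x y z :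
  ext_homog b x -> ext_homog c y -> ext_homog d z ->
  ext_br x (ext_br y z) =
  ext_br (ext_br x y) z + (-1) ^+ (b && c) *: ext_br y (ext_br x z).
Proof.
move=> [hx _] [hy _] [hz _].
rewrite (ext_brE (w := ext_br y z) hx (br_homog hy hz)).
rewrite (ext_brE (u := ext_br x y) (br_homog hx hy) hz).
rewrite (ext_brE (w := ext_br x z) hy (br_homog hx hz)) /=.
rewrite (br_jacobi hx hy hz) (gc.2 _ _ _ _ _ _ hx hy hz).
rewrite -addbA [c (+) (b (+) d)]addbCA.
move: (_ ^+ (b && c)) (_ ^+ (b (+) (c (+) d))) => s t.
by congr (_, (_, _)); rewrite mulrDr; congr (_ + _); exact: mulrCA.
Qed.

Definition ext : lieSuper (V * (K^o * K^o))%type :=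
  LieSuper ext_lin ext_dec ext_cap ext_linl ext_linr ext_br_homog
    ext_skew ext_jacobi.

(** Freeness lifts the projection F -> L to the central extension defined by [g]. The central
    coordinate of the lift is a functional whose value on a bracket is [g] of the projections. *)
Lemma cocycle_lift (P : free_presentation L) :
  exists l : fp_space P -> K,
    (forall a x y, l (a *: x + y) = a * l x + l y) /\
    forall u w, l (br (fp_alg P) u w) = g (fp_proj P u) (fp_proj P w).
Proof.
case: P => W F X par i [ip free] p [ph pbr] psurj /=.
(* The central parts of the lifted generators are arbitrary; 0 has the right parity in both
   cases. *)
have [|f [[fh fbr] fi _]] := free _ ext (fun x => (p (i x), (0, 0))).
  by move=> x; split; rewrite /= ?mulr0 //; apply: ph.
have [|f0 [_ _ f0u]] := free _ L (fun x => p (i x)).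
  by move=> x; apply: ph.
have f1l a x y : (f (a *: x + y)).1 = a *: (f x).1 + (f y).1 by rewrite linearP.
pose f1 : {linear W -> V} :=
  HB.pack (fun x => (f x).1) (GRing.isLinear.Build K W V _ (fun x => (f x).1) f1l).
(* The L-component of the lift and the projection agree on generators, so the uniqueness clause of
   freeness identifies them. *)
have f1p w : (f w).1 = p w.
  rewrite -[LHS]/(f1 w) (f0u f1) ?(f0u p) //.
    split=> [b x /fh [] //|x y].
    by rewrite -[LHS]/(f (br F x y)).1 fbr.
  by move=> x; rewrite -[LHS]/(f (i x)).1 fi.
exists (fun x => (f x).2.1); split=> [a x y|u w]; first by rewrite linearP.
by rewrite fbr /= !f1p.
Qed.

End CentralExtension.

(** Write each [e i] through the [e' j] modulo [B]. A linear relation between the rows of the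
    coefficient matrix would be a relation between the [e i] modulo [B], so the rows are
    independent. *)
Lemma quo_dim_le (K : numFieldType) (V : lmodType K) (A B : set V) d d' :
  B 0 -> (forall a x y, B x -> B y -> B (a *: x + y)) ->
  quo_dim A B d -> quo_dim A B d' -> (d <= d')%N.
Proof.
move=> B0 BL [e [eA ef _]] [e' [_ _ e's]].
have [c cE] := choice (fun i => e's (e i) (eA i)).
pose C : 'M[K]_(d, d') := \matrix_(i, j) c i j.
have Bs (I : finType) (a : I -> K) (w : I -> V) :
    (forall i, B (w i)) -> B (\sum_i a i *: w i).
  by move=> wB; elim/big_rec: _ => // i x _; apply: BL.
suff : row_free C by move=> /eqP <-; exact: rank_leq_col.
rewrite -kermx_eq0; apply/eqP/matrixP => k i; rewrite [RHS]mxE; move: i.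
apply: (ef (fun i => kermx C k i)).
have -> : \sum_i kermx C k i *: e i =
          \sum_i kermx C k i *: (e i - \sum_j c i j *: e' j).
  apply/eqP; rewrite -subr_eq0 -sumrB; apply/eqP.
  under eq_bigr => i _ do rewrite -scalerBr subKr scaler_sumr.
  rewrite exchange_big big1 // => j _.
  under eq_bigr => i _ do rewrite scalerA.
  rewrite -scaler_suml.
  have : (kermx C *m C) k j = 0 by rewrite mulmx_ker mxE.
  by rewrite [LHS]mxE; under eq_bigr => i _ do rewrite [C _ _]mxE; move=> ->; rewrite scale0r.
exact: Bs.
Qed.

(** * The Hopf formula in dual form *)

Section Hopf.
Variables (K : numFieldType) (V : vectType K) (L : lieSuper V).
Variable Vp : bool -> {vspace V}.
Hypothesis VpP : forall b x, homog L b x <-> x \in Vp b.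
Variable P : free_presentation L.
Local Notation N := (\dim {:V}).
Local Notation X := (vbasis {:V}).
Local Notation F := (fp_alg P).
Local Notation p := (fp_proj P).
Local Notation commFR := (brset F setT (fp_ker (P := P))).

Lemma commFR_lin a x y : commFR x -> commFR y -> commFR (a *: x + y).
Proof. exact: lspan_lin. Qed.

Lemma commFR0 : commFR 0.
Proof. exact: lspan0. Qed.

Lemma commFRD x y : commFR x -> commFR y -> commFR (x + y).
Proof. by move=> hx hy; rewrite -[x]scale1r; apply: commFR_lin. Qed.

Lemma commFRZ a x : commFR x -> commFR (a *: x).
Proof. by move=> hx; rewrite -[_ *: _]addr0; apply: commFR_lin => //; exact: commFR0. Qed.

Lemma commFRN x : commFR x -> commFR (- x).
Proof. by rewrite -scaleN1r; exact: commFRZ. Qed.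

Lemma commFR_brr u r : p r = 0 -> commFR (br F u r).
Proof. by move=> pr; apply: lspan_incl; exists u, r. Qed.

Lemma homog_lift b x : homog L b x -> exists2 w, homog F b w & p w = x.
Proof.
move=> hx; have [w pw] := fp_surj P x.
have [u [v [hu hv wE]]] := homog_dec F w.
have [hpu hpv] : homog L false (p u) /\ homog L true (p v).
  by split; apply: (fp_hom P).1.
have := pw; rewrite wE linearD /= => pE.
case: b hx => hx; [exists v => //|exists u => //].
  have pu0 : p u = 0.
    by apply: (homog_cap hpu); rewrite -(addrK (p v) (p u)) pE; apply: homogB.
  by rewrite -pE pu0 add0r.
have pv0 : p v = 0.
  by apply: homog_cap hpv; rewrite -(addKr (p u) (p v)) pE addrC; apply: homogB.
by rewrite -pE pv0 addr0.
Qed.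

(** The commutator space is spanned by brackets with the kernel on the right. The kernel is graded
    because the projection is even, so [r] splits into homogeneous relations, and
    super-skew-symmetry moves each of them to the right. *)
Lemma commFR_brl u r : p r = 0 -> commFR (br F r u).
Proof.
move=> pr; have [r0 [r1 [h0 h1 rE]]] := homog_dec F r.
have [hp0 hp1] : homog L false (p r0) /\ homog L true (p r1).
  by split; apply: (fp_hom P).1.
move: pr; rewrite rE linearD /= => /eqP; rewrite addr_eq0 => /eqP pE.
have pr1 : p r1 = 0.
  by apply: homog_cap hp1; rewrite -[p r1]opprK -pE; apply: homogN.
have pr0 : p r0 = 0 by rewrite pE pr1 oppr0.
rewrite brDl; elim/(@homog_ind _ _ F): u => [u w|b u hu].
  by rewrite !brDr addrACA; apply: commFRD.
apply: commFRD.
  by rewrite (br_skew h0 hu); apply/commFRN/commFRZ/commFR_brr.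
by rewrite (br_skew h1 hu); apply/commFRN/commFRZ/commFR_brr.
Qed.

Lemma commFR_ker x : commFR x -> p x = 0.
Proof.
apply: (@lspan_ind _ _ _ (fun x => p x = 0)); first exact: linear0.
  by move=> a y z hy hz; rewrite linearP hy hz scaler0 addr0.
by move=> _ [u [r [_ pr ->]]]; rewrite (fp_hom P).2 [p r]pr br0r.
Qed.

Variable lift : 'I_N -> fp_space P.
Hypothesis liftE : forall i, p (lift i) = X`_i.

(** Here a matrix stands for an element of V tensor V. Modulo [F, R] a bracket depends only on the
    images of its arguments in L, so these elements represent all of [F, F]. *)
Definition lift2 (c : 'M[K]_N) : fp_space P :=
  \sum_i \sum_j c i j *: br F (lift i) (lift j).

Lemma lift2_lin a c c' : lift2 (a *: c + c') = a *: lift2 c + lift2 c'.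
Proof.
rewrite /lift2 scaler_sumr -big_split; apply: eq_bigr => i _ /=.
rewrite scaler_sumr -big_split; apply: eq_bigr => j _ /=.
by rewrite !mxE scalerDl scalerA.
Qed.

Lemma lift2_0 : lift2 0 = 0.
Proof. by rewrite -[X in lift2 X](subrr 0) -scaleN1r addrC lift2_lin scaleN1r addNr. Qed.

Lemma lift2_sum (I : finType) (a : I -> K) (c : I -> 'M[K]_N) :
  lift2 (\sum_i a i *: c i) = \sum_i a i *: lift2 (c i).
Proof. by elim/big_rec2: _ => [|i y x _ <-]; rewrite ?lift2_0 ?lift2_lin. Qed.

Lemma lift2_tensor u w : commFR (br F u w - lift2 (tensor (p u) (p w))).
Proof.
pose s x : fp_space P := \sum_i coord X i (p x) *: lift i.
have ps x : p (x - s x) = 0.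
  rewrite linearB linear_sum /=; apply/eqP; rewrite subr_eq0; apply/eqP.
  rewrite {1}(coord_vbasis (memvf (p x))); apply: eq_bigr => i _.
  by rewrite linearZ /= liftE.
have -> : lift2 (tensor (p u) (p w)) = br F (s u) (s w).
  rewrite br_suml; apply: eq_bigr => i _; rewrite br_sumr; apply: eq_bigr => j _.
  by rewrite brZl brZr scalerA mxE.
have -> : br F u w - br F (s u) (s w) = br F (u - s u) w + br F (s u) (w - s w).
  by rewrite brBl brBr addrA subrK.
by apply: commFRD; [apply: commFR_brl | apply: commFR_brr].
Qed.

Definition mulL (c : 'M[K]_N) : V := \sum_i \sum_j c i j *: br L X`_i X`_j.

Lemma mulL_lift2 c : p (lift2 c) = mulL c.
Proof.
rewrite linear_sum; apply: eq_bigr => i _; rewrite linear_sum.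
by apply: eq_bigr => j _; rewrite linearZ /= (fp_hom P).2 !liftE.
Qed.

Lemma mulL_lin a c c' : mulL (a *: c + c') = a *: mulL c + mulL c'.
Proof. by rewrite -!mulL_lift2 lift2_lin linearP. Qed.

Lemma mulL_tensor u w : mulL (tensor u w) = br L u w.
Proof.
rewrite {2}(coord_vbasis (memvf u)) br_suml; apply: eq_bigr => i _.
rewrite {2}(coord_vbasis (memvf w)) br_sumr; apply: eq_bigr => j _.
by rewrite brZl brZr scalerA mxE.
Qed.

(* The only use of freeness: cocycle_lift splits the central extension defined
   by W over F. *)
Lemma cocycle_lift2P W : cocycle L (bform W) <->
  forall c, commFR (lift2 c) -> pairing W c = 0.
Proof.
split=> [Wc c|W0].
  have [l [ll lbr]] := cocycle_lift VpP (bform_bilin W) Wc P.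
  have l0 : l 0 = 0.
    by apply: (addrI (l 0)); rewrite -{1}[l 0]mul1r -ll scale1r !addr0.
  have lsum (I : finType) (a : I -> K) (w : I -> fp_space P) :
      l (\sum_i a i *: w i) = \sum_i a i * l (w i).
    by elim/big_rec2: _ => [|i y x _ <-]; rewrite ?l0 ?ll.
  have lR x : commFR x -> l x = 0.
    apply: (@lspan_ind _ _ _ (fun x => l x = 0)) => //.
      by move=> a y z; rewrite ll => -> ->; rewrite mulr0 addr0.
    move=> _ [u [r [_ pr ->]]].
    by rewrite lbr [p r]pr (bilin0r (bform_bilin W)).
  move=> /lR <-.
  have -> : lift2 c = \sum_i 1 *: \sum_j c i j *: br F (lift i) (lift j).
    by apply: eq_bigr => i _; rewrite scale1r.
  rewrite lsum pairingC; apply: eq_bigr => i _; rewrite lsum mul1r.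
  by apply: eq_bigr => j _; rewrite lbr !liftE bform_vbasis.
(* For the converse, skew-symmetry and the Jacobi identity hold in F; the corresponding combinations
   of tensors therefore lift into [F, R], and [W] annihilates them. *)
have tl u w : commFR (lift2 (tensor (p u) (p w)) - br F u w).
  by rewrite -opprB; apply/commFRN/lift2_tensor.
split=> [b c x y hx hy|b c d x y z hx hy hz].
  have [u hu <-] := homog_lift hx; have [w hw <-] := homog_lift hy.
  set s := (-1) ^+ _; apply/eqP; rewrite eq_sym -subr_eq0 -opprD oppr_eq0; apply/eqP.
  rewrite -pairing_linr; apply: W0; rewrite lift2_lin.
  have -> : s *: lift2 (tensor (p w) (p u)) + lift2 (tensor (p u) (p w)) =
    s *: (lift2 (tensor (p w) (p u)) - br F w u) +
    (lift2 (tensor (p u) (p w)) - br F u w).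
    rewrite (br_skew hu hw) -/s scalerBr opprK.
    by rewrite addrACA addNr addr0.
  exact: commFR_lin.
have [u hu <-] := homog_lift hx; have [v hv <-] := homog_lift hy.
have [w hw <-] := homog_lift hz; rewrite -!(fp_hom P).2.
set s := (-1) ^+ _.
have tK : commFR (lift2 ((-1) *: (s *: tensor (p v) (p (br F u w)) +
    tensor (p (br F u v)) (p w)) + tensor (p u) (p (br F v w)))).
  rewrite !lift2_lin.
  have jac0 : (-1) *: (s *: br F v (br F u w) + br F (br F u v) w) +
      br F u (br F v w) = 0.
    by rewrite (br_jacobi hu hv hw) scaleN1r addrC [br F (br F u v) w + _]addrC subrr.
  rewrite -[X in commFR X]subr0 -{1}jac0 opprD addrACA -scalerBr opprD addrACA -scalerBr.
  by apply: commFR_lin => //; apply: commFR_lin.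
have := W0 _ tK; rewrite !pairing_linr => e.
by apply/eqP; rewrite -subr_eq0 -e /bform; apply/eqP; ring.
Qed.


Lemma dim_mulL_ker (K1 : {vspace 'M[K]_N}) :
  (forall c, c \in K1 <-> mulL c = 0) -> (\dim K1 + \dim (derived L) = N * N)%N.
Proof.
move=> K1P; have [f fE] := lfun_of_linear mulL_lin.
have dimM : \dim {: 'M[K]_N} = (N * N)%N by rewrite dimvf.
have := limg_ker_dim f fullv; rewrite dimM => <-; congr addn; congr (\dim _).
  by apply/vspaceP => c; rewrite memv_cap memvf memv_ker fE /=; apply/idP/eqP => /K1P.
apply/eqP; rewrite eqEsubv; apply/andP; split.
  apply: brspan_sub => u w _; rewrite -mulL_tensor -fE.
  by apply/memv_img/memvf.
apply/subvP => _ /memv_imgP [c _ ->]; rewrite fE.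
by apply: memv_suml => i _; apply: memv_suml => j _; rewrite memvZ ?br_derived.
Qed.

Lemma dim_annihilator (U Z : {vspace 'M[K]_N}) :
  (forall W, W \in Z <-> forall c, c \in U -> pairing W c = 0) ->
  (\dim Z + \dim U = N * N)%N.
Proof.
move=> ZP; pose e := vbasis U.
have ef : free e by exact: basis_free (vbasisP _).
have dimM : \dim {: 'M[K]_N} = (N * N)%N by rewrite dimvf.
pose f (i : 'I_(\dim U)) (W : 'M[K]_N) := pairing W e`_i.
have fl i a x y : f i (a *: x + y) = a * f i x + f i y by exact: pairing_linl.
have fZ W : (forall i, f i W = 0) -> W \in Z.
  move=> fW; apply/ZP => c /coord_vbasis ->; rewrite -(scale1r (\sum_i _)).
  elim/big_rec: _ => [|i y _]; first by rewrite scaler0 pairing0.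
  by rewrite !scale1r pairing_linr => ->; rewrite addr0 [pairing _ _]fW mulr0.
rewrite -[\dim U]card_ord -dimM; apply/eqP; rewrite eqn_leq.
rewrite (dim_le_coords fl) ?andbT => [|W _ /fZ //].
apply: (dim_ge_coords fl) => [W WZ|c].
  split; first exact: memvf.
  by move=> i; apply: (ZP W).1 => //; apply: vbasis_mem; rewrite mem_nth ?size_tuple.
(* Prescribed values on a basis of [U] extend to a functional on all matrices; its values on the
   matrix units are the entries of the matrix that represents it. *)
pose h (A : 'M[K]_N) := \sum_k c k * coord e k A.
have hl a A B : h (a *: A + B) = a * h A + h B.
  rewrite /h mulr_sumr -big_split; apply: eq_bigr => k _ /=.
  by rewrite linearP mulrDr mulrCA.
have h0 : h 0 = 0 by apply: big1 => k _; rewrite linear0 mulr0.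
exists (\matrix_(i, j) h (delta_mx i j)); first exact: memvf.
move=> i; rewrite /f /pairing.
have -> : c i = h e`_i.
  rewrite /h (bigD1 i) //= coord_free // eqxx mulr1 big1 ?addr0 // => k ki.
  by rewrite coord_free // eq_sym (negPf ki) mulr0.
rewrite {2}(matrix_sum_delta e`_i).
have hsum (I : finType) (G : I -> 'M[K]_N) : h (\sum_i G i) = \sum_i h (G i).
  elim/big_rec2: _ => [|k y x _ <-]; first exact: h0.
  by rewrite -[G k]scale1r hl mul1r scale1r.
rewrite hsum; apply: eq_bigr => k _; rewrite hsum; apply: eq_bigr => l _.
by rewrite -[_ *: _]addr0 hl h0 addr0 mxE mulrC.
Qed.

(** Let K1 be the kernel of the bracket on V tensor V and K0 the set of tensors that lift into
    [F, R]. The multiplier is K1 / K0, and the cocycles form the annihilator of K0, so its dimension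
    is (N^2 - dim L') - (N^2 - dim Z(0)). *)
Lemma schur_dim_lift : exists d, schur_dim P d /\
  (d + \dim (derived L) = \dim (Zspace L 0))%N.
Proof.
have [K0 K0P] : exists K0 : {vspace 'M[K]_N}, forall c, c \in K0 <-> commFR (lift2 c).
  apply: vspace_of_pred; first by rewrite lift2_0; exact: commFR0.
  by move=> a x y hx hy; rewrite lift2_lin; apply: commFR_lin.
have [K1 K1P] : exists K1 : {vspace 'M[K]_N}, forall c, c \in K1 <-> mulL c = 0.
  apply: vspace_of_pred; first by rewrite -mulL_lift2 lift2_0 linear0.
  by move=> a x y hx hy; rewrite mulL_lin hx hy scaler0 addr0.
have K01 : (K0 <= K1)%VS.
  by apply/subvP => c /K0P /commFR_ker pc; apply/K1P; rewrite -mulL_lift2.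
have := dim_mulL_ker K1P.
have ZP W : W \in Zspace L 0 <-> forall c, c \in K0 -> pairing W c = 0.
  split=> [/ZspaceP [/cocycle_lift2P W0 _] c /K0P /W0 //|W0].
  apply/ZspaceP; split; first by apply/cocycle_lift2P => c /K0P /W0.
  by move=> u x; rewrite memv0 => /eqP ->; rewrite (bilin0l (bform_bilin W)).
have := dim_annihilator ZP.
have := dimv_cap_compl K1 K0; rewrite (capv_idPr K01).
set C := (K1 :\: K0)%VS => dK dZ dD.
exists (\dim C); split; last by lia.
pose e := vbasis C.
have ef : free e by exact: basis_free (vbasisP _).
exists (fun i : 'I_(\dim C) => lift2 e`_i); split.
- move=> i; have eC : e`_i \in C by rewrite vbasis_mem // mem_nth ?size_tuple.
  split; last first.
    by rewrite /fp_ker /= mulL_lift2; apply/K1P; exact: (subvP (diffvSl K1 K0)).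
  rewrite /lift2; elim/big_rec: _ => [|k x _ hx]; first exact: lspan0.
  rewrite -[\sum_j _]scale1r; apply: lspan_lin => //.
  elim/big_rec: _ => [|l y _ hy]; first exact: lspan0.
  by apply: lspan_lin => //; apply: lspan_incl; exists (lift k), (lift l).
- move=> c; rewrite -lift2_sum => /K0P cK0.
  apply: (elimT freeP ef c); apply/eqP; rewrite -memv0 -(capv_diff K1 K0) memv_cap cK0.
  by rewrite andbT memv_suml // => i _; rewrite memvZ ?vbasis_mem ?mem_nth ?size_tuple.
move=> v [vF pv].
have [c vc] : exists c, commFR (v - lift2 c).
  move: vF; apply: (@lspan_ind _ _ _ (fun v => exists c, commFR (v - lift2 c))).
  - by exists 0; rewrite lift2_0 subrr; exact: commFR0.
  - move=> a x y [c xc] [c' yc]; exists (a *: c + c').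
    by rewrite lift2_lin opprD addrACA -scalerBr; apply: commFR_lin.
  by move=> _ [u [w [_ _ ->]]]; exists (tensor (p u) (p w)); exact: lift2_tensor.
have cK1 : c \in (C + K0)%VS.
  rewrite addv_diff (addv_idPl K01); apply/K1P; rewrite -mulL_lift2.
  by have := commFR_ker vc; rewrite linearB /= [p v]pv sub0r => /eqP; rewrite oppr_eq0 => /eqP.
have [c1 c1C [c0 /K0P c0K cE]] := memv_addP cK1.
exists (fun i => coord e i c1); rewrite -lift2_sum -(coord_vbasis c1C).
have -> : v - lift2 c1 = (v - lift2 c) + lift2 c0.
  by rewrite cE -[c1]scale1r lift2_lin !scale1r opprD addrA subrK.
exact: commFRD.
Qed.

End Hopf.

(** One dimension exists and quotient dimensions are unique. The right-hand side does not mention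
    [P], which is the independence of the presentation. *)
Lemma schur_dimE (K : numFieldType) (V : vectType K) (L : lieSuper V)
    (Vp : bool -> {vspace V}) (P : free_presentation L) d :
  (forall b x, homog L b x <-> x \in Vp b) ->
  schur_dim P d <-> (d + \dim (derived L) = \dim (Zspace L 0))%N.
Proof.
move=> VpP.
have [lift liftE] := choice (fun i : 'I_(\dim {:V}) => fp_surj P (vbasis {:V})`_i).
have [d0 [Pd0 dE]] := schur_dim_lift VpP liftE.
split=> [Pd|dd]; last by have -> : d = d0 by lia.
rewrite -dE; congr (_ + _)%N; apply/eqP.
have B0 : brset (fp_alg P) setT (fp_ker (P := P)) 0 by exact: lspan0.
have BL a x y : brset (fp_alg P) setT (fp_ker (P := P)) x ->
    brset (fp_alg P) setT (fp_ker (P := P)) y ->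
    brset (fp_alg P) setT (fp_ker (P := P)) (a *: x + y) by exact: lspan_lin.
by rewrite eqn_leq (quo_dim_le B0 BL Pd Pd0) (quo_dim_le B0 BL Pd0 Pd).
Qed.

(** * The dimension count *)

Section DimForms.
Variables (K : numFieldType) (V : vectType K) (L : lieSuper V).
Variable Vp : bool -> {vspace V}.
Hypothesis VpP : forall b x, homog L b x <-> x \in Vp b.
Variable D : {vspace V}.
Hypothesis Dg : graded Vp D.
Local Notation codim b := (\dim (Vp b) - \dim (D :&: Vp b))%N.

Lemma dim_graded : (\dim (D :&: Vp false) + \dim (D :&: Vp true) = \dim D)%N.
Proof.
rewrite -dimv_disjoint_sum; last first.
  apply/eqP; rewrite -subv0 -(cap_parts VpP false); apply/subvP => x.
  by rewrite !memv_cap => /andP [/andP [_ ->] /andP [_ ->]].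
congr (\dim _); apply/eqP; rewrite eqEsubv subv_add !capvSl /=.
apply/subvP => x xD; rewrite -(part_add VpP false x).
by rewrite memv_add // memv_cap Dg // part_mem.
Qed.

(** In effect these are homogeneous coordinates on L / D. Both parities are indexed by one ordinal
    type because the count of super-skew matrices needs a linear order on the indices. *)
Lemma homogeneous_complement : exists (v : nat) (par : 'I_v -> bool) (c : 'I_v -> V)
    (xi : 'I_v -> V -> K), [/\ v = (codim false + codim true)%N,
    #|[pred i | par i]| = codim true,
    forall i, homog L (par i) (c i),
    forall i, [/\ forall a x y, xi i (a *: x + y) = a * xi i x + xi i y,
      forall j, xi i (c j) = (i == j)%:R, forall x, x \in D -> xi i x = 0 &
      forall b x, homog L b x -> par i != b -> xi i x = 0] &
    forall x, x - \sum_i xi i x *: c i \in D].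
Proof.
pose C b := (Vp b :\: (D :&: Vp b))%VS.
have dC b : \dim (C b) = codim b.
  have := dimv_cap_compl (Vp b) (D :&: Vp b); rewrite (capv_idPr (capvSr _ _)).
  by rewrite -/(C b) => <-; rewrite addKn.
have C0 b : (C b :&: (D :&: Vp b) = 0)%VS by exact: capv_diff.
have CD b : (C b + (D :&: Vp b) = Vp b)%VS.
  by rewrite addv_diff (addv_idPl (capvSr _ _)).
pose J := ('I_(\dim (C false)) + 'I_(\dim (C true)))%type.
pose par (j : J) := if j is inl _ then false else true.
pose c (j : J) := match j with inl i => (vbasis (C false))`_i | inr i => (vbasis (C true))`_i end.
pose q b x := daddv_pi (C b) (D :&: Vp b) (part Vp b x).
pose xi (j : J) x := match j with
  | inl i => coord (vbasis (C false)) i (q false x)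
  | inr i => coord (vbasis (C true)) i (q true x) end.
have ql b a x y : q b (a *: x + y) = a *: q b x + q b y by rewrite /q !linearP.
have qD b x : x \in D -> q b x = 0.
  move=> xD; have := Dg b xD => pD; rewrite /q.
  have C0' : (D :&: Vp b :&: C b = 0)%VS by rewrite capvC.
  have := daddv_pi_add (C0 b) (w := part Vp b x).
  rewrite CD part_mem (daddv_pi_id C0') => [/(_ isT)|].
    by move=> /eqP; rewrite -subr_eq0 addrK => /eqP.
  by rewrite memv_cap pD part_mem.
have qid b x : x \in C b -> q b x = x.
  move=> xC; rewrite /q (part_id VpP) ?daddv_pi_id //; apply/VpP.
  exact: (subvP (diffvSl _ _)) xC.
have qother b x : homog L (~~ b) x -> q b x = 0.
  by move=> hx; rewrite /q (part_other VpP) // linear0.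
have cC i : c i \in C (par i) by case: i => i /=; rewrite vbasis_mem // mem_nth ?size_tuple.
have hc i : homog L (par i) (c i).
  by apply/VpP; exact: (subvP (diffvSl _ _)) (cC i).
have cf b : free (vbasis (C b)) by exact: basis_free (vbasisP _).
exists #|{: J}|, (par \o enum_val), (c \o enum_val), (xi \o enum_val); split.
- by rewrite card_sum !card_ord !dC.
- rewrite -dC -[RHS]card_ord.
  have inrI : injective (@inr 'I_(\dim (C false)) 'I_(\dim (C true))) by move=> ? ? [].
  rewrite -(card_imset predT inrI) -(card_imset _ (@enum_val_inj J predT)).
  apply: eq_card => j; apply/imsetP/imsetP => [[i pi ->]|[i _ ->]].
    by move: pi; rewrite inE /=; case: (enum_val i) => // k; exists k.
  by exists (enum_rank (inr i)); rewrite ?inE /= enum_rankK.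
- by move=> i; exact: hc.
- move=> i /=; split=> [a x y|j|x xD|b x].
  + by rewrite /xi; case: (enum_val i) => k; rewrite ql linearP.
  + rewrite -(inj_eq (@enum_val_inj J predT)).
    move: (enum_val i) (enum_val j) => k l; move: (hc l) (cC l).
    case: k => k; case: l => l /= hl lC.
    * by rewrite (qid _ _ lC) (coord_free l k (cf _)) eq_sym.
    * by rewrite qother // linear0.
    * by rewrite qother // linear0.
    * by rewrite (qid _ _ lC) (coord_free l k (cf _)) eq_sym.
  + by rewrite /xi; case: (enum_val i) => k; rewrite qD // linear0.
  by rewrite /xi; case: (enum_val i) => k; case: b => //= hx _;
    rewrite qother ?linear0.
move=> x; rewrite (reindex (@enum_rank J)) /=; last first.
  by exists (@enum_val J predT) => j _; rewrite ?enum_rankK ?enum_valK.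
under eq_bigr => j _ do rewrite enum_rankK.
rewrite big_sumType /=.
have qE b : \sum_i coord (vbasis (C b)) i (q b x) *: (vbasis (C b))`_i = q b x.
  by rewrite -(coord_vbasis (memv_pi _ _ _)).
rewrite !qE -{1}(part_add VpP false x) opprD addrACA.
have pq b : part Vp b x - q b x \in D.
  have := daddv_pi_add (C0 b) (w := part Vp b x).
  rewrite CD part_mem => /(_ isT) {1}<-; rewrite addrC addKr.
  exact: (subvP (capvSl D (Vp b))) (memv_pi _ _ _).
by rewrite memvD.
Qed.

(** The pairs counted are the free entries of a super-skew matrix: those below the diagonal, and the
    diagonal ones at odd indices, where the form is symmetric. *)
Lemma card_triangle v (par : 'I_v -> bool) :
  #|[pred s : 'I_v * 'I_v | (s.2 < s.1)%N || (s.1 == s.2) && par s.1]| =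
  ('C(v, 2) + #|[pred i | par i]|)%N.
Proof.
rewrite -sum1_card big_mkcond /=.
rewrite -(pair_big predT predT (fun i j : 'I_v =>
  if (i, j) \in [pred s : 'I_v * 'I_v | (s.2 < s.1)%N || (s.1 == s.2) && par s.1]
  then 1%N else 0%N)) /=.
have -> : 'C(v, 2) = (\sum_(i < v) i)%N by rewrite -bin2_sum big_mkord.
have -> : #|[pred i | par i]| = (\sum_(i < v) par i)%N.
  by rewrite -sum1_card big_mkcond; apply: eq_bigr => i _; rewrite inE; case: (par i).
rewrite -big_split /=; apply: eq_bigr => i _.
transitivity (\sum_(j < v) ((j < i)%N + (j == i) * (par i)))%N.
  apply: eq_bigr => j _; rewrite !inE /= [j == i]eq_sym -(inj_eq val_inj) /=.
  by case: (ltngtP i j) => //= _; case: (par i).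
rewrite big_split /=; congr (_ + _)%N.
  rewrite -[RHS]card_ord -sum1_card (big_ord_widen v (fun=> 1%N)) ?(ltnW (ltn_ord i)) //.
  by rewrite [RHS]big_mkcond; apply: eq_bigr => j _; case: ltnP.
rewrite (bigD1 i) //= eqxx mul1n big1 => [|j /negPf ->] //.
by rewrite addn0.
Qed.

Hypothesis DL : forall x y, br L x y \in D.

Lemma dim_Zspace_derived :
  \dim (Zspace L D) = ('C(\dim {:V} - \dim D, 2) + codim true)%N.
Proof.
have [v [par [c [xi [vE pE hc hxi sub]]]]] := homogeneous_complement.
have -> : (\dim {:V} - \dim D = v)%N.
  have := dim_parts VpP false; rewrite /= => <-; rewrite -dim_graded vE.
  have := dimvS (capvSr D (Vp false)); have := dimvS (capvSr D (Vp true)).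
  lia.
rewrite -pE -card_triangle.
set S := [pred s | _]; pose I := {s : 'I_v * 'I_v | S s}.
have <- : #|{: I}| = #|S| by rewrite card_sig; apply: eq_card.
pose f (s : I) (W : 'M[K]_(\dim {:V})) := bform W (c (val s).1) (c (val s).2).
have fl s a x y : f s (a *: x + y) = a * f s x + f s y by exact: bform_lin.
apply/eqP; rewrite eqn_leq; apply/andP; split; last first.
  suff : (\dim (0 : {vspace 'M[K]_(\dim {:V})}) + #|{: I}| <=
         \dim (Zspace L D))%N by rewrite dimv0.
  apply: (dim_ge_coords fl).
    move=> W; rewrite memv0 => /eqP ->; split; first exact: mem0v.
    by move=> i; exact: bform0.
  move=> T; pose T' s := if insub s is Some t then T t else 0 : K.
  have T'S s : ~~ S s -> T' s = 0 by move=> Ss; rewrite /T' insubN.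
  (* [T'] extends the prescribed entries by 0, and [M] is its super-skew completion. The mirrored
     entry is added off the diagonal only; otherwise an odd diagonal entry would be doubled. *)
  pose M i j := T' (i, j) - (i != j)%:R * ((-1) ^+ (par i && par j) * T' (j, i)).
  pose g x y := \sum_i \sum_j M i j * (xi i x * xi j y).
  have Msk i j : M i j = - ((-1) ^+ (par i && par j) * M j i).
    rewrite /M [j == i]eq_sym [par j && _]andbC.
    have [<-|ij] := eqVneq i j; last first.
      by rewrite !mul1r mulrBr opprB mulrA -expr2 sqrr_sign mul1r.
    rewrite !mul0r !subr0 andbb; case pi : (par i); first by rewrite expr1 mulN1r opprK.
    by rewrite T'S ?mulr0 ?oppr0 // /S /= ltnn eqxx pi.
  have gb : bilin g.
    split=> a x y z; rewrite /g mulr_sumr -big_split; apply: eq_bigr => i _ /=;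
      rewrite mulr_sumr -big_split; apply: eq_bigr => j _ /=;
      have [xil _ _ _] := hxi i; have [xjl _ _ _] := hxi j; rewrite (xil, xjl); ring.
  have gD x y : x \in D -> g x y = 0.
    move=> xD; apply: big1 => i _; apply: big1 => j _.
    by have [_ _ -> // _] := hxi i; rewrite mul0r mulr0.
  have gDr x y : y \in D -> g x y = 0.
    move=> yD; apply: big1 => i _; apply: big1 => j _.
    by have [_ _ -> // _] := hxi j; rewrite !mulr0.
  have gc : cocycle L g.
    split=> [b b' x y hx hy|b b' b'' x y z _ _ _]; last first.
      by rewrite gDr // gD // gDr // mulr0 addr0.
    rewrite /g [in RHS]exchange_big mulr_sumr -sumrN; apply: eq_bigr => i _ /=.
    rewrite mulr_sumr -sumrN; apply: eq_bigr => j _.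
    have [_ _ _ hi] := hxi i; have [_ _ _ hj] := hxi j.
    have [bi|bi] := eqVneq (par i) b; last by rewrite (hi b) // mul0r !mulr0 oppr0.
    have [bj|bj] := eqVneq (par j) b'; last by rewrite (hj b') // !(mul0r, mulr0) oppr0.
    by rewrite Msk bi bj; ring.
  have [W WZ WE] := Zspace_form gb gc gD; exists W => //= s.
  rewrite /f WE /g; case: s => -[i j] Sij /=.
  rewrite (bigD1 i) //= (bigD1 j) //= !big1 ?addr0.
  - have [_ -> _ _] := hxi i; have [_ -> _ _] := hxi j; rewrite !eqxx !mulr1 /M.
    have -> : T' (i, j) = T (exist _ (i, j) Sij) by rewrite /T' insubT.
    have [_|ij] := eqVneq i j; first by rewrite mul0r subr0.
    rewrite T'S ?mulr0 ?subr0 //.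
    move: Sij; rewrite /S /= (negPf ij) eq_sym (negPf ij) !orbF -leqNgt; exact: ltnW.
  - move=> k ki; apply: big1 => l _; have [_ -> _ _] := hxi k.
    by rewrite (negPf ki) mul0r mulr0.
  move=> k kj; have [_ -> _ _] := hxi k.
  by rewrite (negPf kj) !mulr0.
suff : (\dim (Zspace L D) <=
       \dim (0 : {vspace 'M[K]_(\dim {:V})}) + #|{: I}|)%N by rewrite dimv0.
apply: (dim_le_coords fl) => W WZ f0.
have /ZspaceP [Wc W0] := WZ; have Wb := bform_bilin W.
rewrite memv0; apply/eqP/bform_inj => x y.
have c0 i j : bform W (c i) (c j) = 0.
  have low k l : S (k, l) -> bform W (c k) (c l) = 0 by move=> kl; exact: (f0 (exist _ (k, l) kl)).
  have [ij|ji|/val_inj ->] := ltngtP i j; last 1 first.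
  - case pj : (par j); first by apply: low; rewrite /S /= eqxx pj orbT.
    by apply/eqP; rewrite -eqNr {2}(Wc.1 _ _ _ _ (hc j) (hc j)) pj mul1r.
  - by rewrite (Wc.1 _ _ _ _ (hc i) (hc j)) low ?mulr0 ?oppr0 // /S /= ij.
  by apply: low; rewrite /S /= ji.
have cr z i : bform W z (c i) = 0.
  rewrite -(subrK (\sum_j xi j z *: c j) z) (bilinDl Wb) W0 // add0r (bilin_suml Wb).
  by apply: big1 => j _; rewrite (bilinZl Wb) c0 mulr0.
rewrite -(subrK (\sum_j xi j y *: c j) y) (bilinDr Wb) (Zspace_radr VpP _ Dg WZ) // add0r.
by rewrite (bilin_sumr Wb); apply: big1 => j _; rewrite (bilinZr Wb) cr mulr0.
Qed.

End DimForms.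

(** * The numerical criterion and the climb through ideals *)

Section Bounds.
Variables (K : numFieldType) (V : vectType K) (L : lieSuper V).
Variable Vp : bool -> {vspace V}.
Hypothesis VpP : forall b x, homog L b x <-> x \in Vp b.
Local Notation D := (derived L).
Local Notation D2 := (brspan L (derived L)).
Local Notation v := (\dim {:V} - \dim D)%N.
Local Notation Z U := (Zspace L U).

Lemma bin2_rat k : ('C(k, 2)%:R * 2 = k%:R * (k%:R - 1) :> rat).
Proof.
case: k => [|k]; first by rewrite !mul0r.
rewrite -natrM -[2%N]/(2`!) bin_ffact ffactnS ffactn1 /= natrM.
by rewrite -addn1 natrD addrK.
Qed.

(** With N = v + d, (N - 1)(N - 2) / 2 = C(v, 2) + d v + C(d, 2) - v - d + 1, and C(v, 2) plus the
    odd dimension of L / L' is dim Z(L'). Substituting dim M = dim Z(0) - d into s = 2 gives the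
    equation, arranged so that naturals are only added. *)
Lemma s_invariantP (P : free_presentation L) :
  s_invariant P 2 <->
  (\dim (Z 0) + v = \dim (Z D) + \dim D * v + 'C(\dim D, 2) +
   \dim (D :&: Vp true))%N.
Proof.
have Dg := derived_graded VpP.
have ZDE := dim_Zspace_derived VpP Dg (br_derived L).
have NE := dim_parts VpP false; rewrite /= in NE.
have vd : (\dim {:V} = v + \dim D)%N by rewrite subnK // dimvS // subvf.
have nE : (\dim (Vp true) = \dim (Vp true) - \dim (D :&: Vp true) +
  \dim (D :&: Vp true))%N by rewrite subnK // dimvS // capvSr.
set n1 := (\dim (Vp true) - \dim (D :&: Vp true))%N in nE ZDE.
move: (bin2_rat v) (bin2_rat (\dim D)) vd; move: 'C(v, 2) ZDE 'C(\dim D, 2) => Cv ZDE Cd.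
move: v ZDE => w ZDE bv bd vd.
have natE : (\dim (Vp false))%:R = w%:R + (\dim D)%:R - (\dim (Vp true))%:R :> rat.
  by apply/eqP; rewrite eq_sym subr_eq -!natrD eqr_nat NE vd.
have nE' : (\dim (Vp true))%:R = n1%:R + (\dim (D :&: Vp true))%:R :> rat.
  by rewrite -natrD -nE.
have key d : (d + \dim D = \dim (Z 0))%N ->
  (2 = ((\dim (Vp false))%:R + (\dim (Vp true))%:R - 2) *
    ((\dim (Vp false))%:R + (\dim (Vp true))%:R - 1) / 2 + (\dim (Vp true))%:R +
      1 - d%:R :> rat) <->
  (\dim (Z 0) + w = \dim (Z D) + \dim D * w + Cd + \dim (D :&: Vp true))%N.
  move=> <-; rewrite natE nE' ZDE; move: bv bd.
  split=> e.
    apply/eqP; rewrite -(eqr_nat rat) !natrD natrM; apply/eqP; lra.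
  by move: e => /(congr1 (fun k => k%:R : rat)); rewrite !natrD natrM; lra.
split=> [[m [n [d [[U0 [U1 [h0 h1 <- <-]]] /(schur_dimE _ _ VpP) dE sE]]]]|e].
  have eqU b (U : {vspace V}) : homog L b = [set x | x \in U]%classic -> U = Vp b.
    by move=> h; apply/vspaceP => x; apply/idP/idP => hx;
      [apply/VpP; rewrite h | move/VpP: hx; rewrite h].
  by apply/(key d dE); rewrite -(eqU _ _ h0) -(eqU _ _ h1).
(* Needed so that the witness dim Z(0) - dim L', a truncated subtraction, is the true difference. *)
have dle : (\dim D <= \dim (Z 0))%N.
  have [lift liftE] := choice (fun i : 'I_(\dim {:V}) => fp_surj P (vbasis {:V})`_i).
  by have [d0 [_ <-]] := schur_dim_lift VpP liftE; exact: leq_addl.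
exists (\dim (Vp false)), (\dim (Vp true)), (\dim (Z 0) - \dim D)%N; split.
- exists (Vp false), (Vp true); split=> //; apply/funext => x; apply/propext; exact: VpP.
- by apply/(schur_dimE _ _ VpP); rewrite subnK.
by apply/key => //; rewrite subnK.
Qed.

(** By the cocycle identity, omega(u, [a, x]) is a signed sum of omega([u, a], x) and omega(a,
    [u, x]), and both inner brackets lie in [U']. *)
Lemma form_derived (U' U : {vspace V}) W u y : graded Vp U' -> graded Vp U ->
  (forall u x, u \in U -> br L u x \in U') -> W \in Z U' -> u \in U -> y \in D ->
  bform W u y = 0.
Proof.
move=> g' g brU WZ uU yD; have /ZspaceP [Wc W0] := WZ; have Wb := bform_bilin W.
have [Y YP] : exists Y : {vspace V}, forall y, y \in Y <-> forall u, u \in U -> bform W u y = 0.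
  apply: vspace_of_pred; first by move=> w _; exact: bilin0r.
  by move=> a x z hx hz w wU; rewrite Wb.2 hx // hz // mulr0 addr0.
suff /subvP/(_ y yD)/YP : (D <= Y)%VS by apply.
apply: brspan_sub => a x _; apply/YP => {}u {}uU.
elim/(@homog_ind _ _ L): a => [a c|ca a ha];
  first by rewrite brDl (bilinDr Wb) => -> ->; rewrite addr0.
elim/(@homog_ind _ _ L): x => [x c|cx x hx];
  first by rewrite brDr (bilinDr Wb) => -> ->; rewrite addr0.
have h b : bform W (part Vp b u) (br L a x) = 0.
  have pU := g b u uU; rewrite (Wc.2 _ _ _ _ _ _ (part_homog VpP b u) ha hx).
  by rewrite W0 ?brU // (Zspace_radr VpP _ g' WZ) ?brU // mulr0 addr0.
by rewrite -(part_add VpP false u) (bilinDl Wb) !h addr0.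
Qed.

(** Modulo Z(U), a form in Z(U') is determined by its values on a basis of U / U' against a basis of
    L / L', because its values on U x L' vanish. *)
Lemma dim_Zspace_step (U' U : {vspace V}) : graded Vp U' -> graded Vp U ->
  (U' <= U)%VS -> (forall u x, u \in U -> br L u x \in U') ->
  (\dim (Z U') <= \dim (Z U) + (\dim U - \dim U') * v)%N.
Proof.
move=> g' g UU brU; pose E := (U :\: U')%VS; pose C := (fullv :\: D)%VS.
have EU : (E + U' = U)%VS by rewrite addv_diff (addv_idPl UU).
have CD : (C + D = fullv)%VS by rewrite addv_diff (addv_idPl (subvf _)).
have dE : \dim E = (\dim U - \dim U')%N.
  by have := dimv_cap_compl U U'; rewrite (capv_idPr UU) => <-; rewrite addKn.
have dC : \dim C = v.
  by have := dimv_cap_compl fullv D; rewrite (capv_idPr (subvf _)) => <-; rewrite addKn.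
pose f (s : 'I_(\dim E) * 'I_(\dim C)) (W : 'M[K]_(\dim {:V})) :=
  bform W (vbasis E)`_s.1 (vbasis C)`_s.2.
have fl s a x y : f s (a *: x + y) = a * f s x + f s y by exact: bform_lin.
rewrite -dE -dC -[\dim E]card_ord -[\dim C]card_ord -card_prod.
apply: (dim_le_coords fl) => W WZ f0; have /ZspaceP [Wc W0] := WZ.
have Wb := bform_bilin W.
apply/ZspaceP; split=> // u x uU.
have [e eE [u' u'U ->]] : exists2 e, e \in E & exists2 u', u' \in U' & u = e + u'.
  by apply/memv_addP; rewrite EU.
have eU : e \in U by rewrite -EU (subvP (addvSl E U')).
have [c cC [y yD ->]] : exists2 c, c \in C & exists2 y, y \in D & x = c + y.
  by apply/memv_addP; rewrite CD memvf.
rewrite (bilinDl Wb) (W0 u') // addr0 (bilinDr Wb).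
rewrite (form_derived g' g brU WZ eU yD) addr0.
rewrite (coord_vbasis eE) (coord_vbasis cC) (bilin_suml Wb) big1 // => i _.
rewrite (bilin_sumr Wb) big1 // => j _.
by rewrite (bilinZl Wb) (bilinZr Wb) [bform _ _ _](f0 (i, j)) !mulr0.
Qed.

Definition lcsv k : {vspace V} := iter k (brspan L) fullv.

Lemma lcsvE k : lcs L k = [set x | x \in lcsv k]%classic.
Proof.
elim: k => [|k IH] /=.
  by apply/funext => x; apply/propext; split=> // _; exact: memvf.
by rewrite IH; apply/funext => x; apply/propext; exact: mem_brspan.
Qed.

Lemma lcsv_graded k : graded Vp (lcsv k).
Proof. by elim: k => [|k IH]; [exact: gradedf | exact: brspan_graded]. Qed.

Lemma lcsvS k : (lcsv k.+1 <= lcsv k)%VS.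
Proof. by elim: k => [|k IH]; [exact: subvf | exact: brspanS]. Qed.

Hypothesis Lnil : nilpotent L.

Lemma nilpotent_lcsv : exists k, lcsv k = 0%VS.
Proof.
have [k k0] := Lnil; exists k; apply/eqP; rewrite -subv0; apply/subvP => x xk.
have : lcs L k x by rewrite lcsvE.
by rewrite k0 memv0 => ->.
Qed.

(** If [U, L] = U, then [U] lies in every term of the lower central series, and some term is 0. *)
Lemma brspan_neq (U : {vspace V}) : U != 0%VS -> brspan L U != U.
Proof.
move=> U0; apply: contraNneq U0 => UE; have [k k0] := nilpotent_lcsv.
rewrite -subv0 -k0; elim: k {k0} => [|k IH]; first exact: subvf.
by rewrite -{1}UE; exact: brspanS.
Qed.

Let step_trans a b x y w : (y <= x)%N -> (a <= b + (x - y) * w)%N ->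
  (a + w * y <= b + w * x)%N.
Proof.
by move=> yx; rewrite mulnBl -(leq_add2r (w * y)) -addnA [(y * w)%N]mulnC subnK
  1?[(x * w)%N]mulnC // leq_mul2l yx orbT.
Qed.

(** Sum the step bound along the lower central series up to [L', L]. Any subspace between [L', L]
    and L' has its brackets in [L', L], so one more step reaches [U]. *)
Lemma dim_Zspace_chain (U : {vspace V}) : graded Vp U -> (D2 <= U)%VS -> (U <= D)%VS ->
  (\dim (Z 0) <= \dim (Z U) + v * \dim U)%N.
Proof.
move=> g U1 U2.
have chain k : (\dim (Z 0) <= \dim (Z (lcsv k.+1)) + v * \dim (lcsv k.+1))%N.
  have [l l0] := nilpotent_lcsv; have [|] := leqP l k => [lk|/ltnW kl].
    have -> : lcsv k.+1 = 0%VS.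
      apply/eqP; rewrite -subv0 -l0 -(subnKC (leqW lk)).
      by elim: (_ - _)%N => [|j IH]; rewrite ?addn0 // addnS (subv_trans (lcsvS _)).
    exact: leq_addr.
  (* Descending induction, starting at an index [l] where the series has reached 0. *)
  rewrite -(subKn kl); elim: (l - k)%N => [|j IH].
    rewrite subn0; have -> : lcsv l.+1 = 0%VS.
      by apply/eqP; rewrite -subv0 -l0 lcsvS.
    exact: leq_addr.
  have [lj|jl] := leqP l j.
    by move: IH; rewrite (eqP lj) (_ : l - j.+1 = 0)%N //; apply/eqP; exact: leqW.
  move: IH; rewrite -(subSn jl) subSS => IH.
  apply: leq_trans IH _.
  apply: step_trans; first exact/dimvS/lcsvS.
  apply: (dim_Zspace_step _ _ (lcsvS _)); try exact: lcsv_graded.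
  by move=> u x; exact: br_brspan.
(* The second term [lcsv 2] is [L', L], from which the final step goes to [U]. *)
apply: leq_trans (chain 1%N) _; apply: step_trans; first exact: dimvS.
apply: dim_Zspace_step => //; first exact: lcsv_graded.
by move=> u x uU; apply/br_brspan/(subvP U2).
Qed.

End Bounds.

(** * The top quotient of the derived algebra *)

Section TopQuotient.
Variables (K : numFieldType) (V : vectType K) (L : lieSuper V).
Variable Vp : bool -> {vspace V}.
Hypothesis VpP : forall b x, homog L b x <-> x \in Vp b.
Local Notation D := (derived L).
Local Notation D2 := (brspan L (derived L)).
Local Notation Z U := (Zspace L U).

(** Separate [z] from [L', L] and compose with the projection onto parity [b]. Since [L', L] is
    graded, the composite still kills it. *)
Lemma top_functional b z : homog L b z -> z \notin D2 ->
  exists phi : 'Hom(V, K^o), [/\ phi z = 1, forall x, x \in D2 -> phi x = 0 &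
    forall x, homog L (~~ b) x -> phi x = 0].
Proof.
move=> hz zD2; have [f [fz fD]] := functional_separation zD2.
have [|phi phiE] := @lfun_of_linear _ V K^o (fun x => f (part Vp b x)).
  by move=> a x y; rewrite !linearP.
exists phi; split=> [|x xD|x hx]; rewrite phiE.
- by rewrite (part_id VpP hz).
- by rewrite fD //; apply: brspan_graded xD => //; exact: derived_graded.
by rewrite (part_other VpP hx) linear0.
Qed.

Variables (b : bool) (z : V) (phi : 'Hom(V, K^o)).
Hypotheses (hz : homog L b z) (zD : z \in D) (phiz : phi z = 1).
Hypothesis phiD2 : forall x, x \in D2 -> phi x = 0.
Hypothesis phi_par : forall x, homog L (~~ b) x -> phi x = 0.
Let D1 := (D :&: lker phi)%VS.
Let B x y : K := phi (br L x y).

Lemma top_bilin : bilin B.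
Proof. by split=> a x y w; rewrite /B ?br_linl ?br_linr linearP. Qed.

Lemma mem_D1 x : x \in D1 = (x \in D) && (phi x == 0).
Proof. by rewrite memv_cap memv_ker. Qed.

Lemma D1_sub : (D1 <= D)%VS. Proof. exact: capvSl. Qed.

Lemma D2_D1 : (D2 <= D1)%VS.
Proof.
apply/subvP => x xD2; rewrite mem_D1 phiD2 // eqxx andbT.
apply: (subvP _ _ xD2); apply: brspan_sub => u w _; exact: br_derived.
Qed.

Lemma brD_D1 u x : u \in D -> br L u x \in D1.
Proof. by move=> uD; apply: (subvP D2_D1); exact: br_brspan. Qed.

Lemma D1_graded : graded Vp D1.
Proof.
move=> c x; rewrite !mem_D1 => /andP [xD /eqP fx].
rewrite (derived_graded VpP) //=.
have [->|cb] := eqVneq c (~~ b); first by rewrite phi_par ?eqxx //; exact: part_homog.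
have -> : c = b by move: cb; case: (c); case: (b).
move: fx; rewrite -{1}(part_add VpP b x) linearD /= [phi (part _ (~~ b) _)]phi_par.
  by move=> e; move/eqP: e; rewrite addr0.
exact: part_homog.
Qed.

Lemma D_decomp u : u \in D -> u - phi u *: z \in D1.
Proof.
move=> uD; rewrite mem_D1 memvB ?memvZ //= linearB linearZ /= phiz.
by rewrite [_ *: _]mulr1 subrr.
Qed.

Lemma dim_D1 : \dim D = (\dim D1 + 1)%N.
Proof.
pose f (i : 'I_1) (x : V) : K := phi x.
have fl i a x y : f i (a *: x + y) = a * f i x + f i y by rewrite /f linearP.
apply/eqP; rewrite eqn_leq; apply/andP; split.
  rewrite -[X in (_ + X)%N](card_ord 1); apply: (dim_le_coords fl) => x xD fx.
  by rewrite mem_D1 xD; apply/eqP; exact: (fx ord0).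
rewrite -[X in (_ + X)%N](card_ord 1); apply: (dim_ge_coords fl) => [x|c].
  by rewrite mem_D1 => /andP [? /eqP xf]; split.
exists (c ord0 *: z); first by rewrite memvZ.
by move=> i; rewrite /f linearZ /= phiz (ord1 i); exact: mulr1.
Qed.

(** If [B] vanished on homogeneous pairs it would vanish altogether, and L' would lie in the kernel
    of [phi], against phi(z) = 1. *)
Lemma top_homog_neq0 : exists b1 b2 x y,
  [/\ homog L b1 x, homog L b2 y, b = b1 (+) b2 & B x y = 1].
Proof.
apply: contrapT => h.
have h0 b1 b2 x y : homog L b1 x -> homog L b2 y -> B x y = 0.
  move=> hx hy; apply: contrapT => /eqP Bxy; apply: h.
  exists b1, b2, ((B x y)^-1 *: x), y; split=> //; first exact: homogZ.
    have [//|nb] := eqVneq b (b1 (+) b2); case/eqP: Bxy; apply: phi_par.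
    have -> : ~~ b = b1 (+) b2 by move: nb; case: (b); case: (b1 (+) b2).
    exact: br_homog.
  by rewrite (bilinZl top_bilin) mulVf.
have B0 x y : B x y = 0.
  elim/(@homog_ind _ _ L): x => [x w|b1 x hx].
    by rewrite (bilinDl top_bilin) => -> ->; rewrite addr0.
  elim/(@homog_ind _ _ L): y => [y w|b2 y hy].
    by rewrite (bilinDr top_bilin) => -> ->; rewrite addr0.
  exact: h0 hx hy.
suff : (D <= lker phi)%VS.
  by move/subvP/(_ z zD); rewrite memv_ker phiz oner_eq0.
by apply: brspan_sub => x y _; rewrite memv_ker; apply/eqP; exact: B0.
Qed.

Section TopForm.
Variable W : 'M[K]_(\dim {:V}).
Hypothesis WZ : W \in Z D1.
Let Wb : bilin (bform W) := bform_bilin W.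
Let Wc : cocycle L (bform W). Proof. by have /ZspaceP [] := WZ. Qed.
Let W0 u x : u \in D1 -> bform W u x = 0.
Proof. by have /ZspaceP [_ h] := WZ; exact: h. Qed.
Let W0r u x : u \in D1 -> bform W x u = 0.
Proof. exact/(Zspace_radr VpP _ D1_graded WZ). Qed.

Lemma top_form_r x u : u \in D -> bform W x u = phi u * bform W x z.
Proof.
move=> /D_decomp uD; rewrite -{1}[u](subrK (phi u *: z)) (bilinDr Wb).
by rewrite W0r // add0r (bilinZr Wb).
Qed.

Lemma top_form_l x u : u \in D -> bform W u x = phi u * bform W z x.
Proof.
move=> /D_decomp uD; rewrite -{1}[u](subrK (phi u *: z)) (bilinDl Wb).
by rewrite W0 // add0r (bilinZl Wb).
Qed.

(** This is theta /\ B = 0 with its Koszul signs. A form in Z(D1) sees a bracket [x, y] only through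
    B(x, y) z, so the cocycle identity on x, y, u involves values against [z] alone. *)
Lemma top_jacobi b1 b2 x y u : homog L b1 x -> homog L b2 y ->
  B x y * bform W z u =
  B y u * bform W x z - (-1) ^+ (b1 && b2) * (B x u * bform W y z).
Proof.
move=> hx hy; rewrite /B -top_form_l ?br_derived //.
by rewrite (cocycle_br Wb Wc _ hx hy) !(top_form_r _ (br_derived L _ _)).
Qed.

Lemma top_formC b1 x : homog L b1 x ->
  bform W x z = - ((-1) ^+ (b1 && b) * bform W z x).
Proof. by move=> hx; exact: Wc.1 hx hz. Qed.

Lemma top_form0 : (forall u, bform W z u = 0) -> W \in Z D.
Proof.
move=> z0; apply/ZspaceP; split=> // u x uD.
by rewrite top_form_l // z0 mulr0.
Qed.

End TopForm.

(** For a pair with B(x, y) = 1 the identity expresses theta(u) through theta(x) and theta(y), so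
    two values determine theta. *)
Lemma dim_top2 : (\dim (Z D1) <= \dim (Z D) + 2)%N.
Proof.
have [b1 [b2 [x [y [hx hy _ Bxy]]]]] := top_homog_neq0.
pose f (i : bool) (W : 'M[K]_(\dim {:V})) := bform W z (if i then x else y).
have fl i a W W' : f i (a *: W + W') = a * f i W + f i W' by exact: bform_lin.
rewrite -card_bool; apply: (dim_le_coords fl) => W WZ f0; apply: top_form0 => // u.
have := top_jacobi WZ u hx hy; rewrite Bxy mul1r => ->.
rewrite (top_formC WZ hx) (top_formC WZ hy).
by rewrite [bform W z x](f0 true) [bform W z y](f0 false) !(mulr0, oppr0, subr0).
Qed.

(** For odd [z] such a pair has an even x and an odd y. Taking u = y, where B(y, y) = 0 by parity,
    gives 2 B(x, y) theta(y) = 0, so theta(x) is the one free value. *)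
Lemma dim_top1 : b -> (\dim (Z D1) <= \dim (Z D) + 1)%N.
Proof.
move=> bt; have [b1 [b2 [x0 [y0 [hx0 hy0 bE Bxy0]]]]] := top_homog_neq0.
have [x [y [hx hy Bxy]]] : exists x y, [/\ homog L false x, homog L true y & B x y != 0].
  move: bE hx0 hy0; rewrite bt; case: b1 b2 => -[] // _ hx hy; last first.
    by exists x0, y0; rewrite Bxy0 oner_eq0.
  exists y0, x0; rewrite /B (br_evenC _ hy) linearN /= [phi _]Bxy0.
  by rewrite oppr_eq0 oner_eq0.
pose f (i : 'I_1) (W : 'M[K]_(\dim {:V})) := bform W z x.
have fl i a W W' : f i (a *: W + W') = a * f i W + f i W' by exact: bform_lin.
rewrite -[X in (_ + X)%N](card_ord 1).
apply: (dim_le_coords fl) => W WZ f0; apply: top_form0 => // u.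
have zx : bform W z x = 0 by exact: (f0 ord0).
have zy : bform W z y = 0.
  have Byy : B y y = 0.
    by rewrite /B; apply: phi_par; rewrite bt -[~~ true]/(true (+) true); apply: br_homog.
  have := top_jacobi WZ y hx hy; rewrite Byy mul0r sub0r mul1r.
  rewrite (top_formC WZ hy) bt expr1 mulN1r opprK => /eqP.
  by rewrite eq_sym eqNr mulf_eq0 (negPf Bxy) => /eqP.
apply: (mulfI Bxy); rewrite (top_jacobi WZ u hx hy) mulr0.
rewrite (top_formC WZ hx) (top_formC WZ hy).
by rewrite zx zy !(mulr0, oppr0, subr0).
Qed.

(* A cocycle witnessing the inequality gives theta; the Jacobi identity for
   (u, y, w) with theta u = 1 factors the bracket. *)
Lemma top_decomposable : ~~ b -> (\dim (Z D) < \dim (Z D1))%N ->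
  exists theta beta : V -> K,
    [/\ forall x, homog L true x -> theta x = 0,
        forall x, homog L true x -> beta x = 0 &
        forall x y, B x y = theta x * beta y - beta x * theta y].
Proof.
move=> bf dZ; have [W WZ WD] : exists2 W, W \in Z D1 & W \notin Z D.
  apply: contrapT => h; move: dZ; rewrite ltnNge dimvS //.
  by apply/subvP => W WZ; apply: contrapT => /negP WD; apply: h; exists W.
have Wb := bform_bilin W; have bF : b = false by exact: negbTE.
have zC b1 x : homog L b1 x -> bform W x z = - bform W z x.
  by move=> hx; rewrite (top_formC WZ hx) bF andbF mul1r.
have J b1 b2 x y u : homog L b1 x -> homog L b2 y ->
  B x y * bform W z u =
  - (B y u * bform W z x) + (-1) ^+ (b1 && b2) * (B x u * bform W z y).
  move=> hx hy; rewrite (top_jacobi WZ u hx hy) (zC _ _ hx) (zC _ _ hy).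
  by rewrite !mulrN opprK.
have Bmix c x y : homog L c x -> homog L (~~ c) y -> B x y = 0.
  move=> hx hy; apply: phi_par; rewrite bF.
  by have := br_homog hx hy; rewrite addbN addbb.
have Bskew b1 b2 x y : homog L b1 x -> homog L b2 y ->
    B x y = - ((-1) ^+ (b1 && b2) * B y x).
  by move=> hx hy; rewrite /B (br_skew hx hy) linearN linearZ.
(* Suppose theta(u) is nonzero for an odd u. The triple (u, u, u) gives 3 B(u, u) theta(u) = 0, then
   (u, u, y) gives B(u, y) = 0, so u lies in the radical of [B]. A pair with B(x, y) = 1 now yields
   theta(u) = 0. *)
have odd0 u : homog L true u -> bform W z u = 0.
  move=> hu; apply: contrapT => /eqP zu.
  have Buu : B u u = 0.
    have := J _ _ _ _ u hu hu; rewrite expr1 mulN1r => /eqP.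
    rewrite -subr_eq0 opprD !opprK addrA.
    rewrite -!mulr2n -mulrSr -mulr_natl mulf_eq0 pnatr_eq0 /= mulf_eq0 (negPf zu).
    by rewrite orbF => /eqP.
  have Buy y : homog L true y -> B u y = 0.
    move=> hy; have := J _ _ _ _ y hu hu; rewrite Buu mul0r expr1 mulN1r => /eqP.
    rewrite eq_sym -opprD oppr_eq0 -mulr2n -mulr_natl mulf_eq0 pnatr_eq0 /= mulf_eq0.
    by rewrite (negPf zu) orbF => /eqP.
  have Bux x c : homog L c x -> B u x = 0.
    by case: c => hx; [exact: Buy | exact: Bmix hu hx].
  have [b1 [b2 [x [y [hx hy _ Bxy]]]]] := top_homog_neq0.
  have := J _ _ _ _ u hx hy.
  rewrite (Bskew _ _ _ _ hx hu) (Bskew _ _ _ _ hy hu) (Bux _ _ hx) (Bux _ _ hy).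
  by rewrite Bxy !(mulr0, mul0r, oppr0, addr0) mul1r => /eqP; rewrite (negPf zu).
have [u hu zu] : exists2 u, homog L false u & bform W z u != 0.
  apply: contrapT => h; case/negP: WD; apply: (top_form0 WZ) => u.
  elim/(@homog_ind _ _ L): u => [x y|[] u hu];
    first by rewrite (bilinDr Wb) => -> ->; rewrite addr0.
    exact: odd0.
  by apply: contrapT => /eqP zu; apply: h; exists u.
pose t x := bform W z x / bform W z u.
exists t, (B u); split=> [x hx|x hx|x y].
- by rewrite /t odd0 // mul0r.
- exact: Bmix hu hx.
elim/(@homog_ind _ _ L): x => [x w|b1 x hx].
  rewrite /t !(bilinDl top_bilin) !(bilinDr Wb) !(bilinDr top_bilin) => -> ->.
  by rewrite /t; ring.
have := J _ _ _ _ y hu hx; rewrite expr0 mul1r => e.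
rewrite /t; apply: (mulfI zu).
have -> : bform W z u * (bform W z x / bform W z u * B u y - B u x * (bform W z y / bform W z u))
  = bform W z x * B u y - B u x * bform W z y by field.
by rewrite e; ring.
Qed.

End TopQuotient.

(** * Algebras given by tables *)

Section Isomorphisms.
Variable K : numFieldType.

(** A model comes with a basis, so the natural map runs from the model to L, while [lie_iso] asks
    for the other direction. The inverse preserves parity because the wrong component of f(x) is
    sent to 0. *)
Lemma lie_iso_of_inverse (V W : lmodType K) (L : lieSuper V) (M : lieSuper W)
    (G : W -> V) :
  (forall a x y, G (a *: x + y) = a *: G x + G y) ->
  (forall b x, homog M b x -> homog L b (G x)) ->
  (forall x y, G (br M x y) = br L (G x) (G y)) ->
  (forall x, G x = 0 -> x = 0) -> (forall y, exists x, G x = y) ->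
  lie_iso L M.
Proof.
move=> Gl Gh Gbr G0 Gs; have [f Gf] := choice Gs.
have Ginj x y : G x = G y -> x = y.
  move=> xy; apply/eqP; rewrite -subr_eq0; apply/eqP/G0.
  by rewrite addrC -scaleN1r Gl xy scaleN1r addNr.
have fG : cancel G f by move=> x; apply: Ginj; rewrite Gf.
have fl a x y : f (a *: x + y) = a *: f x + f y by apply: Ginj; rewrite Gl !Gf.
pose fL : {linear V -> W} := HB.pack f (GRing.isLinear.Build K V W _ f fl).
exists fL; split; last by exists G.
split=> [b x hx|x y]; last by apply: Ginj; rewrite Gbr /= !Gf.
have [u [w [hu hw fE]]] := homog_dec M (f x).
have GE : x = G u + G w by rewrite -[x]Gf fE -[u]scale1r Gl !scale1r.
have hGu := Gh _ _ hu; have hGw := Gh _ _ hw.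
rewrite [fL x]fE; case: b hx => hx.
  suff /G0 -> : G u = 0 by rewrite add0r.
  apply: (homog_cap hGu); rewrite -[G u](addrK (G w)) -GE; exact: homogB.
suff /G0 -> : G w = 0 by rewrite addr0.
by apply: homog_cap hGw; rewrite -[G w](addKr (G u)) -GE addrC; exact: homogB.
Qed.

Section Tables.
Variables (E O : finType) (t : E + O -> E + O -> tspace K E O).
Hypothesis t_homog : forall i j, thomog (tpar i (+) tpar j) (t i j).
Hypothesis t_skew :
  forall i j, t i j = - ((-1) ^+ (tpar i && tpar j) *: t j i).
Hypothesis t_jacobi : forall i j k,
  tbr t (tvec K i) (t j k) =
  tbr t (t i j) (tvec K k) + (-1) ^+ (tpar i && tpar j) *: tbr t (tvec K j) (t i k).
Local Notation M := (talg t_homog t_skew t_jacobi).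

Section FromFamily.
Variables (V : vectType K) (L : lieSuper V) (e : E + O -> V).
Hypothesis he : forall i, homog L (tpar i) (e i).
Hypothesis bre : forall i j, br L (e i) (e j) = \sum_k t i j k *: e k.
Let G (u : tspace K E O) : V := \sum_i u i *: e i.

Let Gl a x y : G (a *: x + y) = a *: G x + G y.
Proof.
rewrite /G scaler_sumr -big_split; apply: eq_bigr => i _ /=.
by rewrite !ffunE scalerDl scalerA.
Qed.

Let Gh b x : homog M b x -> homog L b (G x).
Proof.
move=> hx; rewrite /G; elim/big_rec: _ => [|i y _ hy]; first exact: homog0.
apply: homogD => //; have [xi|/(thomog_par hx) <-] := eqVneq (x i) 0.
  by rewrite xi scale0r; exact: homog0.
exact/homogZ/he.
Qed.

Let Gbr x y : G (br M x y) = br L (G x) (G y).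
Proof.
have G0 : G 0 = 0 by apply: big1 => i _; rewrite ffunE scale0r.
have Gsum (J : finType) (F : J -> tspace K E O) : G (\sum_j F j) = \sum_j G (F j).
  elim/big_rec2: _ => [|j u w _ <-]; first exact: G0.
  by rewrite -[F j]scale1r Gl !scale1r.
rewrite /= /tbr Gsum br_suml; apply: eq_bigr => i _.
rewrite Gsum br_sumr; apply: eq_bigr => j _.
rewrite brZl brZr scalerA bre -[_ *: t i j]addr0 Gl G0 addr0.
by [].
Qed.

(** A spanning family of the right size is a basis: surjectivity gives injectivity by dimension. *)
Lemma talg_iso : (#|E| + #|O| = \dim {:V})%N ->
  (forall x, exists u : E + O -> K, x = \sum_i u i *: e i) -> lie_iso L M.
Proof.
move=> dE es; have [F FE] := @lfun_of_linear K {ffun E + O -> K^o} V G Gl.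
have Gs y : exists x, G x = y.
  by have [u ->] := es y; exists [ffun i => u i]; apply: eq_bigr => i _; rewrite ffunE.
apply: (lie_iso_of_inverse Gl Gh Gbr) => // x Gx.
have F0 : lker F = 0%VS.
  apply/eqP; rewrite -dimv_eq0; have := limg_ker_dim F fullv.
  rewrite dimvf /dim /= muln1 card_sum dE capfv.
  have -> : limg F = fullv.
    apply/vspaceP => y; rewrite memvf; have [x' <-] := Gs y.
    by rewrite -FE memv_img ?memvf.
  lia.
by apply/eqP; have := memv_ker F x; rewrite F0 memv0 FE Gx eqxx => ->.
Qed.

Lemma dsum_abel_iso k l (a : 'I_k + 'I_l -> V) :
  (forall j, homog L (tpar j) (a j)) ->
  (forall j x, br L (a j) x = 0) -> (forall j x, br L x (a j) = 0) ->
  (#|E| + #|O| + (k + l) = \dim {:V})%N ->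
  (forall x, exists u w, x = \sum_i u i *: e i + \sum_j w j *: a j) ->
  lie_iso L (dsum M (abel K k l)).
Proof.
move=> ha al ar dE es.
pose GG (u : tspace K E O * tspace K 'I_k 'I_l) : V := G u.1 + \sum_j u.2 j *: a j.
have GGl c x y : GG (c *: x + y) = c *: GG x + GG y.
  rewrite /GG Gl scalerDr addrACA; congr (_ + _).
  rewrite scaler_sumr -big_split; apply: eq_bigr => i _ /=.
  by rewrite !ffunE scalerDl scalerA.
have [F FE] :=
  @lfun_of_linear K ({ffun E + O -> K^o} * {ffun 'I_k + 'I_l -> K^o})%type V GG GGl.
have Gs y : exists x, GG x = y.
  have [u [w ->]] := es y; exists ([ffun i => u i], [ffun i => w i]).
  by congr (_ + _); apply: eq_bigr => i _; rewrite ffunE.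
apply: (lie_iso_of_inverse GGl) => //.
- move=> b [x y] [/= hx hy]; apply: homogD; first exact: Gh.
  rewrite /=; elim/big_rec: _ => [|i w _ hw]; first exact: homog0.
  apply: homogD => //; have [yi|/(thomog_par hy) <-] := eqVneq (y i) 0.
    by rewrite yi scale0r; exact: homog0.
  exact/homogZ/ha.
- move=> [x y] [x' y']; rewrite /GG /=.
  rewrite [X in _ + X]big1 ?addr0 => [|j _]; last first.
    have -> : tbr (@abel_table K k l) y y' = 0.
      by apply: big1 => i _; apply: big1 => m _; rewrite scaler0.
    by rewrite ffunE scale0r.
  have asl (c : tspace K 'I_k 'I_l) u : br L (\sum_j c j *: a j) u = 0.
    by rewrite br_suml; apply: big1 => j _; rewrite brZl al scaler0.
  have asr (c : tspace K 'I_k 'I_l) u : br L u (\sum_j c j *: a j) = 0.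
    by rewrite br_sumr; apply: big1 => j _; rewrite brZr ar scaler0.
  by rewrite (Gbr x x') brDl !brDr !asl !asr !addr0.
move=> x Gx.
have F0 : lker F = 0%VS.
  apply/eqP; rewrite -dimv_eq0; have := limg_ker_dim F fullv.
  rewrite dimvf /dim /= /dim /= !muln1 !card_sum !card_ord dE capfv.
  have -> : limg F = fullv.
    apply/vspaceP => y; rewrite memvf; have [x' <-] := Gs y.
    by rewrite -FE memv_img ?memvf.
  lia.
by apply/eqP; have := memv_ker F x; rewrite F0 memv0 FE Gx eqxx => ->.
Qed.

End FromFamily.

(** Transports the basis of the model and its dual coordinates to L. All counts of cocycles on the
    models are made in these coordinates. *)
Lemma dsum_abel_coords (V : lmodType K) (L : lieSuper V) k l :
  lie_iso L (dsum M (abel K k l)) ->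
  exists (e : E + O -> V) (a : 'I_k + 'I_l -> V) (xi : E + O -> V -> K)
    (ze : 'I_k + 'I_l -> V -> K),
  [/\ [/\ forall i, homog L (tpar i) (e i), forall j, homog L (tpar j) (a j),
          forall i j, br L (e i) (e j) = \sum_k t i j k *: e k &
          forall j x, br L (a j) x = 0 /\ br L x (a j) = 0],
      forall x, x = \sum_i xi i x *: e i + \sum_j ze j x *: a j,
      [/\ forall i j, xi i (e j) = (i == j)%:R, forall i j, xi i (a j) = 0,
          forall i j, ze i (e j) = 0 & forall i j, ze i (a j) = (i == j)%:R],
      (forall i c x y, xi i (c *: x + y) = c * xi i x + xi i y) /\
      (forall i c x y, ze i (c *: x + y) = c * ze i x + ze i y) &
      [/\ forall i b x, homog L b x -> tpar i != b -> xi i x = 0 ,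
          forall i b x, homog L b x -> tpar i != b -> ze i x = 0,
          forall k x y, xi k (br L x y) =
            \sum_i \sum_j xi i x * xi j y * t i j k &
          forall j x y, ze j (br L x y) = 0]].
Proof.
move=> [f [[fh fbr] [G fG Gf]]].
have Gl c x y : G (c *: x + y) = c *: G x + G y.
  by apply: (can_inj fG); rewrite linearP !Gf.
have G0 : G 0 = 0 by apply: (can_inj fG); rewrite Gf linear0.
have GZ c x : G (c *: x) = c *: G x by rewrite -[_ *: x]addr0 Gl G0 addr0.
have GD x y : G (x + y) = G x + G y by rewrite -[x]scale1r Gl !scale1r.
have Gsum (J : finType) (F : J -> _) : G (\sum_j F j) = \sum_j G (F j).
  by elim/big_rec2: _ => [|j u w _ <-] //; rewrite GD.
have Gh b x : homog (dsum M (abel K k l)) b x -> homog L b (G x).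
  move=> hx; have [u [w [hu hw GE]]] := homog_dec L (G x).
  have fE : x = f u + f w by rewrite -[LHS]Gf GE linearD.
  have f0 y : f y = 0 -> y = 0 by move=> fy; rewrite -[y]fG fy G0.
  have hfu := fh _ _ hu; have hfw := fh _ _ hw.
  rewrite GE; case: b hx => hx.
    suff /f0 -> : f u = 0 by rewrite add0r.
    apply: (homog_cap hfu); rewrite -[f u](addrK (f w)) -fE; exact: homogB.
  suff /f0 -> : f w = 0 by rewrite addr0.
  by apply: homog_cap hfw; rewrite -[f w](addKr (f u)) -fE addrC; exact: homogB.
have h0 (A B : finType) b : @thomog K A B b 0 by move=> i _; rewrite ffunE.
have hv (A B : finType) (i : A + B) : thomog (tpar i) (tvec K i).
  by move=> j; rewrite ffunE; have [->|//] := eqVneq j i; rewrite eqxx.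
have ab0 y y' : tbr (@abel_table K k l) y y' = 0.
  by apply: big1 => i _; apply: big1 => m _; rewrite scaler0.
have fGv i : f (G (tvec K i, 0)) = (tvec K i, 0) by exact: Gf.
exists (fun i => G (tvec K i, 0)), (fun j => G (0, tvec K j)),
  (fun i x => (f x).1 i), (fun j x => (f x).2 j); split.
- split=> [i|j|i j|j x].
  + by apply: Gh; split; [exact: hv | exact: h0].
  + by apply: Gh; split; [exact: h0 | exact: hv].
  + apply: (can_inj fG); rewrite fbr !Gf.
    under eq_bigr => m _ do rewrite -GZ.
    rewrite -Gsum Gf /= /dsum_br /= tbr_vec ab0.
    rewrite {1}[t i j]tvec_sum; apply: injective_projections => /=.
      by rewrite [RHS](big_morph fst (id1 := 0) (op1 := +%R)).
    rewrite [RHS](big_morph snd (id1 := 0) (op1 := +%R)) // big1 // => m _.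
    by rewrite /= scaler0.
  by split; apply: (can_inj fG); rewrite fbr Gf linear0 /= /dsum_br /= ?tbr0l ?tbr0r ab0.
- move=> x; apply: (can_inj fG); rewrite linearD !linear_sum /=.
  under eq_bigr => m _ do rewrite linearZ /= Gf.
  under [X in _ + X]eq_bigr => m _ do rewrite linearZ /= Gf.
  rewrite [LHS]surjective_pairing {1}[(f x).1]tvec_sum {1}[(f x).2]tvec_sum.
  apply: injective_projections => /=.
    rewrite [RHS]/= !(big_morph fst (id1 := 0) (op1 := +%R)) //.
    by rewrite [X in _ + X]big1 ?addr0 // => m _; rewrite /= scaler0.
  rewrite [RHS]/= !(big_morph snd (id1 := 0) (op1 := +%R)) //.
  by rewrite [X in X + _]big1 ?add0r // => m _; rewrite /= scaler0.
- by split=> i j; rewrite Gf /= ffunE.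
- by split=> i c x y; rewrite linearP /= !ffunE.
split=> [i b x /fh [h _] bi|i b x /fh [_ h] bi|m x y|j x y].
- exact: h.
- exact: h.
- rewrite fbr /= /tbr sum_ffunE; apply: eq_bigr => i _.
  by rewrite sum_ffunE; apply: eq_bigr => j _; rewrite ffunE.
by rewrite fbr /= ab0 ffunE.
Qed.

End Tables.
End Isomorphisms.

Section TableCoordinates.
Variable K : numFieldType.

(** Once components of brackets are written as 2 x 2 minors of coordinates, the cocycle identity for
    an explicit form becomes a polynomial identity. *)
Lemma L5_coord (x y : 'I_5 + 'I_0 -> K) (k : 'I_5) :
  \sum_i \sum_j x i * y j * L5_table K i j (inl k) =
  (x (inl (inord 0)) * y (inl (inord 1)) - x (inl (inord 1)) * y (inl (inord 0)))
     * (k == inord 3)%:R +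
  (x (inl (inord 0)) * y (inl (inord 2)) - x (inl (inord 2)) * y (inl (inord 0)))
     * (k == inord 4)%:R.
Proof.
have o i (F : 'I_5 -> K) (h : (i < 5)%N) : F (Ordinal h) = F (inord i).
  by congr F; apply: val_inj; rewrite /= inordK.
rewrite big_sumType /= [X in _ + X]big_ord0 addr0.
under eq_bigr => i _ do rewrite big_sumType /= [X in _ + X]big_ord0 addr0.
have big5 (F : 'I_5 -> K) : \sum_i F i = F (inord 0) + F (inord 1) + F (inord 2) +
  F (inord 3) + F (inord 4).
  rewrite !big_ord_recr big_ord0 /= add0r.
  by do ![congr (_ + _)]; congr F; apply: val_inj; rewrite /= inordK.
rewrite !big5 /L5_table !inordK //= !ffunE /=.
have E (i j : 'I_5) : (inl i == inl j :> 'I_5 + 'I_0) = (i == j) by [].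
rewrite !E; ring.
Qed.

Lemma L4_coord (x y : 'I_4 + 'I_0 -> K) (k : 'I_4) :
  \sum_i \sum_j x i * y j * L4_table K i j (inl k) =
  (x (inl (inord 0)) * y (inl (inord 1)) - x (inl (inord 1)) * y (inl (inord 0)))
     * (k == inord 2)%:R +
  (x (inl (inord 1)) * y (inl (inord 2)) - x (inl (inord 2)) * y (inl (inord 1)))
     * (k == inord 3)%:R.
Proof.
rewrite big_sumType /= [X in _ + X]big_ord0 addr0.
under eq_bigr => i _ do rewrite big_sumType /= [X in _ + X]big_ord0 addr0.
have big4 (F : 'I_4 -> K) : \sum_i F i = F (inord 0) + F (inord 1) + F (inord 2) +
  F (inord 3).
  rewrite !big_ord_recr big_ord0 /= add0r.
  by do ![congr (_ + _)]; congr F; apply: val_inj; rewrite /= inordK.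
rewrite !big4 /L4_table !inordK //= !ffunE /=.
have E (i j : 'I_4) : (inl i == inl j :> 'I_4 + 'I_0) = (i == j) by [].
rewrite !E; ring.
Qed.

Lemma H_table_coord p q (i j k : ('I_p + 'I_p + unit) + 'I_q) :
  k != inl (inr tt) -> H_table K i j k = 0.
Proof.
move=> kz; move: i j => [[[i|i]|[]]|i] [[[j|j]|[]]|j] //=; rewrite /H_table;
  try case: ifP => _; by rewrite ?ffunE // (negPf kz) ?oppr0.
Qed.

Lemma Hodd_table_coord p (i j k : 'I_p + ('I_p + unit)) :
  k != inr (inr tt) -> Hodd_table K i j k = 0.
Proof.
move=> kz; move: i j => [i|[i|[]]] [j|[j|[]]] //=; rewrite /Hodd_table;
  try case: ifP => _; by rewrite ?ffunE // (negPf kz) ?oppr0.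
Qed.

Let big_unit_add (F : unit -> K) : \sum_i F i = F tt.
Proof. by rewrite (bigD1 tt) //= big1 ?addr0 // => -[]. Qed.

Lemma H10_coord (x y : ('I_1 + 'I_1 + unit) + 'I_0 -> K) :
  \sum_i \sum_j x i * y j * H_table K i j (inl (inr tt)) =
  x (inl (inl (inl ord0))) * y (inl (inl (inr ord0))) -
  x (inl (inl (inr ord0))) * y (inl (inl (inl ord0))).
Proof.
rewrite !big_sumType /= !big_ord0 !big_ord1 !big_unit_add /=.
rewrite !big_sumType /= !big_ord0 !big_ord1 !big_unit_add /=.
by rewrite !ffunE !eqxx /= !mulr1n; ring.
Qed.

Lemma Hodd1_coord (x y : 'I_1 + ('I_1 + unit) -> K) :
  \sum_i \sum_j x i * y j * Hodd_table K i j (inr (inr tt)) =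
  x (inl ord0) * y (inr (inl ord0)) - x (inr (inl ord0)) * y (inl ord0).
Proof.
rewrite !big_sumType /= !big_ord1 !big_unit_add /=.
rewrite !big_sumType /= !big_ord1 !big_unit_add /=.
by rewrite !ffunE !eqxx /= !mulr1n; ring.
Qed.

Lemma tvec_scale (E O : finType) (V : lmodType K) (e : E + O -> V) k c :
  \sum_i (c *: tvec K k) i *: e i = c *: e k.
Proof.
rewrite (bigD1 k) //= !ffunE eqxx big1 ?addr0 => [|i /negPf ik].
  by rewrite [c *: _]mulr1.
by rewrite !ffunE ik [c *: _]mulr0 scale0r.
Qed.

End TableCoordinates.

Section AdaptedBasis.
Variables (K : numFieldType) (V : vectType K) (L : lieSuper V).
Variables (E O : finType) (k l : nat) (e : E + O -> V) (a : 'I_k + 'I_l -> V).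
Variables (xi : E + O -> V -> K) (ze : 'I_k + 'I_l -> V -> K).
Hypothesis decomp : forall x, x = \sum_i xi i x *: e i + \sum_j ze j x *: a j.
Hypothesis xie : forall i j, xi i (e j) = (i == j)%:R.
Hypothesis xil : forall i c x y, xi i (c *: x + y) = c * xi i x + xi i y.
Hypothesis zel : forall i c x y, ze i (c *: x + y) = c * ze i x + ze i y.
Hypothesis zebr : forall j x y, ze j (br L x y) = 0.

Lemma adapted_ind (P : V -> Prop) : (forall c x y, P x -> P y -> P (c *: x + y)) ->
  P 0 -> (forall i, P (e i)) -> (forall j, P (a j)) -> forall x, P x.
Proof.
move=> PL P0 Pe Pa x; rewrite (decomp x).
have Ps (J : finType) (c : J -> K) (w : J -> V) : (forall j, P (w j)) ->
    P (\sum_j c j *: w j).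
  by move=> Pw; elim/big_rec: _ => // j y _; apply: PL.
by rewrite -[X in P (X + _)]scale1r; apply: PL; apply: Ps.
Qed.

Lemma adapted_bilin0 (g : V -> V -> K) u : bilin g ->
  (forall i, g u (e i) = 0) -> (forall j, g u (a j) = 0) -> forall x, g u x = 0.
Proof.
move=> gb; apply: adapted_ind; last exact: bilin0r.
by move=> c x y hx hy; rewrite gb.2 hx hy mulr0 addr0.
Qed.

(** Reads L' off a table: the marked basis vectors are independent, lie in L', and carry every
    nonzero coordinate of a bracket. *)
Lemma derived_adapted (S : {set E + O}) : (forall i, i \in S -> e i \in derived L) ->
  (forall i x y, i \notin S -> xi i (br L x y) = 0) ->
  (forall x, x \in derived L -> x = \sum_(i in S) xi i x *: e i) /\
  \dim (derived L) = #|S|.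
Proof.
move=> Se xi0.
have [Y YP] : exists Y : {vspace V}, forall x, x \in Y <->
    (forall i, i \notin S -> xi i x = 0) /\ (forall j, ze j x = 0).
  have xi00 i : xi i 0 = 0 by have := xil i (-1) 0 0; rewrite scaler0 addr0 mulN1r addNr.
  have ze00 i : ze i 0 = 0 by have := zel i (-1) 0 0; rewrite scaler0 addr0 mulN1r addNr.
  apply: vspace_of_pred => // c x y [hx zx] [hy zy]; split=> [i iS|j].
    by rewrite xil hx // hy // mulr0 addr0.
  by rewrite zel zx zy mulr0 addr0.
have DY : (derived L <= Y)%VS.
  by apply: brspan_sub => x y _; apply/YP; split=> [i iS|j]; [exact: xi0 | exact: zebr].
have DE x : x \in derived L -> x = \sum_(i in S) xi i x *: e i.
  move=> /(subvP DY)/YP [hx zx]; rewrite {1}(decomp x).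
  rewrite [X in _ + X]big1 ?addr0 => [|j _]; last by rewrite zx scale0r.
  rewrite [RHS]big_mkcond; apply: eq_bigr => i _.
  by case: ifPn => // iS; rewrite hx // scale0r.
split=> //; pose I := {i | i \in S}; have <- : #|{: I}| = #|S| by rewrite card_sig.
pose f (i : I) x := xi (val i) x.
have fl i c x y : f i (c *: x + y) = c * f i x + f i y by exact: xil.
apply/eqP; rewrite eqn_leq; apply/andP; split.
  suff : (\dim (derived L) <= \dim (0 : {vspace V}) + #|{: I}|)%N by rewrite dimv0.
  apply: (dim_le_coords fl) => x /DE xE f0; rewrite memv0 xE big1 // => i iS.
  by rewrite [xi i x](f0 (exist _ i iS)) scale0r.
suff : (\dim (0 : {vspace V}) + #|{: I}| <= \dim (derived L))%N by rewrite dimv0.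
apply: (dim_ge_coords fl) => [x|c].
  rewrite memv0 => /eqP ->; split; first exact: mem0v.
  by move=> i; have := fl i (-1) 0 0; rewrite scaler0 addr0 mulN1r addNr.
exists (\sum_i c i *: e (val i)).
  by apply: memv_suml => i _; rewrite memvZ // Se //; exact: (valP i).
have fsum (j : I) : forall (J : finType) (d : J -> K) (w : J -> V),
    f j (\sum_i d i *: w i) = \sum_i d i * f j (w i).
  move=> J d w; elim/big_rec2: _ => [|i y x _ <-]; last exact: fl.
  by have := fl j (-1) 0 0; rewrite scaler0 addr0 mulN1r addNr.
move=> j; rewrite fsum (bigD1 j) //= /f xie eqxx mulr1 big1 ?addr0 // => i ij.
by rewrite xie (inj_eq val_inj) eq_sym (negPf ij) mulr0.
Qed.

Hypothesis xia : forall i j, xi i (a j) = 0.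
Hypothesis zee : forall i j, ze i (e j) = 0.
Hypothesis zea : forall i j, ze i (a j) = (i == j)%:R.

Lemma dim_adapted : \dim {:V} = (#|E| + #|O| + (k + l))%N.
Proof.
pose I := ((E + O) + ('I_k + 'I_l))%type.
have <- : #|{: I}| = (#|E| + #|O| + (k + l))%N by rewrite !card_sum !card_ord.
pose f (i : I) x := match i with inl i => xi i x | inr j => ze j x end.
pose b (i : I) := match i with inl i => e i | inr j => a j end.
have fl i c x y : f i (c *: x + y) = c * f i x + f i y by case: i => i; [exact: xil | exact: zel].
have fb i j : f i (b j) = (i == j)%:R.
  by case: i => i; case: j => j; rewrite /= ?(xie, xia, zee, zea).
have f0 i : f i 0 = 0 by have := fl i (-1) 0 0; rewrite scaler0 addr0 mulN1r addNr.
have fsum (i : I) (J : finType) (d : J -> K) (w : J -> V) :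
    f i (\sum_j d j *: w j) = \sum_j d j * f i (w j).
  by elim/big_rec2: _ => [|j y x _ <-]; [exact: f0 | exact: fl].
apply/eqP; rewrite eqn_leq; apply/andP; split.
  suff : (\dim {:V} <= \dim (0 : {vspace V}) + #|{: I}|)%N by rewrite dimv0.
  apply: (dim_le_coords fl) => x _ fx; rewrite memv0 (decomp x) !big1 ?addr0 // => i _.
    by rewrite [ze i x](fx (inr i)) scale0r.
  by rewrite [xi i x](fx (inl i)) scale0r.
suff : (\dim (0 : {vspace V}) + #|{: I}| <= \dim {:V})%N by rewrite dimv0.
apply: (dim_ge_coords fl) => [x|c].
  by rewrite memv0 => /eqP ->; split; [exact: memvf | exact: f0].
exists (\sum_i c i *: b i); first exact: memvf.
move=> i; rewrite fsum (bigD1 i) //= fb eqxx mulr1 big1 ?addr0 // => j ij.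
by rewrite fb eq_sym (negPf ij) mulr0.
Qed.

End AdaptedBasis.

Section DerivedParity.
Variables (K : numFieldType) (V : vectType K) (L : lieSuper V).
Variable Vp : bool -> {vspace V}.
Hypothesis VpP : forall b x, homog L b x <-> x \in Vp b.

Lemma dim_derived_homog b c : (forall x, x \in derived L -> homog L b x) ->
  \dim (derived L :&: Vp c) = ((b == c) * \dim (derived L))%N.
Proof.
move=> Db.
have Dc : (derived L :&: Vp b = derived L)%VS.
  by apply/capv_idPl/subvP => x /Db/VpP.
have D0 : (derived L :&: Vp (~~ b) = 0)%VS.
  by rewrite -Dc -capvA (cap_parts VpP) capv0.
have [<-|bc] := eqVneq b c; first by rewrite Dc mul1n.
have -> : c = ~~ b by case: b c bc {Db Dc D0} => -[].
by rewrite D0 dimv0.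
Qed.

(* The Koszul signs disappear when the form ignores the odd part. *)
Lemma even_cocycle (g : V -> V -> K) : bilin g ->
  (forall x y, homog L true x -> g x y = 0) -> (forall x y, g x y = - g y x) ->
  (forall x y u, g x (br L y u) = g (br L x y) u + g y (br L x u)) -> cocycle L g.
Proof.
move=> gb g0 gs gj; split=> [b c x y hx hy|b c d x y u hx hy hu].
  case: b c hx hy => -[] hx hy; rewrite /= ?expr0 ?mul1r //.
  by rewrite g0 // g0 // mulr0 oppr0.
case: b c hx hy => -[] hx hy; rewrite /= ?expr0 ?mul1r //.
have := gj x y u; rewrite !(g0 x) // !(g0 y) // !addr0 mulr0 => <-.
by rewrite addr0.
Qed.

End DerivedParity.

(** * Cocycle counts for the Heisenberg models *)

Section Values.
Variables (K : numFieldType) (V : vectType K) (L : lieSuper V).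
Variable Vp : bool -> {vspace V}.
Hypothesis VpP : forall b x, homog L b x <-> x \in Vp b.
Local Notation D := (derived L).
Local Notation Z U := (Zspace L U).

(** The cocycle identity turns omega([x, y], u) into omega(x, [y, u]) and omega(y, [x, u]). This is
    the main source of vanishing on the models. *)
Lemma form_br_comm b c x y u W : W \in Z 0 -> homog L b x -> homog L c y ->
  br L x u = 0 -> br L y u = 0 -> bform W (br L x y) u = 0.
Proof.
move=> /ZspaceP [Wc _] hx hy xu yu; have Wb := bform_bilin W.
by rewrite (cocycle_br Wb Wc _ hx hy) xu yu !(bilin0r Wb) mulr0 subr0.
Qed.

(** The cocycle identity on (y, y, y) gives omega([y, y], y) = 2 omega(y, [y, y]) = -2 omega([y, y],
    y), so three times the value is 0. *)
Lemma form_odd_square y W : W \in Z 0 -> homog L true y ->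
  bform W (br L y y) y = 0.
Proof.
move=> /ZspaceP [Wc _] hy; have Wb := bform_bilin W.
have hz : homog L false (br L y y) by exact: (br_homog hy hy).
have := cocycle_br Wb Wc y hy hy.
rewrite (cocycle_evenC Wb Wc _ hz) expr1 mulN1r opprK => /eqP.
rewrite eq_sym -subr_eq0 opprK -mulr2n -mulrSr -mulr_natl mulf_eq0 pnatr_eq0 /=.
by move=> /eqP ->; rewrite oppr0.
Qed.

Lemma Zspace_le0 U : (Z U <= Z 0)%VS.
Proof. by apply: Zspace_sub; exact: sub0v. Qed.

(** For a basis vector e, omega(z, e) vanishes once z is the bracket of a pair commuting with e, or
    once e = y with z = [y, y] for an odd y. One of the two is available for every e unless p = 1
    and q = 0, where the only pair contains e itself. *)
Lemma H_values p q k l : lie_iso L (dsum (H K p q) (abel K k l)) -> (0 < p + q)%N ->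
  [/\ \dim D = 1%N, \dim (D :&: Vp true) = 0%N &
      \dim (Z 0) = \dim (Z D) <-> ~ (p = 1%N /\ q = 0%N)].
Proof.
move=> iso pq; have [e [a [xi [ze [[he ha bre bra] dec [xie xia zee zea] [xil zel]
  [xih zeh xibr zebr]]]]]] := dsum_abel_coords iso.
set z := e (inl (inr tt)).
have brx i : br L (e (inl (inl (inl i)))) (e (inl (inl (inr i)))) = z.
  by rewrite bre /= eqxx -[X in _ = X]scale1r -(tvec_scale e _ 1) scale1r.
have brw j : br L (e (inr j)) (e (inr j)) = z.
  by rewrite bre /= eqxx -[X in _ = X]scale1r -(tvec_scale e _ 1) scale1r.
have br0 i j : H_table K i j = 0 -> br L (e i) (e j) = 0.
  by move=> tij; rewrite bre tij big1 // => m _; rewrite ffunE scale0r.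
have zD : z \in D.
  have [q0|q0] := posnP q; last by rewrite -(brw (Ordinal q0)) br_derived.
  have p0 : (0 < p)%N by lia.
  by rewrite -(brx (Ordinal p0)) br_derived.
pose S : {set ('I_p + 'I_p + unit + 'I_q)%type} := finset.set1 (inl (inr tt)).
have [DE dD] : (forall x, x \in D -> x = \sum_(i in S) xi i x *: e i) /\ \dim D = #|S|.
  apply: (derived_adapted dec xie xil zel zebr) => [i|i x y].
    by rewrite finset.in_set1 => /eqP ->.
  rewrite finset.in_set1 => iz; rewrite xibr big1 // => i' _; rewrite big1 // => j' _.
  by rewrite H_table_coord ?mulr0.
rewrite /S cards1 in dD.
have Dz x : x \in D -> x = xi (inl (inr tt)) x *: z by move=> /DE; rewrite finset.big_set1.
have hz : homog L false z by exact: (he (inl (inr tt))).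
split=> //.
  rewrite (dim_derived_homog VpP (b := false)) // => x /Dz ->; exact: homogZ.
have sub : (Z 0 <= Z D)%VS <-> \dim (Z 0) = \dim (Z D).
  split=> [h|h]; first by apply/eqP; rewrite eqn_leq !dimvS // Zspace_le0.
  by have /eqP -> : Z D == Z 0; rewrite // eqEdim Zspace_le0 h leqnn.
rewrite -sub; split=> [h [p1 q0]|npq].
  subst p q; pose x1 : 'I_1 + 'I_1 + unit + 'I_0 := inl (inl (inl ord0)).
  pose z1 : 'I_1 + 'I_1 + unit + 'I_0 := inl (inr tt).
  have xibr0 x y : xi x1 (br L x y) = 0.
    rewrite xibr big1 // => i _; rewrite big1 // => j _.
    by rewrite H_table_coord ?mulr0.
  (* The extra cocycle on H(1, 0) is the wedge of the coordinates of x_1 and z; it does not vanish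
     on L' x L. *)
  have gb : bilin (fun u w => xi x1 u * xi z1 w - xi z1 u * xi x1 w).
    by split=> c x y u; rewrite !xil; ring.
  have odd0 i x : homog L true x -> xi (inl i) x = 0 by move=> hx; apply: (xih (inl i) true).
  have [||W WZ WE] := Zspace_form (L := L) (U := 0%VS) gb.
  - apply: (even_cocycle gb) => [x y hx|x y|x y u].
    + by rewrite (odd0 _ x hx : xi x1 x = 0) (odd0 _ x hx : xi z1 x = 0) !mul0r subr0.
    + by rewrite opprB mulrC [X in _ - X]mulrC.
    + by rewrite !xibr0 !xibr !H10_coord; ring.
  - by move=> u x; rewrite memv0 => /eqP ->; exact: bilin0l gb _.
  move/(subvP h)/ZspaceP: WZ => [_ /(_ z (e x1) zD)].
  rewrite WE !xie !eqxx /= mulr0 mul1r sub0r => /eqP.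
  by rewrite oppr_eq0 oner_eq0.
apply/subvP => W WZ; have /ZspaceP [Wc _] := WZ; have Wb := bform_bilin W.
apply/ZspaceP; split=> // x u /Dz ->; rewrite (bilinZl Wb).
suff -> : bform W z u = 0 by rewrite mulr0.
apply: (adapted_bilin0 dec Wb) => {u} [i|j]; last first.
  have [q0|q0] := posnP q.
    have p0 : (0 < p)%N by lia.
    by rewrite -(brx (Ordinal p0)); apply: form_br_comm (he _) (he _) _ _ => //;
      apply: (bra _ _).2.
  by rewrite -(brw (Ordinal q0)); apply: form_br_comm (he _) (he _) _ _ => //;
      apply: (bra _ _).2.
have [q0|q0] := posnP q; last first.
  rewrite -(brw (Ordinal q0)); have [->|iq] := eqVneq i (inr (Ordinal q0)).
    by apply: form_odd_square => //; exact: (he (inr _)).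
  apply: form_br_comm (he _) (he _) _ _ => //; apply: br0;
    case: i iq => [[[?|?]|[]]|i] //= iq; by rewrite (_ : _ == _ = false) //;
    apply: contraNF iq => /eqP ->.
have p2 : (1 < p)%N by lia.
have p0 : (0 < p)%N by lia.
(* [o] is the pair to which the basis vector belongs, with an arbitrary default for the central one.
   A different pair [oo] exists as p >= 2, and its members commute with that vector. *)
pose o := if i is inl (inl (inl j)) then j else if i is inl (inl (inr j)) then j else Ordinal p0.
have [oo oi] : exists oo, oo != o.
  have [->|] := eqVneq o (Ordinal p0); first by exists (Ordinal p2).
  by exists (Ordinal p0); rewrite eq_sym.
rewrite -(brx oo); apply: form_br_comm (he _) (he _) _ _ => //; apply: br0;
  move: oi; rewrite /o; case: (i) => [[[?|?]|[]]|?] //= /negPf -> //.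
Qed.

(** The identity on (x_i, y_i, y_i) always kills omega(z, y_i). The value omega(z, x_i) is killed by
    another pair when p >= 2, and is free when p = 1. *)
Lemma Hodd_values p k l : lie_iso L (dsum (Hodd K p) (abel K k l)) -> (0 < p)%N ->
  [/\ \dim D = 1%N, \dim (D :&: Vp true) = 1%N &
      \dim (Z 0) = (\dim (Z D) + 1)%N <-> p = 1%N].
Proof.
move=> iso p0; have [e [a [xi [ze [[he ha bre bra] dec [xie xia zee zea] [xil zel]
  [xih zeh xibr zebr]]]]]] := dsum_abel_coords iso.
set z := e (inr (inr tt)).
have brx i : br L (e (inl i)) (e (inr (inl i))) = z.
  by rewrite bre /= eqxx -[X in _ = X]scale1r -(tvec_scale e _ 1) scale1r.
have br0 i j : Hodd_table K i j = 0 -> br L (e i) (e j) = 0.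
  by move=> tij; rewrite bre tij big1 // => m _; rewrite ffunE scale0r.
have zD : z \in D by rewrite -(brx (Ordinal p0)) br_derived.
pose S : {set ('I_p + ('I_p + unit))%type} := finset.set1 (inr (inr tt)).
have [DE dD] : (forall x, x \in D -> x = \sum_(i in S) xi i x *: e i) /\ \dim D = #|S|.
  apply: (derived_adapted dec xie xil zel zebr) => [i|i x y].
    by rewrite finset.in_set1 => /eqP ->.
  rewrite finset.in_set1 => iz; rewrite xibr big1 // => i' _; rewrite big1 // => j' _.
  by rewrite Hodd_table_coord ?mulr0.
rewrite /S cards1 in dD.
have Dz x : x \in D -> x = xi (inr (inr tt)) x *: z by move=> /DE; rewrite finset.big_set1.
have hz : homog L true z by exact: (he (inr (inr tt))).
split=> //.
  rewrite (dim_derived_homog VpP (b := true)) ?dD // => x /Dz ->; exact: homogZ.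
have toZD W : W \in Z 0 -> (forall i, bform W z (e (inl i)) = 0) ->
    (forall i, bform W z (e (inr (inl i))) = 0) -> W \in Z D.
  move=> WZ We Wo; have /ZspaceP [Wc _] := WZ; have Wb := bform_bilin W.
  apply/ZspaceP; split=> // x u /Dz ->; rewrite (bilinZl Wb).
  suff -> : bform W z u = 0 by rewrite mulr0.
  apply: (adapted_bilin0 dec Wb) => {u} [[i|[i|[]]]|j]; [exact: We|exact: Wo| |].
    rewrite -{1}(brx (Ordinal p0)); apply: form_br_comm (he _) (he _) _ _ => //; exact: br0.
  rewrite -(brx (Ordinal p0)); apply: form_br_comm (he _) (he _) _ _ => //;
    exact: (bra _ _).2.
have Wodd i W : W \in Z 0 -> bform W z (e (inr (inl i))) = 0.
  move=> WZ; have /ZspaceP [Wc _] := WZ; have Wb := bform_bilin W.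
  have := cocycle_br Wb Wc (e (inr (inl i))) (he (inl i)) (he (inr (inl i))).
  rewrite brx br0 // (bilin0r Wb) sub0r mul1r.
  rewrite (Wc.1 _ _ _ _ (he (inr (inl i))) hz) expr1 mulN1r opprK => /eqP.
  by rewrite eq_sym eqNr => /eqP.
split=> [dZ|p1].
  apply/eqP; rewrite eqn_leq p0 andbT leqNgt; apply/negP => p2.
  suff : (Z 0 <= Z D)%VS by move/dimvS; rewrite dZ addn1 ltnn.
  apply/subvP => W WZ; apply: toZD => // i; last exact: Wodd.
  have [oo oi] : exists oo : 'I_p, oo != i.
    have [->|] := eqVneq i (Ordinal p0); first by exists (Ordinal p2).
    by exists (Ordinal p0); rewrite eq_sym.
  rewrite -(brx oo); apply: form_br_comm (he _) (he _) _ _ => //; apply: br0 => //=.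
  by rewrite (negPf oi).
subst p; pose x1 : 'I_1 + ('I_1 + unit) := inl ord0.
pose z1 : 'I_1 + ('I_1 + unit) := inr (inr tt).
pose f (i : 'I_1) (W : 'M[K]_(\dim {:V})) := bform W z (e x1).
have fl i c W W' : f i (c *: W + W') = c * f i W + f i W' by exact: bform_lin.
apply/eqP; rewrite eqn_leq; apply/andP; split.
  rewrite -[X in (_ + X)%N](card_ord 1); apply: (dim_le_coords fl) => W WZ f0.
  by apply: toZD => // i; [rewrite (ord1 i); exact: (f0 ord0) | exact: Wodd].
rewrite -[X in (_ + X)%N](card_ord 1); apply: (dim_ge_coords fl) => [W WD|c].
  split; first exact: (subvP (Zspace_le0 D)).
  by move=> i; move/ZspaceP: WD => [_ W0]; exact: W0.
have xibr0 x y : xi x1 (br L x y) = 0.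
  rewrite xibr big1 // => i _; rewrite big1 // => j _.
  by rewrite Hodd_table_coord ?mulr0.
(* The wedge of the coordinates of z and x_1, scaled to the prescribed value. One of them is odd and
   the other even, so plain skew-symmetry is the super-skew one. *)
pose g u w := c ord0 * (xi z1 u * xi x1 w - xi x1 u * xi z1 w).
have gb : bilin g by split=> d x y u; rewrite /g !xil; ring.
have gc : cocycle L g.
  have xe x : homog L true x -> xi x1 x = 0 by move=> hx; apply: (xih _ true).
  have xo x : homog L false x -> xi z1 x = 0 by move=> hx; apply: (xih _ false).
  have y0 x : homog L false x -> xi (inr (inl ord0)) x = 0.
    by move=> hx; apply: (xih _ false).
  split=> [b b' x y hx hy|b b' b'' x y u hx hy hu].
    rewrite /g; case: b b' hx hy => -[] hx hy;
      rewrite /= ?expr0 ?expr1 ?(xe x hx) ?(xo x hx) ?(xe y hy) ?(xo y hy); ring.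
  rewrite /g !xibr0 !xibr !Hodd1_coord; case: b b' hx hy => -[] hx hy;
    rewrite /= ?expr0 ?expr1 ?(xe x hx) ?(y0 x hx) ?(xe y hy) ?(y0 y hy); ring.
have [|W WZ WE] := Zspace_form gb gc (U := 0%VS).
  by move=> u x; rewrite memv0 => /eqP ->; exact: bilin0l gb _.
exists W => // i; rewrite (ord1 i) /f WE /g !xie !eqxx /=; ring.
Qed.

Lemma even_form_alt W x : W \in Z 0 -> homog L false x -> bform W x x = 0.
Proof.
move=> /ZspaceP [Wc _] hx; apply/eqP; rewrite -eqNr.
by rewrite {2}(cocycle_evenC (bform_bilin W) Wc x hx).
Qed.

End Values.

(** * Cocycle counts for the models with dim L' = 2 *)

Section NilpotentValues.
Variables (K : numFieldType) (V : vectType K) (L : lieSuper V).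
Variable Vp : bool -> {vspace V}.
Hypothesis VpP : forall b x, homog L b x <-> x \in Vp b.
Local Notation D := (derived L).
Local Notation Z U := (Zspace L U).

(** L^1_{4,0} occurs without an abelian summand; adding A(0|0) lets it use the coordinates set up
    for direct sums. *)
Lemma talg_iso_dsum0 (E O : finType) (t : E + O -> E + O -> tspace K E O) th ts tj :
  lie_iso L (@talg K E O t th ts tj) ->
  lie_iso L (dsum (@talg K E O t th ts tj) (abel K 0 0)).
Proof.
move=> [f [[fh fbr] [G fG Gf]]].
have gl c x y : (f (c *: x + y), 0 : tspace K 'I_0 'I_0) =
    c *: (f x, 0 : tspace K 'I_0 'I_0) + (f y, 0).
  by rewrite linearP; congr (_, _); apply/ffunP => -[[]|[]].
pose g : {linear V -> (tspace K E O * tspace K 'I_0 'I_0)%type} :=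
  HB.pack (fun x => (f x, 0 : tspace K 'I_0 'I_0))
   (GRing.isLinear.Build K V _ _ (fun x => (f x, 0 : tspace K 'I_0 'I_0)) gl).
exists g; split; last first.
  exists (fun u => G u.1) => [x|[u w]] /=; first exact: fG.
  by rewrite -[LHS]/(f (G u), 0) Gf; congr (_, _); apply/ffunP => -[[]|[]].
split=> [b x hx|x y]; first by split; [exact: fh | case=> -[]].
rewrite -[LHS]/(f (br L x y), 0) fbr; congr (_, _).
by apply/ffunP => -[[]|[]].
Qed.

(** In the basis x, y, z, v the values omega(v, y), omega(z, x) and omega(z, y) are free, and the
    others on L' x L vanish; for instance omega(v, x) = omega([y, z], x) = omega(z, z) = 0. *)
Lemma L4_values : lie_iso L (L4 K) ->
  [/\ \dim D = 2%N, \dim (D :&: Vp true) = 0%N,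
      \dim (Z 0) = (\dim (Z D) + 3)%N & \dim {:V} = 4%N].
Proof.
move=> /talg_iso_dsum0 iso.
have [e [a [xi [ze [[he ha bre bra] dec [xie xia zee zea] [xil zel]
  [xih zeh xibr zebr]]]]]] := dsum_abel_coords iso.
pose o k : 'I_4 + 'I_0 := inl (inord k).
have dV := dim_adapted dec xie xil zel xia zee zea.
rewrite !card_ord in dV.
have br0 i j : L4_table K i j = 0 -> br L (e i) (e j) = 0.
  by move=> tij; rewrite bre tij big1 // => m _; rewrite ffunE scale0r.
have hev i : homog L false (e (o i)) by exact: (he (o i)).
have br01 : br L (e (o 0%N)) (e (o 1%N)) = e (o 2%N).
  by rewrite bre /L4_table /= !inordK //= -[RHS]scale1r -(tvec_scale e _ 1) scale1r.
have br12 : br L (e (o 1%N)) (e (o 2%N)) = e (o 3%N).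
  by rewrite bre /L4_table /= !inordK //= -[RHS]scale1r -(tvec_scale e _ 1) scale1r.
have br02 : br L (e (o 0%N)) (e (o 2%N)) = 0 by apply: br0; rewrite /L4_table /= !inordK.
have brr3 i : br L (e i) (e (o 3%N)) = 0.
  apply: br0; case: i => [i|[]//]; rewrite -(inord_val i).
  by case: i => -[|[|[|[|//]]]] hi; rewrite /L4_table /= !inordK.
have e2D : e (o 2%N) \in D by rewrite -br01 br_derived.
have e3D : e (o 3%N) \in D by rewrite -br12 br_derived.
have xi2 x y : xi (o 2%N) (br L x y) =
    xi (o 0%N) x * xi (o 1%N) y - xi (o 1%N) x * xi (o 0%N) y.
  by rewrite xibr L4_coord eqxx -(inj_eq val_inj) /= !inordK // mulr1 mulr0 addr0.
have xi3 x y : xi (o 3%N) (br L x y) =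
    xi (o 1%N) x * xi (o 2%N) y - xi (o 2%N) x * xi (o 1%N) y.
  by rewrite xibr L4_coord eqxx -(inj_eq val_inj) /= !inordK // mulr1 mulr0 add0r.
have xi01 i x y : (i < 2)%N -> xi (o i) (br L x y) = 0.
  move=> i2; rewrite xibr L4_coord -!(inj_eq val_inj) /= !inordK //; last exact: leq_trans i2 _.
  by case: i i2 => [|[|]] // _; rewrite !mulr0 addr0.
pose S : {set 'I_4 + 'I_0} := (finset.set1 (o 2%N) :|: finset.set1 (o 3%N))%SET.
have [DE dD] : (forall x, x \in D -> x = \sum_(i in S) xi i x *: e i) /\ \dim D = #|S|.
  apply: (derived_adapted dec xie xil zel zebr) => [i|i x y].
    by rewrite !inE => /orP [] /eqP ->.
  case: i => [i|[]//]; rewrite -(inord_val i) !inE.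
  by case: i => -[|[|[|[|//]]]] hi //=; rewrite ?eqxx ?orbT // => _; exact: xi01.
have o23 : o 2%N != o 3%N.
  by apply/eqP => -[] /(congr1 val); rewrite /= !inordK.
have {}dD : \dim D = 2%N by rewrite dD cardsU1 cards1 !inE o23.
have {}DE x : x \in D -> x = xi (o 2%N) x *: e (o 2%N) + xi (o 3%N) x *: e (o 3%N).
  by move=> /DE; rewrite big_setU1 ?inE //= finset.big_set1.
split=> //.
  rewrite (dim_derived_homog VpP (b := false)) // => x /DE ->.
  by apply: homogD; apply: homogZ; exact: hev.
pose f (i : 'I_3) (W : 'M[K]_(\dim {:V})) :=
  if val i == 0%N then bform W (e (o 3%N)) (e (o 1%N))
  else if val i == 1%N then bform W (e (o 2%N)) (e (o 0%N))
  else bform W (e (o 2%N)) (e (o 1%N)).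
have fl i c W W' : f i (c *: W + W') = c * f i W + f i W'.
  by rewrite /f; case: eqP => _; [|case: eqP => _]; exact: bform_lin.
apply/eqP; rewrite eqn_leq; apply/andP; split.
  rewrite -[3%N]card_ord; apply: (dim_le_coords fl) => W WZ f0.
  have f31 : bform W (e (o 3%N)) (e (o 1%N)) = 0 by exact: (f0 (@Ordinal 3 0 isT)).
  have f20 : bform W (e (o 2%N)) (e (o 0%N)) = 0 by exact: (f0 (@Ordinal 3 1 isT)).
  have f21 : bform W (e (o 2%N)) (e (o 1%N)) = 0 by exact: (f0 (@Ordinal 3 2 isT)).
  have /ZspaceP [Wc _] := WZ; have Wb := bform_bilin W.
  have f23 : bform W (e (o 2%N)) (e (o 3%N)) = 0.
    by rewrite -br01; apply: form_br_comm (hev _) (hev _) _ _.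
  have f22 : bform W (e (o 2%N)) (e (o 2%N)) = 0 by exact: (even_form_alt WZ (hev _)).
  have f33 : bform W (e (o 3%N)) (e (o 3%N)) = 0 by exact: (even_form_alt WZ (hev _)).
  have f32 : bform W (e (o 3%N)) (e (o 2%N)) = 0.
    by rewrite (cocycle_evenC Wb Wc _ (hev 3%N)) f23 oppr0.
  have f30 : bform W (e (o 3%N)) (e (o 0%N)) = 0.
    rewrite -br12 (cocycle_br Wb Wc _ (hev _) (hev _)) mul1r.
    rewrite (br_evenC _ (hev 2%N)) br02 (br_evenC _ (hev 1%N)) br01.
    by rewrite oppr0 (bilin0r Wb) (bilinNr Wb) f22 oppr0 subr0.
  have W23 k : (k == 2) || (k == 3)%N -> forall u, bform W (e (o k)) u = 0.
    move=> k23; apply: (adapted_bilin0 dec Wb) => [[i|[]//]|[[]//|[]//]].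
    rewrite -(inord_val i); case: i => -[|[|[|[|//]]]] hi;
      by case/orP: k23 => /eqP ->.
  apply/ZspaceP; split=> // x u /DE ->.
  by rewrite (bilinDl Wb) !(bilinZl Wb) !W23 // !mulr0 addr0.
rewrite -[3%N]card_ord; apply: (dim_ge_coords fl) => [W WD|c].
  split; first exact: (subvP (Zspace_le0 _ D)).
  move=> i; move/ZspaceP: WD => [_ W0]; rewrite /f.
  by case: eqP => _; [|case: eqP => _]; exact: W0.
pose c0 := c (@Ordinal 3 0 isT); pose c1 := c (@Ordinal 3 1 isT).
pose c2 := c (@Ordinal 3 2 isT).
pose w i j x y := xi (o i) x * xi (o j) y - xi (o j) x * xi (o i) y.
pose g x y := c0 * w 3%N 1%N x y + c1 * w 2%N 0%N x y + c2 * w 2%N 1%N x y.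
have gb : bilin g by split=> d x y u; rewrite /g /w !xil; ring.
have xio k x : homog L true x -> xi (o k) x = 0 by move=> hx; apply: (xih _ true).
have gc : cocycle L g.
  apply: (even_cocycle gb) => [x y hx|x y|x y u].
  - by rewrite /g /w !(xio _ _ hx); ring.
  - by rewrite /g /w; ring.
  by rewrite /g /w !xi3 !xi2 !(xi01 0%N) // !(xi01 1%N) //; ring.
have [|W WZ WE] := Zspace_form gb gc (U := 0%VS).
  by move=> u x; rewrite memv0 => /eqP ->; exact: bilin0l gb _.
exists W => // i.
have xiE k m : (k < 4)%N -> (m < 4)%N -> xi (o k) (e (o m)) = (k == m)%:R.
  move=> k4 m4; rewrite xie; congr (nat_of_bool _)%:R.
  by apply/eqP/eqP => [[] /(congr1 val)|->] //; rewrite /= !inordK.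
rewrite /f !WE /g /w !xiE //=; case: i => -[|[|[|//]]] hi /=.
- by rewrite (_ : c _ = c0) /c0; [ring | congr c; apply: val_inj].
- by rewrite (_ : c _ = c1) /c1; [ring | congr c; apply: val_inj].
by rewrite (_ : c _ = c2) /c2; [ring | congr c; apply: val_inj].
Qed.

(** Values of omega on L' against L' and against the abelian summand vanish. Of the six values of v
    and w against x, y, z, the identity on (x, y, z) equates omega(v, z) with omega(w, y), leaving
    five. *)
Lemma L5_values k l : lie_iso L (dsum (L5 K) (abel K k l)) ->
  [/\ \dim D = 2%N, \dim (D :&: Vp true) = 0%N,
      \dim (Z 0) = (\dim (Z D) + 5)%N & \dim {:V} = (5 + (k + l))%N].
Proof.
move=> iso.
have [e [a [xi [ze [[he ha bre bra] dec [xie xia zee zea] [xil zel]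
  [xih zeh xibr zebr]]]]]] := dsum_abel_coords iso.
pose o k : 'I_5 + 'I_0 := inl (inord k).
have dV := dim_adapted dec xie xil zel xia zee zea.
rewrite !card_ord in dV.
have br0 i j : L5_table K i j = 0 -> br L (e i) (e j) = 0.
  by move=> tij; rewrite bre tij big1 // => m _; rewrite ffunE scale0r.
have hev i : homog L false (e (o i)) by exact: (he (o i)).
have br01 : br L (e (o 0%N)) (e (o 1%N)) = e (o 3%N).
  by rewrite bre /L5_table /= !inordK //= -[RHS]scale1r -(tvec_scale e _ 1) scale1r.
have br02 : br L (e (o 0%N)) (e (o 2%N)) = e (o 4%N).
  by rewrite bre /L5_table /= !inordK //= -[RHS]scale1r -(tvec_scale e _ 1) scale1r.
have br12 : br L (e (o 1%N)) (e (o 2%N)) = 0 by apply: br0; rewrite /L5_table /= !inordK.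
have brr34 m i : (m == 3) || (m == 4)%N -> br L (e i) (e (o m)) = 0.
  move=> m34; apply: br0; case: i => [i|[]//]; rewrite -(inord_val i).
  by case: i => -[|[|[|[|[|//]]]]] hi; case/orP: m34 => /eqP ->; rewrite /L5_table /= !inordK.
have e3D : e (o 3%N) \in D by rewrite -br01 br_derived.
have e4D : e (o 4%N) \in D by rewrite -br02 br_derived.
have xi3 x y : xi (o 3%N) (br L x y) =
    xi (o 0%N) x * xi (o 1%N) y - xi (o 1%N) x * xi (o 0%N) y.
  by rewrite xibr L5_coord eqxx -(inj_eq val_inj) /= !inordK // mulr1 mulr0 addr0.
have xi4 x y : xi (o 4%N) (br L x y) =
    xi (o 0%N) x * xi (o 2%N) y - xi (o 2%N) x * xi (o 0%N) y.
  by rewrite xibr L5_coord eqxx -(inj_eq val_inj) /= !inordK // mulr1 mulr0 add0r.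
have xi012 i x y : (i < 3)%N -> xi (o i) (br L x y) = 0.
  move=> i2; rewrite xibr L5_coord -!(inj_eq val_inj) /= !inordK //; last exact: leq_trans i2 _.
  by case: i i2 => [|[|[|]]] // _; rewrite !mulr0 addr0.
pose S : {set 'I_5 + 'I_0} := (finset.set1 (o 3%N) :|: finset.set1 (o 4%N))%SET.
have [DE dD] : (forall x, x \in D -> x = \sum_(i in S) xi i x *: e i) /\ \dim D = #|S|.
  apply: (derived_adapted dec xie xil zel zebr) => [i|i x y].
    by rewrite !inE => /orP [] /eqP ->.
  case: i => [i|[]//]; rewrite -(inord_val i) !inE.
  by case: i => -[|[|[|[|[|//]]]]] hi //=; rewrite ?eqxx ?orbT // => _; exact: xi012.
have o34 : o 3%N != o 4%N.
  by apply/eqP => -[] /(congr1 val); rewrite /= !inordK.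
have {}dD : \dim D = 2%N by rewrite dD cardsU1 cards1 !inE o34.
have {}DE x : x \in D -> x = xi (o 3%N) x *: e (o 3%N) + xi (o 4%N) x *: e (o 4%N).
  by move=> /DE; rewrite big_setU1 ?inE //= finset.big_set1.
split=> //.
  rewrite (dim_derived_homog VpP (b := false)) // => x /DE ->.
  by apply: homogD; apply: homogZ; exact: hev.
(* Index pairs of the five free values. The last one, (4, 1), also stands for (3, 2), which is why
   the last term of [g] below is a sum of two wedges. *)
pose ix (i : 'I_5) : nat * nat :=
  nth (0%N, 0%N) [:: (3, 0); (3, 1); (4, 0); (4, 2); (4, 1)]%N i.
pose f (i : 'I_5) (W : 'M[K]_(\dim {:V})) := bform W (e (o (ix i).1)) (e (o (ix i).2)).
have fl i c W W' : f i (c *: W + W') = c * f i W + f i W' by exact: bform_lin.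
apply/eqP; rewrite eqn_leq; apply/andP; split.
  rewrite -[5%N]card_ord; apply: (dim_le_coords fl) => W WZ f0.
  have f30 : bform W (e (o 3%N)) (e (o 0%N)) = 0 by exact: (f0 (@Ordinal 5 0 isT)).
  have f31 : bform W (e (o 3%N)) (e (o 1%N)) = 0 by exact: (f0 (@Ordinal 5 1 isT)).
  have f40 : bform W (e (o 4%N)) (e (o 0%N)) = 0 by exact: (f0 (@Ordinal 5 2 isT)).
  have f42 : bform W (e (o 4%N)) (e (o 2%N)) = 0 by exact: (f0 (@Ordinal 5 3 isT)).
  have f41 : bform W (e (o 4%N)) (e (o 1%N)) = 0 by exact: (f0 (@Ordinal 5 4 isT)).
  have /ZspaceP [Wc _] := WZ; have Wb := bform_bilin W.
  have f32 : bform W (e (o 3%N)) (e (o 2%N)) = 0.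
    rewrite -br01 (cocycle_br Wb Wc _ (hev _) (hev _)) br12 br02 mul1r.
    by rewrite (bilin0r Wb) sub0r (cocycle_evenC Wb Wc _ (hev 1%N)) f41 !oppr0.
  have f3 m : (m == 3) || (m == 4)%N -> bform W (e (o 3%N)) (e (o m)) = 0.
    by move=> m34; rewrite -br01; apply: (form_br_comm WZ (hev _) (hev _)); exact: brr34.
  have f4 m : (m == 3) || (m == 4)%N -> bform W (e (o 4%N)) (e (o m)) = 0.
    by move=> m34; rewrite -br02; apply: (form_br_comm WZ (hev _) (hev _)); exact: brr34.
  have W34 m : (m == 3) || (m == 4)%N -> forall u, bform W (e (o m)) u = 0.
    move=> m34; apply: (adapted_bilin0 dec Wb) => [[i|[]//]|j]; last first.
      case/orP: m34 => /eqP ->; first rewrite -br01; last rewrite -br02;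
        by apply: (form_br_comm WZ (hev _) (hev _)); exact: (bra _ _).2.
    rewrite -(inord_val i); case: i => -[|[|[|[|[|//]]]]] hi;
      by case/orP: m34 => /eqP -> //=; rewrite ?f3 ?f4.
  apply/ZspaceP; split=> // x u /DE ->.
  by rewrite (bilinDl Wb) !(bilinZl Wb) !W34 // !mulr0 addr0.
rewrite -[5%N]card_ord; apply: (dim_ge_coords fl) => [W WD|c].
  split; first exact: (subvP (Zspace_le0 _ D)).
  move=> i; move/ZspaceP: WD => [_ W0]; rewrite /f.
  by case: i => -[|[|[|[|[|//]]]]] hi; exact: W0.
pose d i := c (inord i).
pose w i j x y := xi (o i) x * xi (o j) y - xi (o j) x * xi (o i) y.
pose g x y := d 0%N * w 3%N 0%N x y + d 1%N * w 3%N 1%N x y + d 2%N * w 4%N 0%N x y +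
  d 3%N * w 4%N 2%N x y + d 4%N * (w 3%N 2%N x y + w 4%N 1%N x y).
have gb : bilin g by split=> r x y u; rewrite /g /w !xil; ring.
have xio m x : homog L true x -> xi (o m) x = 0 by move=> hx; apply: (xih _ true).
have gc : cocycle L g.
  apply: (even_cocycle gb) => [x y hx|x y|x y u].
  - by rewrite /g /w !(xio _ _ hx); ring.
  - by rewrite /g /w; ring.
  by rewrite /g /w !xi3 !xi4 !(xi012 0%N) // !(xi012 1%N) // !(xi012 2%N) //; ring.
have [|W WZ WE] := Zspace_form gb gc (U := 0%VS).
  by move=> u x; rewrite memv0 => /eqP ->; exact: bilin0l gb _.
exists W => // i.
have xiE m r : (m < 5)%N -> (r < 5)%N -> xi (o m) (e (o r)) = (m == r)%:R.
  move=> m5 r5; rewrite xie; congr (nat_of_bool _)%:R.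
  by apply/eqP/eqP => [[] /(congr1 val)|->] //; rewrite /= !inordK.
rewrite -(inord_val i) -/(d i) /f WE /g /w.
by case: i => -[|[|[|[|[|//]]]]] hi; rewrite /ix /= !inordK //= !xiE //=; ring.
Qed.

End NilpotentValues.

(** * Normal forms of bilinear forms *)

Section NormalForms.
Variables (K : numFieldType) (V : vectType K) (g : V -> V -> K).
Hypothesis gb : bilin g.

Definition ord_cons (T : Type) p (x : T) (f : 'I_p -> T) (i : 'I_p.+1) : T :=
  if unlift ord0 i is Some j then f j else x.

Lemma ord_cons0 T p (x : T) (f : 'I_p -> T) : ord_cons x f ord0 = x.
Proof. by rewrite /ord_cons unlift_none. Qed.

Lemma ord_consS T p (x : T) (f : 'I_p -> T) i : ord_cons x f (lift ord0 i) = f i.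
Proof. by rewrite /ord_cons liftK. Qed.

Lemma ord_split p (P : 'I_p.+1 -> Prop) : P ord0 -> (forall i, P (lift ord0 i)) ->
  forall i, P i.
Proof. by move=> P0 PS i; case: (unliftP ord0 i) => [j|] ->. Qed.

Lemma kernel_space (C : {vspace V}) (I : finType) (f : I -> V -> K) :
  (forall i a x y, f i (a *: x + y) = a * f i x + f i y) ->
  exists C' : {vspace V}, forall u, u \in C' <-> u \in C /\ forall i, f i u = 0.
Proof.
move=> fl; apply: vspace_of_pred.
  by split=> [|i]; [exact: mem0v | have := fl i (-1) 0 0; rewrite scaler0 addr0 mulN1r addNr].
move=> a x y [xC fx] [yC fy]; split=> [|i]; first by rewrite memvD ?memvZ.
by rewrite fl fx fy mulr0 addr0.
Qed.

(** Split off a hyperbolic plane and recurse in its orthogonal; when no pair with nonzero value is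
    left, what remains is the radical [R]. Skew-symmetry is asked on [C] alone because a bracket
    form may be skew on the even part and symmetric on the odd part. *)
Lemma symplectic_basis (C : {vspace V}) :
  (forall x y, x \in C -> y \in C -> g x y = - g y x) ->
  exists p (x y : 'I_p -> V) (R : {vspace V}),
    [/\ (forall i, x i \in C) /\ (forall i, y i \in C),
        (forall i j, [/\ g (x i) (y j) = (i == j)%:R, g (x i) (x j) = 0 &
          g (y i) (y j) = 0]),
        (R <= C)%VS /\ (forall r u, r \in R -> u \in C -> g r u = 0),
        \dim C = (p + p + \dim R)%N &
        forall u, u \in C -> exists (a b : 'I_p -> K) (r : V),
          r \in R /\ u = \sum_i a i *: x i + \sum_i b i *: y i + r].
Proof.
have [n] := ubnP (\dim C); elim: n C => // n IH C; rewrite ltnS => dC gC.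
have alt u : u \in C -> g u u = 0 by move=> uC; apply/eqP; rewrite -eqNr -(gC _ _ uC uC).
have [g0|] := pselect (forall x y, x \in C -> y \in C -> g x y = 0).
  exists 0%N, (fun=> 0), (fun=> 0), C; split=> //.
  - by split=> -[].
  - by case.
  by move=> u uC; exists (fun=> 0), (fun=> 0), u; rewrite !big_ord0 !add0r.
move=> /existsNP [x0] /existsNP [y1] /not_implyP [x0C] /not_implyP [y1C /eqP g1].
have [y0 y0C g01] : exists2 y0, y0 \in C & g x0 y0 = 1.
  by exists ((g x0 y1)^-1 *: y1); rewrite ?memvZ // (bilinZr gb) mulVf.
have g10 : g y0 x0 = -1 by rewrite gC // g01.
pose f (i : bool) u := if i then g x0 u else g y0 u.
have fl i a x y : f i (a *: x + y) = a * f i x + f i y by case: i; rewrite /f gb.2.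
have [C' C'P] := kernel_space C fl.
have C'C u : u \in C' -> u \in C by move=> /C'P [].
have C'x u : u \in C' -> g x0 u = 0 by move=> /C'P [_ /(_ true)].
have C'y u : u \in C' -> g y0 u = 0 by move=> /C'P [_ /(_ false)].
have dC' : \dim C = (\dim C' + 2)%N.
  apply/eqP; rewrite eqn_leq -card_bool; apply/andP; split.
    by apply: (dim_le_coords fl) => u uC fu; apply/C'P.
  apply: (dim_ge_coords fl) => [u /C'P //|c].
  exists (c true *: y0 - c false *: x0); first by rewrite memvB ?memvZ.
  by case; rewrite /f /= (bilinBr gb) !(bilinZr gb) ?g01 ?g10 ?alt //; ring.
have [||p [x [y [R [[xC yC] gxy [RC gR] dR dec]]]]] := IH C'.
- by move: dC; rewrite dC'; lia.
- by move=> u w /C'C uC /C'C wC; exact: gC.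
exists p.+1, (ord_cons x0 x), (ord_cons y0 y), R; split.
- by split; apply: ord_split => [|i]; rewrite ?ord_cons0 ?ord_consS // C'C.
- have gx u : u \in C' -> g u x0 = 0 by move=> uC; rewrite gC ?C'x ?oppr0 // C'C.
  have gy u : u \in C' -> g u y0 = 0 by move=> uC; rewrite gC ?C'y ?oppr0 // C'C.
  apply: ord_split => [|i]; apply: ord_split => [|j];
    rewrite ?ord_cons0 ?ord_consS ?(inj_eq lift_inj) //.
  + by rewrite g01 !alt.
  + by rewrite !C'x // C'y.
  + by rewrite !gx ?gy.
- split; first by apply/subvP => u /(subvP RC)/C'C.
  move=> r u rR uC; have rC := subvP RC _ rR.
  (* The component of [u] orthogonal to the plane of x0 and y0; the sign comes from g(y0, x0) =
     -1. *)
  have uE : u - (g x0 u *: y0 - g y0 u *: x0) \in C'.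
    apply/C'P; split; first by rewrite !memvB ?memvZ.
    by case; rewrite /f /= !(bilinBr gb) !(bilinZr gb) ?g01 ?g10 ?alt //; ring.
  rewrite -[u](subrK (g x0 u *: y0 - g y0 u *: x0)) (bilinDr gb) (gR _ _ rR uE).
  have gry : g r y0 = 0 by rewrite (gC _ _ (C'C _ rC) y0C) C'y // oppr0.
  have grx : g r x0 = 0 by rewrite (gC _ _ (C'C _ rC) x0C) C'x // oppr0.
  by rewrite (bilinBr gb) !(bilinZr gb) gry grx !mulr0 subr0 addr0.
- by rewrite dC' dR; lia.
move=> u uC; have uE : u - (g x0 u *: y0 - g y0 u *: x0) \in C'.
  apply/C'P; split; first by rewrite !memvB ?memvZ.
  by case; rewrite /f /= !(bilinBr gb) !(bilinZr gb) ?g01 ?g10 ?alt //; ring.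
have [a [b [r [rR uEq]]]] := dec _ uE.
exists (ord_cons (- g y0 u) a), (ord_cons (g x0 u) b), r; split=> //.
rewrite !big_ord_recl !ord_cons0 -[LHS](subrK (g x0 u *: y0 - g y0 u *: x0)) uEq.
under [X in _ = _ + X + _ + _]eq_bigr => i _ do rewrite !ord_consS.
under [X in _ = _ + (_ + X) + _]eq_bigr => i _ do rewrite !ord_consS.
rewrite scaleNr addrC addrA; congr (_ + _).
by rewrite [RHS]addrACA [g x0 u *: y0 - _]addrC.
Qed.

(** Rank normal form of a pairing between two spaces: split off a dual pair and pass on each side to
    the annihilator of the opposite member. *)
Lemma dual_bases (C0 C1 : {vspace V}) :
  exists k (x y : 'I_k -> V) (R0 R1 : {vspace V}),
    [/\ (forall i, x i \in C0) /\ (forall i, y i \in C1),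
        (forall i j, g (x i) (y j) = (i == j)%:R),
        [/\ (R0 <= C0)%VS, (R1 <= C1)%VS,
            (forall r u, r \in R0 -> u \in C1 -> g r u = 0) &
            (forall r u, r \in R1 -> u \in C0 -> g u r = 0)],
        \dim C0 = (k + \dim R0)%N /\ \dim C1 = (k + \dim R1)%N &
        (forall u, u \in C0 -> exists (a : 'I_k -> K) (r : V),
          r \in R0 /\ u = \sum_i a i *: x i + r) /\
        (forall u, u \in C1 -> exists (a : 'I_k -> K) (r : V),
          r \in R1 /\ u = \sum_i a i *: y i + r)].
Proof.
have [n] := ubnP (\dim C0); elim: n C0 C1 => // n IH C0 C1; rewrite ltnS => dC.
have [g0|] := pselect (forall x y, x \in C0 -> y \in C1 -> g x y = 0).
  exists 0%N, (fun=> 0), (fun=> 0), C0, C1; split=> //.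
  - by split=> -[].
  - by case.
  - by split=> // r u rR uC; exact: g0.
  by split=> u uC; exists (fun=> 0), u; rewrite !big_ord0 !add0r.
move=> /existsNP [x0] /existsNP [y1] /not_implyP [x0C] /not_implyP [y1C /eqP g1].
have [y0 y0C g01] : exists2 y0, y0 \in C1 & g x0 y0 = 1.
  by exists ((g x0 y1)^-1 *: y1); rewrite ?memvZ // (bilinZr gb) mulVf.
have fl0 (i : 'I_1) a x y : g (a *: x + y) y0 = a * g x y0 + g y y0 by exact: gb.1.
have fl1 (i : 'I_1) a x y : g x0 (a *: x + y) = a * g x0 x + g x0 y by exact: gb.2.
have [C0' C0'P] := kernel_space C0 fl0; have [C1' C1'P] := kernel_space C1 fl1.
have sub0 u : u \in C0' -> u \in C0 by move=> /C0'P [].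
have sub1 u : u \in C1' -> u \in C1 by move=> /C1'P [].
have ker0 u : u \in C0' -> g u y0 = 0 by move=> /C0'P [_ /(_ ord0)].
have ker1 u : u \in C1' -> g x0 u = 0 by move=> /C1'P [_ /(_ ord0)].
have dC0' : \dim C0 = (\dim C0' + 1)%N.
  rewrite -[X in (_ + X)%N](card_ord 1); apply/eqP; rewrite eqn_leq; apply/andP; split.
    by apply: (dim_le_coords fl0) => u uC fu; apply/C0'P.
  apply: (dim_ge_coords fl0) => [u /C0'P //|c].
  exists (c ord0 *: x0); first by rewrite memvZ.
  by move=> i; rewrite (bilinZl gb) g01 mulr1 (ord1 i).
have dC1' : \dim C1 = (\dim C1' + 1)%N.
  rewrite -[X in (_ + X)%N](card_ord 1); apply/eqP; rewrite eqn_leq; apply/andP; split.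
    by apply: (dim_le_coords fl1) => u uC fu; apply/C1'P.
  apply: (dim_ge_coords fl1) => [u /C1'P //|c].
  exists (c ord0 *: y0); first by rewrite memvZ.
  by move=> i; rewrite (bilinZr gb) g01 mulr1 (ord1 i).
have proj0 u : u \in C0 -> u - g u y0 *: x0 \in C0'.
  move=> uC; apply/C0'P; split; first by rewrite memvB ?memvZ.
  by move=> _; rewrite (bilinBl gb) (bilinZl gb) g01 mulr1 subrr.
have proj1 u : u \in C1 -> u - g x0 u *: y0 \in C1'.
  move=> uC; apply/C1'P; split; first by rewrite memvB ?memvZ.
  by move=> _; rewrite (bilinBr gb) (bilinZr gb) g01 mulr1 subrr.
have [|k [x [y [R0 [R1 [[xC yC] gxy [RC0 RC1 gR0 gR1] [dR0 dR1] [dec0 dec1]]]]]]] := IH C0' C1'.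
  by move: dC; rewrite dC0'; lia.
exists k.+1, (ord_cons x0 x), (ord_cons y0 y), R0, R1; split.
- by split; apply: ord_split => [|i]; rewrite ?ord_cons0 ?ord_consS // (sub0, sub1).
- apply: ord_split => [|i]; apply: ord_split => [|j];
    rewrite ?ord_cons0 ?ord_consS ?(inj_eq lift_inj) //.
  + by rewrite ker1.
  + by rewrite ker0.
- split.
  + by apply/subvP => u /(subvP RC0)/sub0.
  + by apply/subvP => u /(subvP RC1)/sub1.
  + move=> r u rR uC; rewrite -[u](subrK (g x0 u *: y0)) (bilinDr gb).
    by rewrite (gR0 _ _ rR (proj1 _ uC)) (bilinZr gb) ker0 ?mulr0 ?addr0 // (subvP RC0).
  move=> r u rR uC; rewrite -[u](subrK (g u y0 *: x0)) (bilinDl gb).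
  by rewrite (gR1 _ _ rR (proj0 _ uC)) (bilinZl gb) ker1 ?mulr0 ?addr0 // (subvP RC1).
- by rewrite dC0' dC1' dR0 dR1; lia.
split=> u uC.
  have [a [r [rR uE]]] := dec0 _ (proj0 _ uC).
  exists (ord_cons (g u y0) a), r; split=> //.
  rewrite big_ord_recl !ord_cons0 -[LHS](subrK (g u y0 *: x0)) uE.
  under [in RHS]eq_bigr => i _ do rewrite !ord_consS.
  by rewrite addrC addrA.
have [a [r [rR uE]]] := dec1 _ (proj1 _ uC).
exists (ord_cons (g x0 u) a), r; split=> //.
rewrite big_ord_recl !ord_cons0 -[LHS](subrK (g x0 u *: y0)) uE.
under [in RHS]eq_bigr => i _ do rewrite !ord_consS.
by rewrite addrC addrA.
Qed.

End NormalForms.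

Section Orthonormal.
Variables (K : numClosedFieldType) (V : vectType K) (g : V -> V -> K).
Hypothesis gb : bilin g.

(** Gram-Schmidt. A vector with g(w, w) nonzero is normalized by a square root in the closed field;
    if every g(w, w) is 0, polarization shows that [g] vanishes on [C]. *)
Lemma orthonormal_basis (C : {vspace V}) :
  (forall x y, x \in C -> y \in C -> g x y = g y x) ->
  exists q (w : 'I_q -> V) (R : {vspace V}),
    [/\ (forall i, w i \in C), (forall i j, g (w i) (w j) = (i == j)%:R),
        (R <= C)%VS /\ (forall r u, r \in R -> u \in C -> g r u = 0),
        \dim C = (q + \dim R)%N &
        forall u, u \in C -> exists (a : 'I_q -> K) (r : V),
          r \in R /\ u = \sum_i a i *: w i + r].
Proof.
have [n] := ubnP (\dim C); elim: n C => // n IH C; rewrite ltnS => dC gC.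
have [g0|] := pselect (forall x, x \in C -> g x x = 0).
  exists 0%N, (fun=> 0), C; split=> //.
  - by case.
  - by case.
  - split=> // r u rC uC; have := g0 _ (memvD rC uC).
    rewrite (bilinDl gb) !(bilinDr gb) !g0 // add0r addr0 (gC u r) // -mulr2n => /eqP.
    by rewrite -mulr_natl mulf_eq0 pnatr_eq0 => /eqP.
  by move=> u uC; exists (fun=> 0), u; rewrite !big_ord0 !add0r.
move=> /existsNP [w1] /not_implyP [w1C /eqP g1].
have [w0 w0C g00] : exists2 w0, w0 \in C & g w0 w0 = 1.
  exists ((sqrtC (g w1 w1))^-1 *: w1); first by rewrite memvZ.
  rewrite (bilinZl gb) (bilinZr gb) mulrA -invfM -expr2 sqrtCK mulVf //.
have fl (i : 'I_1) a x y : g w0 (a *: x + y) = a * g w0 x + g w0 y by exact: gb.2.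
have [C' C'P] := kernel_space C fl.
have sub u : u \in C' -> u \in C by move=> /C'P [].
have ker u : u \in C' -> g w0 u = 0 by move=> /C'P [_ /(_ ord0)].
have dC' : \dim C = (\dim C' + 1)%N.
  rewrite -[X in (_ + X)%N](card_ord 1); apply/eqP; rewrite eqn_leq; apply/andP; split.
    by apply: (dim_le_coords fl) => u uC fu; apply/C'P.
  apply: (dim_ge_coords fl) => [u /C'P //|c].
  exists (c ord0 *: w0); first by rewrite memvZ.
  by move=> i; rewrite (bilinZr gb) g00 mulr1 (ord1 i).
have proj u : u \in C -> u - g w0 u *: w0 \in C'.
  move=> uC; apply/C'P; split; first by rewrite memvB ?memvZ.
  by move=> _; rewrite (bilinBr gb) (bilinZr gb) g00 mulr1 subrr.
have [||q [w [R [wC gw [RC gR] dR dec]]]] := IH C'.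
- by rewrite -addn1 -dC'.
- by move=> x y /sub xC /sub yC; exact: gC.
exists q.+1, (ord_cons w0 w), R; split.
- by apply: ord_split => [|i]; rewrite ?ord_cons0 ?ord_consS // sub.
- apply: ord_split => [|i]; apply: ord_split => [|j];
    rewrite ?ord_cons0 ?ord_consS ?(inj_eq lift_inj) //.
  + by rewrite ker.
  + by rewrite gC ?ker // sub.
- split; first by apply/subvP => u /(subvP RC)/sub.
  move=> r u rR uC; have rC := subvP RC _ rR.
  rewrite -[u](subrK (g w0 u *: w0)) (bilinDr gb) (gR _ _ rR (proj _ uC)) (bilinZr gb).
  by rewrite (gC _ _ (sub _ rC) w0C) (ker _ rC) mulr0 addr0.
- by rewrite dC' dR; lia.
move=> u uC; have [a [r [rR uE]]] := dec _ (proj _ uC).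
exists (ord_cons (g w0 u) a), r; split=> //.
rewrite big_ord_recl !ord_cons0 -[LHS](subrK (g w0 u *: w0)) uE.
under [in RHS]eq_bigr => i _ do rewrite !ord_consS.
by rewrite addrC addrA.
Qed.

End Orthonormal.

(** * Classification *)

Section OneDimensionalDerived.
Variables (K : numClosedFieldType) (V : vectType K) (L : lieSuper V).
Variable Vp : bool -> {vspace V}.
Hypothesis VpP : forall b x, homog L b x <-> x \in Vp b.
Local Notation D := (derived L).
Local Notation D2 := (brspan L (derived L)).

Section Central.
Variables (b : bool) (z : V) (phi : 'Hom(V, K^o)).
Hypotheses (hz : homog L b z) (zD : z \in D) (phiz : phi z = 1).
Hypothesis phiD2 : forall x, x \in D2 -> phi x = 0.
Hypothesis phi_par : forall x, homog L (~~ b) x -> phi x = 0.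
Hypothesis dD : \dim D = 1%N.
Let B x y : K := phi (br L x y).
Let Bb : bilin B := top_bilin L phi.

(** A one-dimensional L' leaves a zero hyperplane. Hence [z] is central, the bracket is B(x, y) z,
    and classifying L amounts to classifying the form [B]. *)
Let D1_0 : (D :&: lker phi = 0)%VS.
Proof.
apply/eqP; rewrite -dimv_eq0; have := dim_D1 zD phiz.
by rewrite dD addn1 => -[] <-.
Qed.

Let brE x y : br L x y = B x y *: z.
Proof.
have := D_decomp zD phiz (br_derived L x y).
by rewrite D1_0 memv0 subr_eq0 => /eqP.
Qed.

Let zl x : br L z x = 0.
Proof. by have := brD_D1 phiD2 x zD; rewrite D1_0 memv0 => /eqP. Qed.

Let zr x : br L x z = 0.
Proof.
elim/(@homog_ind _ _ L): x => [x y|c x hx]; first by rewrite brDl => -> ->; rewrite addr0.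
by rewrite (br_skew hx hz) zl scaler0 oppr0.
Qed.

Let Bz x : B z x = 0. Proof. by rewrite /B zl linear0. Qed.
Let Bzr x : B x z = 0. Proof. by rewrite /B zr linear0. Qed.

Let Bskew c c' x y : homog L c x -> homog L c' y -> B x y = - ((-1) ^+ (c && c') * B y x).
Proof. by move=> hx hy; rewrite /B (br_skew hx hy) linearN linearZ. Qed.

Let Bpar c c' x y : homog L c x -> homog L c' y -> c (+) c' != b -> B x y = 0.
Proof.
move=> hx hy cb; apply: phi_par; have -> : ~~ b = c (+) c'.
  by move: cb; case: (b); case: (c (+) c').
exact: br_homog.
Qed.

Let big_unit_add (F : unit -> V) : \sum_i F i = F tt.
Proof. by rewrite (bigD1 tt) //= big1 ?addr0 // => -[]. Qed.

Let z0 : z != 0.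
Proof. by apply/eqP => ze; move/eqP: phiz; rewrite ze linear0 eq_sym oner_eq0. Qed.

Lemma complement_line (U : {vspace V}) : z \in U -> exists C : {vspace V},
  [/\ (C <= U)%VS, \dim U = (\dim C + 1)%N &
      forall u, u \in U -> exists c s, c \in C /\ u = c + s *: z].
Proof.
move=> zU; pose C := (U :\: <[z]>)%VS.
have zUs : (<[z]> <= U)%VS by rewrite -memvE.
exists C; split; first exact: diffvSl.
  have := dimv_cap_compl U <[z]>%VS; rewrite (capv_idPr zUs) dim_vline z0 => <-.
  by rewrite addnC.
move=> u; rewrite -[U](addv_idPl zUs) -addv_diff -/C => /memv_addP [c cC [w /vlineP [s ->] ->]].
by exists c, s.
Qed.

(** For even [z] the form does not mix parities: it is skew on the even part and symmetric on the
    odd part, so each part gets its own normal form. [C] leaves [z] out of the even part, and the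
    two radicals then span the abelian summand. If p = q = 0, then B = 0 and L' = 0. *)
Lemma iso_even_derived : b = false -> exists p q k l, [/\ (0 < p + q)%N,
  lie_iso L (dsum (H K p q) (abel K k l)), \dim (Vp false) = (2 * p + 1 + k)%N &
  \dim (Vp true) = (q + l)%N].
Proof.
move=> b0; have zV : z \in Vp false by apply/VpP; rewrite -b0.
have [C [CV dC Cdec]] := complement_line zV.
have hC u : u \in C -> homog L false u by move=> /(subvP CV)/VpP.
have B01 u w : homog L false u -> homog L true w -> B u w = 0.
  by move=> hu hw; apply: (Bpar hu hw); rewrite b0.
have B10 u w : homog L true u -> homog L false w -> B u w = 0.
  by move=> hu hw; apply: (Bpar hu hw); rewrite b0.
have [|p [x [y [R0 [[xC yC] Bxy [RC BR] dR dec]]]]] := symplectic_basis Bb (C := C).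
  by move=> u w /hC hu /hC hw; rewrite (Bskew hu hw) mul1r.
have [|q [w [R1 [wV Bw [RV BR1] dR1 dec1]]]] := orthonormal_basis Bb (C := Vp true).
  by move=> u w /VpP hu /VpP hw; rewrite (Bskew hu hw) mulN1r opprK.
exists p, q, (\dim R0), (\dim R1).
have hx i := hC _ (xC i); have hy i := hC _ (yC i).
have hw i : homog L true (w i) by apply/VpP.
have hR0 r : r \in R0 -> homog L false r by move=> /(subvP RC)/hC.
have hR1 r : r \in R1 -> homog L true r by move=> /(subvP RV)/VpP.
have R0c r u : r \in R0 -> B r u = 0.
  move=> rR; rewrite -(part_add VpP false u) (bilinDr Bb) (B01 r (part Vp (~~ false) u)) ?addr0.
  - have [c [s [cC ->]]] := Cdec _ (part_mem Vp false u).
    by rewrite (bilinDr Bb) (bilinZr Bb) Bzr mulr0 addr0 BR.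
  - exact: hR0.
  exact: (part_homog VpP true u).
have R1c r u : r \in R1 -> B r u = 0.
  move=> rR; rewrite -(part_add VpP true u) (bilinDr Bb) (B10 r (part Vp (~~ true) u)) ?addr0.
  - by rewrite BR1 ?part_mem.
  - exact: hR1.
  exact: (part_homog VpP false u).
have Rc r c u : homog L c r -> (forall u, B r u = 0) -> B u r = 0.
  move=> hr rc; elim/(@homog_ind _ _ L): u => [u v|c' u hu].
    by rewrite (bilinDl Bb) => -> ->; rewrite addr0.
  by rewrite (Bskew hu hr) rc mulr0 oppr0.
pose e (i : ('I_p + 'I_p + unit) + 'I_q) := match i with
  | inl (inl (inl i)) => x i | inl (inl (inr i)) => y i | inl (inr tt) => z
  | inr j => w j end.
pose a (j : 'I_(\dim R0) + 'I_(\dim R1)) := match j with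
  | inl i => (vbasis R0)`_i | inr i => (vbasis R1)`_i end.
have aR j : match j with inl _ => a j \in R0 | inr _ => a j \in R1 end.
  by case: j => j; rewrite /a vbasis_mem // mem_nth ?size_tuple.
have he i : homog L (tpar i) (e i).
  by case: i => [[[i|i]|[]]|i]; [exact: hx | exact: hy | rewrite /= -b0 | exact: hw].
have ha j : homog L (tpar j) (a j).
  by have := aR j; case: j => j /=; [exact: hR0 | exact: hR1].
have ac j u : B (a j) u = 0 by have := aR j; case: j => j /=; [exact: R0c | exact: R1c].
have tE i j : H_table K i j = B (e i) (e j) *: tvec K (inl (inr tt)).
  case: i j => [[[i|i]|[]]|i] [[[j|j]|[]]|j] /=; rewrite ?Bz ?Bzr ?scale0r //.
  - by have [_ -> _] := Bxy i j; rewrite scale0r.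
  - have [-> _ _] := Bxy i j; by case: eqP; rewrite ?scale1r ?scale0r.
  - by rewrite B01 ?scale0r.
  - rewrite (Bskew (hy i) (hx j)) mul1r eq_sym; have [-> _ _] := Bxy j i.
    by case: eqP; rewrite ?scaleN1r // oppr0 scale0r.
  - by have [_ _ ->] := Bxy i j; rewrite scale0r.
  - by rewrite B01 ?scale0r.
  - by rewrite B10 ?scale0r.
  - by rewrite B10 ?scale0r.
  by rewrite Bw; case: eqP; rewrite ?scale1r ?scale0r.
have dimV := dim_parts VpP false; rewrite /= in dimV.
split.
- rewrite lt0n; apply/negP; rewrite addn_eq0 => /andP [/eqP p0 /eqP q0].
  have B0 u v : B u v = 0.
    rewrite -(part_add VpP false u) (bilinDl Bb) (R1c (part Vp (~~ false) u)) ?addr0.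
      have [c [s [cC ->]]] := Cdec _ (part_mem Vp false u).
      rewrite (bilinDl Bb) (bilinZl Bb) Bz mulr0 addr0; apply: R0c.
      have [a1 [a2 [r [rR ->]]]] := dec _ cC.
      by subst p; rewrite !big_ord0 !add0r.
    have [a1 [r [rR ->]]] := dec1 _ (part_mem Vp true u).
    by subst q; rewrite big_ord0 add0r.
  case/eqP: z0; apply/eqP; rewrite -memv0.
  by apply: (subvP _ z zD); apply: brspan_sub => u v _; rewrite brE B0 scale0r mem0v.
- apply: (dsum_abel_iso _ _ _ he _ ha) => [i j|j u|j u||u].
  + by rewrite tE tvec_scale brE.
  + by rewrite brE ac scale0r.
  + by rewrite brE (Rc _ _ _ (ha j)) ?scale0r.
  + by rewrite !card_sum !card_ord card_unit -dimV dC dR dR1; lia.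
  have [c [s [cC uE]]] := Cdec _ (part_mem Vp false u).
  have [a1 [a2 [r [rR cE]]]] := dec _ cC.
  have [a3 [r' [rR' vE]]] := dec1 _ (part_mem Vp true u).
  exists (fun i => match i with inl (inl (inl i)) => a1 i | inl (inl (inr i)) => a2 i
    | inl (inr tt) => s | inr j => a3 j end).
  exists (fun j => match j with inl i => coord (vbasis R0) i r
    | inr i => coord (vbasis R1) i r' end).
  rewrite !big_sumType /= -(coord_vbasis rR) -(coord_vbasis rR').
  rewrite big_unit_add /=.
  rewrite -{1}(part_add VpP false u) uE cE vE.
  rewrite -!addrA; congr (_ + (_ + _)).
  by rewrite addrCA; congr (_ + _); rewrite addrCA.
- by rewrite dC dR; lia.
by rewrite dR1.
Qed.

(** For odd [z] the form only pairs even with odd vectors, so dual bases give the pairs of H_k. Here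
    [z] is left out of the odd side, and the two radicals span the abelian summand. *)
Lemma iso_odd_derived : b = true -> exists p k l, [/\ (0 < p)%N,
  lie_iso L (dsum (Hodd K p) (abel K k l)), \dim (Vp false) = (p + k)%N &
  \dim (Vp true) = (p + 1 + l)%N].
Proof.
move=> b1; have zV : z \in Vp true by apply/VpP; rewrite -b1.
have [C [CV dC Cdec]] := complement_line zV.
have hC u : u \in C -> homog L true u by move=> /(subvP CV)/VpP.
have B00 u w : homog L false u -> homog L false w -> B u w = 0.
  by move=> hu hw; apply: (Bpar hu hw); rewrite b1.
have B11 u w : homog L true u -> homog L true w -> B u w = 0.
  by move=> hu hw; apply: (Bpar hu hw); rewrite b1.
have [p [x [y [R0 [R1 [[xV yC] Bxy [RV RC BR0 BR1] [dR0 dR1] [dec0 dec1]]]]]]] :=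
  dual_bases Bb (Vp false) C.
exists p, (\dim R0), (\dim R1).
have hx i : homog L false (x i) by apply/VpP.
have hy i := hC _ (yC i).
have hR0 r : r \in R0 -> homog L false r by move=> /(subvP RV)/VpP.
have hR1 r : r \in R1 -> homog L true r by move=> /(subvP RC)/hC.
have R0c r u : r \in R0 -> B r u = 0.
  move=> rR; rewrite -(part_add VpP true u) (bilinDr Bb) (B00 r (part Vp (~~ true) u)) ?addr0.
  - have [c [s [cC ->]]] := Cdec _ (part_mem Vp true u).
    by rewrite (bilinDr Bb) (bilinZr Bb) Bzr mulr0 addr0 BR0.
  - exact: hR0.
  exact: (part_homog VpP false u).
have R1c r u : r \in R1 -> B u r = 0.
  move=> rR; rewrite -(part_add VpP false u) (bilinDl Bb) (B11 (part Vp (~~ false) u) r) ?addr0.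
  - by rewrite BR1 ?part_mem.
  - exact: (part_homog VpP true u).
  exact: hR1.
have Rc r c u : homog L c r -> (forall u, B r u = 0) -> B u r = 0.
  move=> hr rc; elim/(@homog_ind _ _ L): u => [u v|c' u hu].
    by rewrite (bilinDl Bb) => -> ->; rewrite addr0.
  by rewrite (Bskew hu hr) rc mulr0 oppr0.
have Rc' r c u : homog L c r -> (forall u, B u r = 0) -> B r u = 0.
  move=> hr rc; elim/(@homog_ind _ _ L): u => [u v|c' u hu].
    by rewrite (bilinDr Bb) => -> ->; rewrite addr0.
  by rewrite (Bskew hr hu) rc mulr0 oppr0.
pose e (i : 'I_p + ('I_p + unit)) := match i with
  | inl i => x i | inr (inl i) => y i | inr (inr tt) => z end.
pose a (j : 'I_(\dim R0) + 'I_(\dim R1)) := match j with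
  | inl i => (vbasis R0)`_i | inr i => (vbasis R1)`_i end.
have aR j : match j with inl _ => a j \in R0 | inr _ => a j \in R1 end.
  by case: j => j; rewrite /a vbasis_mem // mem_nth ?size_tuple.
have he i : homog L (tpar i) (e i).
  by case: i => [i|[i|[]]]; [exact: hx | exact: hy | rewrite /= -b1].
have ha j : homog L (tpar j) (a j).
  by have := aR j; case: j => j /=; [exact: hR0 | exact: hR1].
have ac j u : B (a j) u = 0 /\ B u (a j) = 0.
  have := aR j; have := ha j; case: j => j /= hj aj.
    by split; [exact: R0c | apply: (Rc _ _ _ hj) => v; exact: R0c].
  by split; [apply: (Rc' _ _ _ hj) => v; exact: R1c | exact: R1c].
have tE i j : Hodd_table K i j = B (e i) (e j) *: tvec K (inr (inr tt)).
  case: i j => [i|[i|[]]] [j|[j|[]]] /=; rewrite ?Bz ?Bzr ?scale0r //.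
  - by rewrite B00 ?scale0r.
  - by rewrite Bxy; case: eqP; rewrite ?scale1r ?scale0r.
  - rewrite (Bskew (hy i) (hx j)) mul1r Bxy eq_sym.
    by case: eqP; rewrite ?scaleN1r // oppr0 scale0r.
  by rewrite B11 ?scale0r.
have dimV := dim_parts VpP false; rewrite /= in dimV.
split.
- rewrite lt0n; apply/negP => /eqP p0.
  have B0 u v : B u v = 0.
    rewrite -(part_add VpP false u) (bilinDl Bb) R0c ?add0r.
      have [c [s [cC ->]]] := Cdec _ (part_mem Vp true u).
      rewrite (bilinDl Bb) (bilinZl Bb) Bz mulr0 addr0.
      apply: (Rc' _ true); first exact: hC.
      move=> t; apply: R1c; have [a1 [r [rR ->]]] := dec1 _ cC.
      by subst p; rewrite !big_ord0 !add0r.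
    have [a1 [r [rR ->]]] := dec0 _ (part_mem Vp false u).
    by subst p; rewrite big_ord0 add0r.
  case/eqP: z0; apply/eqP; rewrite -memv0.
  by apply: (subvP _ z zD); apply: brspan_sub => u v _; rewrite brE B0 scale0r mem0v.
- apply: (dsum_abel_iso _ _ _ he _ ha) => [i j|j u|j u||u].
  + by rewrite tE tvec_scale brE.
  + by rewrite brE (ac j u).1 scale0r.
  + by rewrite brE (ac j u).2 scale0r.
  + by rewrite !card_sum !card_ord card_unit -dimV dC dR0 dR1; lia.
  have [a1 [r [rR uE]]] := dec0 _ (part_mem Vp false u).
  have [c [s [cC vE]]] := Cdec _ (part_mem Vp true u).
  have [a2 [r' [rR' cE]]] := dec1 _ cC.
  exists (fun i => match i with inl i => a1 i | inr (inl i) => a2 i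
    | inr (inr tt) => s end).
  exists (fun j => match j with inl i => coord (vbasis R0) i r
    | inr i => coord (vbasis R1) i r' end).
  rewrite !big_sumType /= -(coord_vbasis rR) -(coord_vbasis rR').
  rewrite big_unit_add /=.
  rewrite -{1}(part_add VpP false u) uE vE cE.
  by rewrite -!addrA; congr (_ + _); rewrite [LHS]addrCA; congr (_ + _); rewrite [LHS]addrA addrC.
- by rewrite dR0.
by rewrite dC dR1; lia.
Qed.

End Central.
End OneDimensionalDerived.

(** * Derived algebra of dimension two *)

Section TwoDimensionalDerived.
Variables (K : numFieldType) (V : vectType K) (L : lieSuper V).
Variable Vp : bool -> {vspace V}.
Hypothesis VpP : forall b x, homog L b x <-> x \in Vp b.
Local Notation D := (derived L).
Local Notation D2 := (brspan L (derived L)).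
Local Notation v := (\dim {:V} - \dim D)%N.
Local Notation Z U := (Zspace L U).
Hypothesis Lnil : nilpotent L.
Hypothesis dD : \dim D = 2%N.
Hypothesis dZ0 : (\dim (Z 0) = \dim (Z D) + v + 1 + \dim (D :&: Vp true))%N.

Lemma D2_proper : (\dim D2 <= 1)%N.
Proof.
have D2D : (D2 <= D)%VS by apply: brspan_sub => u x _; exact: br_derived.
have D0 : D != 0%VS by rewrite -dimv_eq0 dD.
have := brspan_neq Lnil D0; rewrite eqEdim D2D dD /=.
by rewrite -ltnNge ltnS.
Qed.

Lemma dim_Zspace_D1 b z (phi : 'Hom(V, K^o)) : homog L b z -> z \in D -> phi z = 1 ->
  (forall x, x \in D2 -> phi x = 0) -> (forall x, homog L (~~ b) x -> phi x = 0) ->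
  (\dim (Z 0) <= \dim (Z (D :&: lker phi)) + v)%N.
Proof.
move=> hz zD pz pD2 pp; have := dim_Zspace_chain VpP Lnil (D1_graded VpP pp)
  (D2_D1 pD2) (D1_sub L phi).
have := dim_D1 zD pz; rewrite dD addn1 => -[<-].
by rewrite muln1.
Qed.

(** With an odd [z] outside [L', L] the last step supplies at most 1, while the odd part of L'
    raises the demand on it to at least 2. *)
Lemma no_odd_top z : homog L true z -> z \in D -> z \in D2.
Proof.
move=> hz zD; apply: contrapT => /negP zD2.
have [phi [pz pD2 pp]] := top_functional VpP hz zD2.
have := dim_Zspace_D1 hz zD pz pD2 pp.
have := dim_top1 VpP hz zD pz pp isT.
have : (0 < \dim (D :&: Vp true))%N.
  rewrite lt0n dimv_eq0; apply: contraNneq zD2 => DV.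
  have : z \in (D :&: Vp true)%VS by rewrite memv_cap zD; apply/VpP.
  by rewrite DV memv0 => /eqP ->; exact: mem0v.
by rewrite dZ0; lia.
Qed.

(** The criterion asks the last step for at least 1, so it is strict and the form factors. Since
    [phi] is any suitable functional, in class 2 this applies to the whole pencil of forms. *)
Lemma even_top_decomposable z (phi : 'Hom(V, K^o)) : homog L false z -> z \in D ->
  phi z = 1 -> (forall x, x \in D2 -> phi x = 0) ->
  (forall x, homog L true x -> phi x = 0) ->
  (\dim (Z D) < \dim (Z (D :&: lker phi)))%N /\
  exists theta beta : V -> K,
    [/\ forall x, homog L true x -> theta x = 0,
        forall x, homog L true x -> beta x = 0 &
        forall x y, phi (br L x y) = theta x * beta y - beta x * theta y].
Proof.
move=> hz zD pz pD2 pp; have := dim_Zspace_D1 hz zD pz pD2 pp; rewrite dZ0 => h.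
have lt : (\dim (Z D) < \dim (Z (D :&: lker phi)))%N by lia.
by split=> //; apply: (top_decomposable VpP hz zD pz pp isT lt).
Qed.

Lemma br_br_even x y u : homog L false x -> homog L false y ->
  br L (br L x y) u = br L x (br L y u) - br L y (br L x u).
Proof.
move=> hx hy; elim/(@homog_ind _ _ L): u => [u w|c u hu].
  by rewrite !brDr => -> ->; rewrite opprD addrACA.
by rewrite (br_jacobi hx hy hu) expr0 scale1r addrK.
Qed.

Lemma left_central_right (U : {vspace V}) : graded Vp U ->
  (forall d u, d \in U -> br L d u = 0) -> forall d u, d \in U -> br L u d = 0.
Proof.
move=> Ug Uc d u dU; rewrite -(part_add VpP false d).
elim/(@homog_ind _ _ L): u => [u w|c u hu].
  by rewrite !brDl => -> ->; rewrite addr0.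
rewrite brDr (br_skew hu (part_homog VpP false d)).
rewrite (br_skew hu (part_homog VpP (~~ false) d)).
by rewrite !Uc ?Ug // !scaler0 oppr0 addr0.
Qed.

Section TopForm.
Variable phi : 'Hom(V, K^o).
Let B x y : K := phi (br L x y).
Let Bb : bilin B := top_bilin L phi.
Variables (theta beta : V -> K).
Hypothesis BE : forall x y, B x y = theta x * beta y - beta x * theta y.

(** For a form of rank 2 the plane of x and y complements the radical, and this is the projection
    onto the radical. The identity inside is the Pluecker relation. *)
Lemma decomposable_rad x y u w : B x y = 1 ->
  B (u - B u y *: x - B x u *: y) w = 0.
Proof.
move=> Bxy; rewrite !(bilinBl Bb) !(bilinZl Bb).
have : B u w - B u y * B x w - B x u * B y w = (1 - B x y) * B u w.
  by rewrite !BE; ring.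
by rewrite Bxy subrr mul0r.
Qed.

Lemma decomposable_alt x : B x x = 0.
Proof. by rewrite BE; ring. Qed.

Lemma decomposable_skew x y : B x y = - B y x.
Proof. by rewrite !BE; ring. Qed.

(** The left side is the Pfaffian of a 4 x 4 skew matrix. Applied to the members of a pencil, its
    vanishing makes the factors shared. *)
Lemma decomposable_pfaffian x y r s :
  B x y * B r s - B x r * B y s + B x s * B y r = 0.
Proof. by rewrite !BE; ring. Qed.

End TopForm.

Lemma even_top_pair z (phi : 'Hom(V, K^o)) (theta beta : V -> K) :
  homog L false z -> z \in D -> phi z = 1 -> (forall x, homog L true x -> phi x = 0) ->
  (forall x, homog L true x -> theta x = 0) -> (forall x, homog L true x -> beta x = 0) ->
  (forall x y, phi (br L x y) = theta x * beta y - beta x * theta y) ->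
  exists x y, [/\ homog L false x, homog L false y & phi (br L x y) = 1].
Proof.
move=> hz zD pz pp t0 b0 BE.
have [b1 [b2 [x [y [hx hy b12 Bxy]]]]] := top_homog_neq0 (b := false) zD pz pp.
case: b1 b2 b12 hx hy => -[] // _ hx hy; last by exists x, y.
move: Bxy; rewrite BE !t0 // !mul0r mulr0 subr0 => /esym/eqP.
by rewrite oner_eq0.
Qed.

Lemma even_top_exists : exists z (phi : 'Hom(V, K^o)), [/\ homog L false z, z \in D,
  phi z = 1, (forall x, x \in D2 -> phi x = 0) & forall x, homog L true x -> phi x = 0].
Proof.
have [z [hz zD zD2]] : exists z, [/\ homog L false z, z \in D & z \notin D2].
  apply: contrapT => h; have : (D <= D2)%VS.
    apply/subvP => x xD; rewrite -(part_add VpP false x) memvD //; last first.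
      by apply: no_odd_top; [exact: (part_homog VpP true x) | exact: derived_graded].
    apply: contrapT => /negP xD2; apply: h; exists (part Vp false x).
    by split; [exact: part_homog | exact: derived_graded | ].
  move=> /dimvS; rewrite dD; have := D2_proper; lia.
by have [phi [pz pD2 pp]] := top_functional VpP hz zD2; exists z, phi; split.
Qed.

(** Let z = [x, y] and t = [y, z]. The radical of [B] commutes with z, so omega(t, y) determines
    omega(t, _) and the lowest step supplies 1 instead of v. With at most 2 from the last step the
    criterion gives v <= 2, which leaves no room for an abelian summand. *)
Lemma iso_L4 : D2 != 0%VS -> lie_iso L (L4 K).
Proof.
move=> D20; have [z0 [phi [hz0 z0D pz0 pD2 pp]]] := even_top_exists.
have [dlt [th [be [t0 b0 BE]]]] := even_top_decomposable hz0 z0D pz0 pD2 pp.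
pose B x y : K := phi (br L x y); have Bb : bilin B := top_bilin L phi.
have [x0 [y0 [hx0 hy0 Bxy0]]] := even_top_pair hz0 z0D pz0 pp t0 b0 BE.
set D1 := (D :&: lker phi)%VS in dlt *.
have dD1 : \dim D1 = 1%N by have := dim_D1 z0D pz0; rewrite dD addn1 => -[].
have D12 : D2 = D1.
  apply/eqP; rewrite eqEdim (D2_D1 pD2) dD1 lt0n dimv_eq0; exact: D20.
have D3 : brspan L D2 = 0%VS.
  apply/eqP; rewrite -dimv_eq0 -leqn0 -ltnS.
  have D32 : (brspan L D2 <= D2)%VS.
    by apply: brspanS; apply: brspan_sub => u w _; exact: br_derived.
  by have := brspan_neq Lnil D20; rewrite eqEdim D32 /= -ltnNge D12 dD1.
have D1c d u : d \in D1 -> br L d u = 0.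
  by rewrite -D12 => dD2; have := br_brspan L u dD2; rewrite D3 memv0 => /eqP.
have D1cr d u : d \in D1 -> br L u d = 0.
  exact: (left_central_right (D1_graded (b := false) VpP pp) D1c).
have Bsk u w : B u w = - B w u by exact: decomposable_skew BE u w.
have brD1 u w : B u w = 0 -> br L u w \in D1.
  by move=> Buw; rewrite memv_cap br_derived memv_ker; apply/eqP.
(* For u in the radical, [x, u] and [y, u] fall in the central line [L', L], so Jacobi makes [x, y]
   commute with u. *)
have zrad x y u : homog L false x -> homog L false y -> (forall w, B u w = 0) ->
    br L (br L x y) u = 0.
  move=> hx hy Bu; have Bu' w : br L w u \in D1 by apply: brD1; rewrite Bsk Bu oppr0.
  by rewrite br_br_even // (D1cr _ x (Bu' y)) (D1cr _ y (Bu' x)) subrr.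
have rad0 x y u : B x y = 1 ->
    exists2 u', (forall w, B u' w = 0) & u = B u y *: x + B x u *: y + u'.
  move=> Bxy; exists (u - B u y *: x - B x u *: y).
    by move=> w; exact: (decomposable_rad BE u w Bxy).
  by rewrite -[_ - _ - _]addrA -opprD [RHS]addrC subrK.
have line1 s : s \in D1 -> s != 0 -> forall u, u \in D1 -> exists c, u = c *: s.
  move=> sD s0 u uD1; apply/vlineP; suff -> : (<[s]> = D1)%VS by [].
  by apply/eqP; rewrite eqEdim dim_vline s0 dD1 andbT -memvE.
(* The pair is changed without changing z = [x, y], so that x commutes with z and y does not. If
   both commuted with z, then [L', L] would be 0. *)
have [x [y [hx hy Bxy xz yz]]] : exists x y, [/\ homog L false x, homog L false y,
    B x y = 1, br L x (br L x y) = 0 & br L y (br L x y) != 0].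
  set z := br L x0 y0; have zD : z \in D by exact: br_derived.
  have hz : homog L false z by exact: (br_homog hx0 hy0).
  have D2mem u : br L u z \in D1.
    have -> : br L u z = - br L z u by rewrite (br_evenC u hz) opprK.
    by rewrite memvN -D12 br_brspan.
  have [yz|yz] := eqVneq (br L y0 z) 0; last first.
    have [s xs] := line1 _ (D2mem y0) yz _ (D2mem x0).
    exists (x0 - s *: y0), y0.
    have e : br L (x0 - s *: y0) y0 = z by rewrite brBl brZl (br_even_self hy0) scaler0 subr0.
    split=> //; first exact/homogB/homogZ.
    - by rewrite /B e.
    - by rewrite e brBl brZl xs subrr.
    by rewrite e.
  have e : br L (- y0) x0 = z by rewrite brNl -(br_evenC _ hx0).
  exists (- y0), x0; rewrite e; split=> //; first exact: homogN.
  - by rewrite /B e.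
  - by rewrite brNl yz oppr0.
  apply: contraNneq D20 => xz; rewrite -subv0; apply: brspan_sub => d u dD'.
  rewrite memv0 -[d](subrK (phi d *: z)) brDl D1c ?add0r; last exact: (D_decomp zD Bxy0 dD').
  have [u' Bu' ->] := rad0 x0 y0 u Bxy0.
  rewrite brZl !brDr (zrad _ _ u' hx0 hy0 Bu') !brZr (br_evenC x0 hz) (br_evenC y0 hz).
  by rewrite xz yz !oppr0 !scaler0 !addr0 scaler0.
set z := br L x y in xz yz *; set t := br L y z in yz *.
have zD : z \in D by exact: br_derived.
have hz : homog L false z by exact: (br_homog hx hy).
have ht : homog L false t by exact: (br_homog hy hz).
have tD1 : t \in D1.
  by rewrite /t (br_evenC _ hy) memvN -D12 br_brspan.
have D1E := line1 _ tD1 yz.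
have rad u := rad0 x y u Bxy.
(* By the identity on (y, z, u), omega(t, u) vanishes for u = x and for u in the radical, where
   omega(z, t) = 0 is also used. *)
have step1 : (\dim (Z 0) <= \dim (Z D1) + 1)%N.
  pose f (i : 'I_1) (W : 'M[K]_(\dim {:V})) := bform W t y.
  have fl i a W W' : f i (a *: W + W') = a * f i W + f i W' by exact: bform_lin.
  rewrite -[X in (_ + X)%N](card_ord 1); apply: (dim_le_coords fl) => W WZ f0.
  have ty : bform W t y = 0 by exact: (f0 ord0).
  have /ZspaceP [Wc W0] := WZ; have Wb := bform_bilin W.
  have tu u : bform W t u = bform W y (br L z u) - bform W z (br L y u).
    by rewrite {1}/t (cocycle_br Wb Wc u hy hz) mul1r.
  have zt : bform W z t = 0.
    rewrite (cocycle_evenC Wb Wc _ hz).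
    rewrite (form_derived VpP _ (D1_graded (b := false) VpP pp) _ WZ tD1 zD) ?oppr0 //.
      by move=> c u; rewrite memv0 => /eqP ->; rewrite linear0 mem0v.
    by move=> d u dD1'; rewrite D1c // mem0v.
  apply/ZspaceP; split=> // d u /D1E [c ->]; rewrite (bilinZl Wb).
  have [u' Bu' ->] := rad u; rewrite !(bilinDr Wb) !(bilinZr Wb) ty mulr0 addr0.
  have -> : bform W t x = 0.
    rewrite tu (br_evenC x hz) xz oppr0 (bilin0r Wb) (br_evenC x hy) -/z (bilinNr Wb).
    by rewrite (even_form_alt WZ hz) oppr0 subr0.
  have -> : bform W t u' = 0.
    rewrite tu (zrad _ _ u' hx hy Bu') (bilin0r Wb).
    have [c' ->] := D1E _ (brD1 y u' (etrans (Bsk _ _) (etrans (congr1 -%R (Bu' y)) (oppr0 _)))).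
    by rewrite (bilinZr Wb) zt mulr0 subrr.
  by rewrite mulr0 addr0 mulr0.
have step2 := dim_top2 VpP hz0 z0D pz0 pp; rewrite -/D1 in step2.
pose f (i : bool) u := if i then B u y else B x u.
have fl i a u w : f i (a *: u + w) = a * f i u + f i w by case: i; rewrite /f (Bb.1, Bb.2).
have [R RP] := kernel_space fullv fl.
have dR : \dim {:V} = (\dim R + 2)%N.
  apply/eqP; rewrite eqn_leq -card_bool; apply/andP; split.
    by apply: (dim_le_coords fl) => u uC fu; apply/RP.
  apply: (dim_ge_coords fl) => [u /RP //|c].
  exists (c true *: x + c false *: y); first exact: memvf.
  have alt u : B u u = 0 by exact: decomposable_alt BE u.
  by case; rewrite /f ?(bilinDl Bb) ?(bilinDr Bb) ?(bilinZl Bb) ?(bilinZr Bb) !alt Bxy; ring.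
have DR : (D <= R)%VS.
  apply/subvP => d dD'; apply/RP; split; first exact: memvf.
  have Bd w : B d w = 0 by apply: pD2; exact: br_brspan.
  by case; rewrite /f ?Bd // Bsk Bd oppr0.
(* The radical [R] has codimension 2 and contains L', whose codimension v is at most 2 by the two
   step bounds. *)
have RD : R = D.
  by apply/eqP; rewrite eq_sym eqEdim DR dD; move: dZ0 dR; rewrite dD; lia.
have radD u : (forall w, B u w = 0) -> u \in D.
  by move=> Bu; rewrite -RD; apply/RP; split; [exact: memvf | case; rewrite /f ?Bu // Bsk Bu oppr0].
pose e (i : 'I_4 + 'I_0) : V := if i is inl i then nth 0 [:: x; y; z; t] i else 0.
have he i : homog L (tpar i) (e i) by case: i => [[[|[|[|[|//]]]] hi]|[]//].
have s2 c : \sum_k (c *: tvec K (inl (inord 2) : 'I_4 + 'I_0)) k *: e k = c *: z.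
  by rewrite tvec_scale /e inordK.
have s3 c : \sum_k (c *: tvec K (inl (inord 3) : 'I_4 + 'I_0)) k *: e k = c *: t.
  by rewrite tvec_scale /e inordK.
have s0 : \sum_k (0 : tspace K 'I_4 'I_0) k *: e k = 0.
  by apply: big1 => k _; rewrite ffunE scale0r.
have bre i j : br L (e i) (e j) = \sum_k L4_table K i j k *: e k.
  have xzN : br L z x = 0 by rewrite (br_evenC _ hz) xz oppr0.
  have yx : br L y x = - z by rewrite (br_evenC _ hy).
  have zy : br L z y = - t by rewrite (br_evenC _ hz).
  case: i => [[[|[|[|[|//]]]] hi]|[]//]; case: j => [[[|[|[|[|//]]]] hj]|[]//];
    rewrite /L4_table /= ?s0 ?(br_even_self hx) ?(br_even_self hy) ?(br_even_self hz)
      ?(D1c t) ?(D1cr t) //.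
  - by rewrite -[LHS]scale1r -s2 scale1r.
  - by rewrite yx -scaleN1r -s2 scaleN1r.
  - by rewrite -[LHS]scale1r -s3 scale1r.
  by rewrite zy -scaleN1r -s3 scaleN1r.
apply: (talg_iso _ _ _ he bre); first by rewrite !card_ord dR RD dD.
move=> u; have [u' Bu' uE] := rad u; have u'D := radD _ Bu'.
have phiz : phi z = 1 by exact: Bxy.
have [c cE] := D1E _ (D_decomp zD phiz u'D).
exists (fun i : 'I_4 + 'I_0 => if i is inl i then nth 0 [:: B u y; B x u; phi u'; c] i else 0).
rewrite big_sumType /= [X in _ + X]big_ord0 addr0 !big_ord_recl big_ord0 /= addr0.
by rewrite {1}uE -{1}[u'](subrK (phi u' *: z)) cE -!addrA [c *: _ + _]addrC.
Qed.

(** The bracket is B z + B' t. A pair x, y with [x, y] = z and a vector c of the radical of [B] are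
    chosen so that [x, c] spans the second line and [y, c] = 0; the remaining vectors can then be
    taken central. *)
Lemma iso_L5 : D2 = 0%VS -> exists k l, lie_iso L (dsum (L5 K) (abel K k l)).
Proof.
move=> D20; have [z0 [phi [hz0 z0D pz0 pD2 pp]]] := even_top_exists.
have Dev d : d \in D -> homog L false d.
  move=> dD'; have : part Vp true d \in D2.
    by apply: no_odd_top; [exact: part_homog | exact: derived_graded].
  rewrite D20 memv0 => /eqP d0; rewrite -(part_add VpP false d) [part _ (~~ _) _]d0 addr0.
  exact: part_homog.
have Dc d u : d \in D -> br L d u = 0.
  by move=> dD'; have := br_brspan L u dD'; rewrite D20 memv0 => /eqP.
have Dcr d u : d \in D -> br L u d = 0.
  exact: (left_central_right (derived_graded VpP) Dc).
have dec (psi : 'Hom(V, K^o)) d : d \in D -> psi d = 1 ->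
    (forall x, homog L true x -> psi x = 0) -> exists theta beta : V -> K,
    [/\ forall x, homog L true x -> theta x = 0,
        forall x, homog L true x -> beta x = 0 &
        forall x y, psi (br L x y) = theta x * beta y - beta x * theta y].
  move=> dD' pd podd; have pD2' x : x \in D2 -> psi x = 0.
    by rewrite D20 memv0 => /eqP ->; rewrite linear0.
  by have [] := even_top_decomposable (Dev _ dD') dD' pd pD2' podd.
have [th [be [t0 b0 BE]]] := dec _ _ z0D pz0 pp.
pose B x y : K := phi (br L x y); have Bb : bilin B := top_bilin L phi.
have [x0 [y0 [hx0 hy0 Bxy0]]] := even_top_pair hz0 z0D pz0 pp t0 b0 BE.
set z := br L x0 y0; have zD : z \in D by exact: br_derived.
have hz : homog L false z := Dev _ zD.
set D1 := (D :&: lker phi)%VS.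
have dD1 : \dim D1 = 1%N by have := dim_D1 z0D pz0; rewrite dD addn1 => -[].
have [t tD1 tn0] : exists2 t, t \in D1 & t != 0.
  by exists (vpick D1); rewrite ?memv_pick // vpick0 -dimv_eq0 dD1.
have D1E u : u \in D1 -> exists c, u = c *: t.
  move=> uD1; apply/vlineP; suff -> : (<[t]> = D1)%VS by [].
  by apply/eqP; rewrite eqEdim dim_vline tn0 dD1 andbT -memvE.
have [tD pt] : t \in D /\ phi t = 0 by move: tD1; rewrite memv_cap memv_ker => /andP [? /eqP].
(* The functional [psi] must kill [z] and all odd vectors, so that phi + a psi is homogeneous with
   value 1 at [z] for every a. *)
have tU : t \notin (<[z]> + Vp true)%VS.
  apply: contraNN tn0 => /memv_addP [_ /vlineP [c ->] [o oV te]].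
  have o0 : o = 0.
    apply: (@homog_cap _ _ L); last exact/VpP.
    have -> : o = t - c *: z by rewrite te addrC addKr.
    by apply: homogB; [exact: Dev | exact: homogZ].
  move: pt; rewrite te o0 addr0 linearZ /= [phi z]Bxy0 => c0.
  have {}c0 : c = 0 by rewrite -[c]mulr1; exact: c0.
  by rewrite c0 scale0r.
have [psi [psit psiU]] := functional_separation tU.
have psiz : psi z = 0 by apply: psiU; rewrite memvE addvSl.
have psiodd x : homog L true x -> psi x = 0.
  by move=> /VpP xV; apply: psiU; apply: (subvP (addvSr _ _)).
have DE d : d \in D -> d = phi d *: z + psi d *: t.
  move=> dD'; have [c cE] := D1E _ (D_decomp zD Bxy0 dD').
  have -> : psi d = c.
    rewrite -[d](subrK (phi d *: z)) cE linearD !linearZ /= psit psiz.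
    by rewrite [_ *: 0]mulr0 addr0; exact: mulr1.
  by rewrite -cE addrC subrK.
pose B' x y : K := psi (br L x y); have Bb' : bilin B' := top_bilin L psi.
have brE u w : br L u w = B u w *: z + B' u w *: t by exact/DE/br_derived.
have [th' [be' [t0' b0' BE']]] := dec _ _ tD psit psiodd.
have alt u : B u u = 0 by exact: decomposable_alt BE u.
have alt' u : B' u u = 0 by exact: decomposable_alt BE' u.
have sk u w : B u w = - B w u by exact: decomposable_skew BE u w.
have sk' u w : B' u w = - B' w u by exact: decomposable_skew BE' u w.
have Bxy' : B' x0 y0 = 0 by exact: psiz.
have oddc u w : homog L true u -> B u w = 0 /\ B' u w = 0.
  move=> hu; split.
    by rewrite /B BE (t0 _ hu) (b0 _ hu) !mul0r subr0.
  by rewrite /B' BE' (t0' _ hu) (b0' _ hu) !mul0r subr0.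
have rad0 x y u : B x y = 1 ->
    exists2 u', (forall w, B u' w = 0) & u = B u y *: x + B x u *: y + u'.
  move=> Bxy; exists (u - B u y *: x - B x u *: y).
    by move=> w; exact: (decomposable_rad BE u w Bxy).
  by rewrite -[_ - _ - _]addrA -opprD [RHS]addrC subrK.
(* With r and s in the radical of [B], the Pfaffian of B + a B' reduces to a B'(r, s) - a^2 (B'(x,
   r) B'(y, s) - B'(x, s) B'(y, r)). Its vanishing at a = 1 and a = -1 separates the two
   coefficients. *)
have pf x y r s : B x y = 1 -> B' x y = 0 -> (forall w, B r w = 0) ->
    (forall w, B s w = 0) -> B' r s = 0 /\ B' x r * B' y s = B' x s * B' y r.
  move=> Bxy Bxy'0 Br Bs.
  have pfs (a : K) : a * B' r s - a * a * (B' x r * B' y s) + a * a * (B' x s * B' y r) = 0.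
    have [|||th'' [be'' [_ _ BE'']]] := dec (phi + a *: psi) z => //.
    - by rewrite add_lfunE scale_lfunE psiz [phi z]Bxy0 scaler0 addr0.
    - by move=> u hu; rewrite add_lfunE scale_lfunE psiodd // pp // scaler0 addr0.
    have := decomposable_pfaffian BE'' x y r s.
    rewrite !add_lfunE !scale_lfunE -!/(B _ _) -!/(B' _ _).
    rewrite Bxy Bxy'0 Br (sk x r) (sk y s) (sk x s) (sk y r) !Br !Bs !oppr0.
    rewrite !add0r /GRing.scale /= => <-; ring.
  have p1 := pfs 1; have pm1 := pfs (-1).
  have rs0 : B' r s = 0.
    have /eqP : 2 * B' r s = 0 by rewrite -[RHS](subrr 0) -{1}p1 -pm1; ring.
    by rewrite mulf_eq0 pnatr_eq0 /= => /eqP.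
  split=> //; apply/eqP; rewrite -subr_eq0 -oppr_eq0 -p1 rs0; apply/eqP; ring.
have sk2 u w : B' u w = 0 -> B' w u = 0 by move=> h; rewrite sk' h oppr0.
(* B' vanishes at (x0, y0) and on pairs from the radical of [B]. As it is not zero, some radical
   vector pairs nontrivially with x0 or y0. *)
have [c1 Bc1 Bc1'] : exists2 c, (forall w, B c w = 0) & (B' x0 c != 0) || (B' y0 c != 0).
  apply: contrapT => h.
  have r0 r : (forall w, B r w = 0) -> B' x0 r = 0 /\ B' y0 r = 0.
    move=> Br; split; apply: contrapT => /eqP nz; apply: h; exists r => //;
      by rewrite nz ?orbT.
  have B'0 u w : B' u w = 0.
    have [u' Bu' ->] := rad0 _ _ u Bxy0; have [w' Bw' ->] := rad0 _ _ w Bxy0.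
    have [xu yu] := r0 _ Bu'; have [xw yw] := r0 _ Bw'.
    rewrite !(bilinDl Bb') !(bilinDr Bb') !(bilinZl Bb') !(bilinZr Bb') !alt'.
    rewrite xw yw (sk2 _ _ xu) (sk2 _ _ yu) (pf _ _ _ _ Bxy0 Bxy' Bu' Bw').1.
    by rewrite Bxy' (sk2 _ _ Bxy') !mulr0 !addr0.
  have : (D <= lker psi)%VS.
    by apply: brspan_sub => u w _; rewrite memv_ker; apply/eqP; exact: B'0.
  by move/subvP/(_ t tD); rewrite memv_ker psit oner_eq0.
pose c := part Vp false c1; have hc : homog L false c by exact: part_homog.
have cE : c = c1 - part Vp true c1 by rewrite -[X in _ = X - _](part_add VpP false c1) addrK.
have Bc w : B c w = 0.
  by rewrite cE (bilinBl Bb) Bc1 (oddc _ w (part_homog VpP true c1)).1 subr0.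
have Bc' w : B' w c = B' w c1.
  rewrite cE (bilinBr Bb') (sk2 _ w (oddc _ w (part_homog VpP true c1)).2).
  by rewrite subr0.
move: Bc1'; rewrite -!Bc' => Bc1'.
(* A change of the pair that preserves [x, y] = z makes y commute with [c], so that x alone carries
   both brackets. *)
have [x [y [hx hy xyz yc xc]]] : exists x y, [/\ homog L false x, homog L false y,
    br L x y = z, B' y c = 0 & B' x c != 0].
  have [xc0|xc0] := eqVneq (B' x0 c) 0.
    exists y0, (- x0); split=> //; first exact: homogN.
    - by rewrite brNr -(br_evenC _ hx0).
    - by rewrite (bilinNl Bb') xc0 oppr0.
    by move: Bc1'; rewrite xc0 eqxx.
  exists x0, (y0 - (B' y0 c / B' x0 c) *: x0); split=> //.
  - by apply: homogB => //; exact: homogZ.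
  - by rewrite brBr brZr (br_even_self hx0) scaler0 subr0.
  by rewrite (bilinBl Bb') (bilinZl Bb') divfK // subrr.
have Bxy : B x y = 1 by rewrite /B xyz.
have Bxy'0 : B' x y = 0 by rewrite /B' xyz.
have cB w : B w c = 0 by rewrite sk Bc oppr0.
set t' := B' x c *: t.
have xct : br L x c = t' by rewrite brE cB scale0r add0r.
have yc0 : br L y c = 0 by rewrite brE cB yc !scale0r addr0.
have t'D : t' \in D by rewrite memvZ.
pose f (i : 'I_3) u := nth 0 [:: B u y; B x u; B' x u] i.
have fl i a u w : f i (a *: u + w) = a * f i u + f i w.
  by case: i => [[|[|[|//]]] hi]; rewrite /f /= (Bb.1, Bb.2, Bb'.2).
have [C CP] := kernel_space (Vp false) fl.
(* The three conditions defining [C] put u in the radical of [B]; then B'(y, u) = 0 as well, by the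
   proportionality in [pf] with B'(x, c) nonzero, and u is central. *)
have Cc u w : u \in C -> br L u w = 0.
  move=> /CP [uV fu].
  have uy : B u y = 0 by exact: (fu (@Ordinal 3 0 isT)).
  have xu : B x u = 0 by exact: (fu (@Ordinal 3 1 isT)).
  have xu' : B' x u = 0 by exact: (fu (@Ordinal 3 2 isT)).
  have [u' Bu' uE] := rad0 _ _ u Bxy.
  have {u' Bu' uE} Bu s : B u s = 0 by rewrite uE uy xu !scale0r !add0r.
  have yu' : B' y u = 0.
    have [_ e] := pf _ _ _ _ Bxy Bxy'0 Bc Bu.
    by move: e; rewrite xu' mul0r => /eqP; rewrite mulf_eq0 (negPf xc) => /eqP.
  rewrite brE Bu scale0r add0r; have [w' Bw' ->] := rad0 _ _ w Bxy.
  rewrite !(bilinDr Bb') !(bilinZr Bb') (sk2 _ _ xu') (sk2 _ _ yu').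
  by rewrite (pf _ _ _ _ Bxy Bxy'0 Bu Bw').1 !mulr0 !addr0 scale0r.
have dV : \dim (Vp false) = (\dim C + 3)%N.
  rewrite -[3%N]card_ord; apply/eqP; rewrite eqn_leq; apply/andP; split.
    by apply: (dim_le_coords fl) => u uV fu; apply/CP.
  apply: (dim_ge_coords fl) => [u /CP //|d].
  exists (d (@Ordinal 3 0 isT) *: x + d (@Ordinal 3 1 isT) *: y +
      (d (@Ordinal 3 2 isT) / B' x c) *: c).
    by rewrite !memvD ?memvZ //; apply/VpP.
  case=> [[|[|[|//]]] hi]; rewrite /f /= ?(bilinDl Bb) ?(bilinDr Bb) ?(bilinDr Bb')
    ?(bilinZl Bb) ?(bilinZr Bb) ?(bilinZr Bb').
  - rewrite alt Bxy Bc !mulr0 !addr0 mulr1; congr d; exact: val_inj.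
  - rewrite alt Bxy cB !mulr0 addr0 add0r mulr1; congr d; exact: val_inj.
  rewrite alt' Bxy'0 !mulr0 !add0r divfK //; congr d; exact: val_inj.
have DC : (D <= C)%VS.
  apply/subvP => d dD'; apply/CP; split; first exact/VpP/Dev.
  by case=> [[|[|[|//]]] hi]; rewrite /f /= /B /B' ?(Dc d) ?(Dcr d) // linear0.
(* The abelian summand consists of a complement of L' in the even center [C] together with the
   entire odd part. *)
pose A := (C :\: D)%VS.
have AD : (A + D = C)%VS by rewrite addv_diff (addv_idPl DC).
have dA : \dim C = (2 + \dim A)%N.
  by have := dimv_cap_compl C D; rewrite (capv_idPr DC) dD.
exists (\dim A), (\dim (Vp true)).
pose e (i : 'I_5 + 'I_0) : V := if i is inl i then nth 0 [:: x; y; c; z; t'] i else 0.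
pose a (j : 'I_(\dim A) + 'I_(\dim (Vp true))) := match j with
  | inl i => (vbasis A)`_i | inr i => (vbasis (Vp true))`_i end.
have aA j : match j with inl _ => a j \in A | inr _ => a j \in Vp true end.
  by case: j => j; rewrite /a vbasis_mem // mem_nth ?size_tuple.
have he i : homog L (tpar i) (e i).
  by case: i => [[[|[|[|[|[|//]]]]] hi]|[]//] //; exact: Dev.
have AC u : u \in A -> u \in C by apply/subvP; exact: diffvSl.
have ha j : homog L (tpar j) (a j).
  have := aA j; case: j => j /= aj; last exact/VpP.
  by have /CP [/VpP] := AC _ aj.
have ac j u : br L (a j) u = 0.
  have := aA j; case: j => j /= aj; first exact/Cc/AC.
  by move/VpP: aj => aj; rewrite brE !(oddc _ u aj).1 (oddc _ u aj).2 !scale0r addr0.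
have acr j u : br L u (a j) = 0.
  elim/(@homog_ind _ _ L): u => [u w|p u hu]; first by rewrite brDl => -> ->; rewrite addr0.
  by rewrite (br_skew hu (ha j)) ac scaler0 oppr0.
have s3 r : \sum_k (r *: tvec K (inl (inord 3) : 'I_5 + 'I_0)) k *: e k = r *: z.
  by rewrite tvec_scale /e inordK.
have s4 r : \sum_k (r *: tvec K (inl (inord 4) : 'I_5 + 'I_0)) k *: e k = r *: t'.
  by rewrite tvec_scale /e inordK.
have s0 : \sum_k (0 : tspace K 'I_5 'I_0) k *: e k = 0.
  by apply: big1 => k _; rewrite ffunE scale0r.
have bre i j : br L (e i) (e j) = \sum_k L5_table K i j k *: e k.
  have yx : br L y x = - z by rewrite (br_evenC _ hy) xyz.
  have cx : br L c x = - t' by rewrite (br_evenC _ hc) xct.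
  have cy : br L c y = 0 by rewrite (br_evenC _ hc) yc0 oppr0.
  case: i => [[[|[|[|[|[|//]]]]] hi]|[]//]; case: j => [[[|[|[|[|[|//]]]]] hj]|[]//];
    rewrite /L5_table /= ?s0 ?(br_even_self hx) ?(br_even_self hy) ?(br_even_self hc)
      ?(Dc z) ?(Dc t') ?(Dcr z) ?(Dcr t') ?yc0 ?cy //.
  - by rewrite xyz -[LHS]scale1r -s3 scale1r.
  - by rewrite xct -[LHS]scale1r -s4 scale1r.
  - by have := s3 (-1); rewrite !scaleN1r yx => ->.
  by have := s4 (-1); rewrite !scaleN1r cx => ->.
apply: (dsum_abel_iso _ _ _ he bre ha ac acr).
  by have := dim_parts VpP false; rewrite /= !card_ord => <-; rewrite dV dA; lia.
move=> u; pose u0 := part Vp false u; have hu0 : homog L false u0 by exact: part_homog.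
pose u1 := u0 - (B u0 y *: x + B x u0 *: y + (B' x u0 / B' x c) *: c).
have u1C : u1 \in C.
  apply/CP; split; first by rewrite !(memvB, memvD) ?memvZ //; apply/VpP.
  case=> [[|[|[|//]]] hi]; rewrite /f /= ?(bilinBl Bb) ?(bilinBr Bb) ?(bilinBr Bb')
    ?(bilinDl Bb) ?(bilinDr Bb) ?(bilinDr Bb')
    ?(bilinZl Bb) ?(bilinZr Bb) ?(bilinZr Bb').
  - by rewrite alt Bxy Bc !mulr0 !addr0 mulr1 subrr.
  - by rewrite alt Bxy cB !mulr0 addr0 add0r mulr1 subrr.
  by rewrite alt' Bxy'0 !mulr0 !add0r divfK // subrr.
move: u1C; rewrite -AD => /memv_addP [d dA' [d' dD' u1E]].
exists (fun i : 'I_5 + 'I_0 => if i is inl i then nth 0 [:: B u0 y; B x u0;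
  B' x u0 / B' x c; phi d'; psi d' / B' x c] i else 0).
exists (fun j => match j with inl i => coord (vbasis A) i d
    | inr i => coord (vbasis (Vp true)) i (part Vp true u) end).
rewrite !big_sumType /= -(coord_vbasis dA') -(coord_vbasis (part_mem Vp true u)).
rewrite [X in _ + X + _]big_ord0 addr0 !big_ord_recl big_ord0 /= addr0.
rewrite -{1}(part_add VpP false u) -/u0 /=.
rewrite -{1}[u0](subrK (B u0 y *: x + B x u0 *: y + (B' x u0 / B' x c) *: c)) -/u1 u1E.
have -> : (psi d' / B' x c) *: t' = psi d' *: t by rewrite scalerA divfK.
rewrite -(DE _ dD') [d + d' + _]addrC -!addrA.
by do 3![congr (_ + _)]; rewrite addrCA.
Qed.

End TwoDimensionalDerived.

(** * Deciding the criterion *)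

Section Classification.
Variables (K : numClosedFieldType) (V : vectType K) (L : lieSuper V).
Variable Vp : bool -> {vspace V}.
Hypothesis VpP : forall b x, homog L b x <-> x \in Vp b.
Hypothesis V0 : (fullv : {vspace V}) <> 0%VS.
Hypothesis Lnil : nilpotent L.
Local Notation D := (derived L).
Local Notation D2 := (brspan L (derived L)).
Local Notation v := (\dim {:V} - \dim D)%N.
Local Notation Z U := (Zspace L U).

Lemma top_exists : D != 0%VS -> exists b z (phi : 'Hom(V, K^o)),
  [/\ homog L b z, z \in D, phi z = 1, (forall x, x \in D2 -> phi x = 0) &
      forall x, homog L (~~ b) x -> phi x = 0].
Proof.
move=> D0; have [b [z [hz zD zD2]]] : exists b z, [/\ homog L b z, z \in D & z \notin D2].
  apply: contrapT => h; have /eqP := brspan_neq Lnil D0; apply; apply/eqP.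
  rewrite eqEsubv; apply/andP; split; first by apply: brspan_sub => u x _; exact: br_derived.
  apply/subvP => x xD; rewrite -(part_add VpP false x).
  have pD b : part Vp b x \in D2.
    apply: contrapT => /negP nD; apply: h; exists b, (part Vp b x); split=> //.
      exact: part_homog.
    exact: derived_graded.
  by rewrite memvD.
by have [phi [pz pD2 pp]] := top_functional VpP hz zD2; exists b, z, phi; split.
Qed.

Let criterion := (\dim (Z 0) + v = \dim (Z D) + \dim D * v + 'C(\dim D, 2) +
   \dim (D :&: Vp true))%N.

(** With L' = 0 the criterion reads v = 0, so L would be 0. For d >= 3 the last step would have to
    supply at least C(d, 2) >= 3, and it supplies at most 2. *)
Lemma criterion_dim_derived : criterion -> (0 < \dim D < 3)%N.
Proof.
rewrite /criterion => e; apply/andP; split.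
  rewrite lt0n dimv_eq0; apply/negP => /eqP D0; apply: V0.
  move: e; rewrite D0 dimv0 bin0n mul0n subn0 cap0v dimv0 !addn0 => e.
  by apply/eqP; rewrite -dimv_eq0; lia.
rewrite ltnNge; apply/negP => d3.
have D0 : D != 0%VS by rewrite -dimv_eq0; apply/eqP => h; rewrite h in d3.
have [b [z [phi [hz zD pz pD2 pp]]]] := top_exists D0.
have h1 := dim_Zspace_chain VpP Lnil (D1_graded VpP pp) (D2_D1 pD2) (D1_sub L phi).
have h2 := dim_top2 VpP hz zD pz pp.
have h3 := dim_D1 zD pz.
have h4 : (3 <= 'C(\dim D, 2))%N by apply: (leq_trans _ (leq_bin2l 2 d3)).
move: h1 h2 h3 e; set D1 := (D :&: lker phi)%VS; move: (v) => w h1 h2 h3.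
rewrite h3 mulnDl mul1n [(\dim D1 * w)%N]mulnC -h3 => e; lia.
Qed.

(** At d = 1 the terms in v cancel and the criterion reads dim Z(0) = dim Z(L') + dim (L' odd). *)
Lemma criterion_even_d1 p q k l : lie_iso L (dsum (H K p q) (abel K k l)) ->
  (0 < p + q)%N -> criterion <-> ~ (p = 1%N /\ q = 0%N).
Proof.
move=> iso pq; have [dD nD <-] := H_values VpP iso pq.
by rewrite /criterion dD nD bin_small //; split; lia.
Qed.

Lemma criterion_odd_d1 p k l : lie_iso L (dsum (Hodd K p) (abel K k l)) ->
  (0 < p)%N -> criterion <-> p = 1%N.
Proof.
move=> iso p0; have [dD nD <-] := Hodd_values VpP iso p0.
by rewrite /criterion dD nD bin_small //; split; lia.
Qed.

(** At d = 2 with L' even the criterion asks for dim Z(0) - dim Z(L') = v + 1. Here v = 2, and the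
    model has three free values. *)
Lemma criterion_L4 : lie_iso L (L4 K) -> criterion.
Proof.
move=> iso; have [dD nD ZE dV] := L4_values VpP iso.
have vE : v = 2%N by rewrite dD dV.
by rewrite /criterion vE ZE dD nD binn addn0 -!addnA.
Qed.

(** Here v = 3 + k + l, and the five free values of the model must equal v + 1. *)
Lemma criterion_L5 k l : lie_iso L (dsum (L5 K) (abel K k l)) ->
  criterion <-> (k + l = 1)%N.
Proof.
move=> iso; have [dD nD ZE dV] := L5_values VpP iso.
have vE : v = (3 + (k + l))%N by rewrite dD dV.
by rewrite /criterion vE ZE dD nD binn; move: (\dim (Z D)) => w; split; lia.
Qed.

Lemma criterionP : let m := \dim (Vp false) in let n := \dim (Vp true) in
  criterion <->
  (exists p q : nat,
      [/\ (2 <= p + q)%N, (2 * p + 1 <= m)%N, (q <= n)%N &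
          lie_iso L (dsum (H K p q) (abel K (m - (2 * p + 1))%N (n - q)%N))])
  \/ [/\ (1 <= m)%N, (1 <= n)%N &
         lie_iso L (dsum (H K 0 1) (abel K (m - 1)%N (n - 1)%N))]
  \/ [/\ (1 <= m)%N, (2 <= n)%N &
         lie_iso L (dsum (Hodd K 1) (abel K (m - 1)%N (n - 2)%N))]
  \/ lie_iso L (L4 K)
  \/ lie_iso L (dsum (L5 K) (abel K 1 0))
  \/ lie_iso L (dsum (L5 K) (abel K 0 1)).
Proof.
move=> m n; split=> [e|]; last first.
  case=> [[p [q [pq _ _ iso]]]|[[_ _ iso]|[[_ _ iso]|[iso|[iso|iso]]]]].
  - by apply/(criterion_even_d1 iso); lia.
  - by apply/(criterion_even_d1 iso); lia.
  - by apply/(criterion_odd_d1 iso).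
  - exact: criterion_L4.
  - by apply/(criterion_L5 iso).
  by apply/(criterion_L5 iso).
have /andP [d0 d3] := criterion_dim_derived e.
have D0 : D != 0%VS by rewrite -dimv_eq0 -lt0n.
have [d1|d1] := eqVneq (\dim D) 1%N.
  have [b [z [phi [hz zD pz pD2 pp]]]] := top_exists D0.
  case bE : b hz pp => hz pp.
    have [p [k [l [p0 iso dm dn]]]] := iso_odd_derived VpP hz zD pz pD2 pp d1 erefl.
    have p1 : p = 1%N by exact/(criterion_odd_d1 iso p0).
    have km : k = (m - 1)%N by rewrite /m dm p1 addKn.
    have ln : l = (n - 2)%N by rewrite /n dn p1 addKn.
    right; right; left; rewrite -km -ln -p1; split=> //.
      by rewrite /m dm leq_addr.
    by rewrite /n dn p1.
  have [p [q [k [l [pq iso dm dn]]]]] := iso_even_derived VpP hz zD pz pD2 pp d1 erefl.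
  have npq : ~ (p = 1%N /\ q = 0%N) by exact/(criterion_even_d1 iso pq).
  have km : k = (m - (2 * p + 1))%N by rewrite /m dm addKn.
  have ln : l = (n - q)%N by rewrite /n dn addKn.
  have [pq2|pq2] := leqP 2 (p + q).
    left; exists p, q; rewrite -km -ln; split=> //; first by rewrite /m dm leq_addr.
    by rewrite /n dn leq_addr.
  (* With p + q = 1 and H(1, 0) excluded by its extra cocycle, only H(0, 1) is left. *)
  have [p0 q1] : p = 0%N /\ q = 1%N by lia.
  right; left; move: iso; rewrite km ln p0 q1 => iso; split=> //.
    by rewrite /m dm addn1 addSn.
  by rewrite /n dn q1.
have d2 : \dim D = 2%N by lia.
have dZ : (\dim (Z 0) = \dim (Z D) + v + 1 + \dim (D :&: Vp true))%N.
  by move: e; rewrite /criterion d2 binn; lia.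
have [D20|D20] := eqVneq D2 0%VS; last first.
  by right; right; right; left; apply: (iso_L4 VpP Lnil d2 dZ D20).
have [k [l iso]] := iso_L5 VpP Lnil d2 dZ D20.
have kl : (k + l = 1)%N by exact/(criterion_L5 iso).
do 4!right; have [k0|k1] : k = 0%N \/ k = 1%N by lia.
  by right; move: iso; rewrite k0 (_ : l = 1)%N //; lia.
by left; move: iso; rewrite k1 (_ : l = 0)%N //; lia.
Qed.

End Classification.

Theorem theorem1p3 (R : realType) (V : vectType R[i]) (L : lieSuper V)
    (P : free_presentation L) (m n : nat) :
  (fullv : {vspace V}) <> 0%VS -> nilpotent L -> sdim L m n ->
  s_invariant P 2 <->
  (exists p q : nat,
      [/\ (2 <= p + q)%N, (2 * p + 1 <= m)%N, (q <= n)%N &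
          lie_iso L (dsum (H R[i] p q)
                          (abel R[i] (m - (2 * p + 1))%N (n - q)%N))])
  \/ [/\ (1 <= m)%N, (1 <= n)%N &
         lie_iso L (dsum (H R[i] 0 1) (abel R[i] (m - 1)%N (n - 1)%N))]
  \/ [/\ (1 <= m)%N, (2 <= n)%N &
         lie_iso L (dsum (Hodd R[i] 1) (abel R[i] (m - 1)%N (n - 2)%N))]
  \/ lie_iso L (L4 R[i])
  \/ lie_iso L (dsum (L5 R[i]) (abel R[i] 1 0))
  \/ lie_iso L (dsum (L5 R[i]) (abel R[i] 0 1)).
Proof.
move=> V0 Lnil [U0 [U1 [h0 h1 <- <-]]].
pose Vp (b : bool) := if b then U1 else U0.
have VpP b x : homog L b x <-> x \in Vp b by case: b; rewrite ?h0 ?h1.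
split=> [/(s_invariantP VpP)|h].
  by move/(criterionP VpP V0 Lnil).
by apply/(s_invariantP VpP)/(criterionP VpP V0 Lnil).
Qed.
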